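(* Let $U,V\in\mathcal{L}_2(\mathbb{R}^m)$, $Y:=(U,V)$, $\nu:=\mathrm{Law}(Y)$, $S$ the standard form on $\mathbb{R}^{2m}$, and let $(R,f)$ and $(Q,g)$ be $Y$-equilibria. (a) $\langle R-U,V-f(R)\rangle=\langle Q-U,V-g(Q)\rangle$ a.s. (b) If $\operatorname{supp}\nu=\mathbb{R}^{2m}$, then there exists a unique $H\in\mathcal{M}(S)$ optimal for the dual problem; the graphs of $f$ and $g$ are contained in $H$; in particular $C(f)=C(g)$ and $f(u)=g(u)$ for $u\in C(f)$. (c) Assume that the interior of the convex hull of $\operatorname{supp}\nu$ is non-empty and that conditions (A1), (A2), (A3) below hold. Then $f(R)=g(Q)$ a.s. If, in addition, $f$ and $g$ are monotone or $Y\in\operatorname{int}(\operatorname{supp}\nu)$ a.s., then $R=Q$ a.s.; in this case $X:=(R,f(R))$ is the unique optimal map and $\mathrm{Law}(X,Y)$ is the unique optimal plan. Conditions: (A1) $h(SY)\ne0$ a.s. for every $h\in\mathcal{H}^j_C$ with $j\in\{1,\dots,2m\}$ and compact $C\subset\{x:x^j=1,\ S(x,x)>0\}$; (A2) if $m=1$, then for every $S$-isotropic $w$ the random variable $S(Y,w)$ has a continuous distribution function; (A3) if $m>1$, then $\nu(D)=0$ for every $D\in\mathcal{E}_0(S)$.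
   Context: Standard form on $\mathbb{R}^{2m}$: $S((r,s),(u,v)):=\langle s,u\rangle+\langle r,v\rangle$. $w$ is $S$-isotropic if $|w|>0$ and $S(w,w)=0$. $G$ is $S$-monotone if $S(x-y,x-y)\ge0$ for $x,y\in G$; maximal if not a strict subset of another $S$-monotone set; $\mathcal{M}(S)$ = family of maximal $S$-monotone sets; $\psi_G(y):=\sup_{x\in G}(S(x,y)-\frac12S(x,x))$. For $x\in\mathbb{R}^{2m}$, $x^{-j}$ is $x$ without its $j$-th coordinate; for compact $C$ with $y^j=1$ on $C$, $\mathcal{H}^j_C$ is the family of $h(x)=x^j+g_1(x^{-j})-g_2(x^{-j})$ with $g_1,g_2$ convex of linear growth and $\nabla h(x)\in C$ whenever $g_1,g_2$ differentiable at $x^{-j}$. $\mathcal{E}_0(S)$: Borel sets $D$ such that for every $\delta>0$ there are $j_n$, compact $C_n\subset\{x:x^{j_n}=1,\ 0\le S(x,x)\le\delta\}$ and $h_n\in\mathcal{H}^{j_n}_{C_n}$ with $D\subset\bigcup_n\{x:h_n(Sx)=0\}$. $\mathcal{X}(Y):=\{X\in\mathcal{L}_2(\mathbb{R}^{2m}):X\ Y\text{-measurable},\ \mathbb{E}[Y|X]=X\}$; optimal map: maximizer of $\frac12\mathbb{E}[S(X,Y)]$ over $\mathcal{X}(Y)$. $\Gamma(\nu)$: Borel probability measures on $\mathbb{R}^{2m}\times\mathbb{R}^{2m}$ (coordinates $(x,y)$) with finite second moments, second marginal $\nu$, conditional expectation of $y$ given $x$ equal to $x$; optimal plan: maximizer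 of $\frac12\int S d\gamma$. Optimal set of dual problem: minimizer of $\int\psi_G d\nu$ over $\mathcal{M}(S)$. $f$ monotone: $\langle u-r,f(u)-f(r)\rangle\ge0$. $C(f)$: set of points where $f$ is continuous. For $R\in\mathcal{L}_2(\mathbb{R}^m)$ $Y$-measurable and Borel $f:\mathbb{R}^m\to\mathbb{R}^m$, $(R,f)$ is a $Y$-equilibrium if $f(R)=\mathbb{E}[V|R]$ and a.s. $R\in\operatorname{argmax}_{r}\langle r-U,V-f(r)\rangle$. *)

(* Defs.v *)
From HB Require Import structures.
From mathcomp Require Import all_boot all_order all_algebra.
From mathcomp Require Import all_classical all_reals all_analysis.
Import Order.TTheory GRing.Theory Num.Theory.
Import numFieldNormedType.Exports.

Set Implicit Arguments.
Unset Strict Implicit.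
Unset Printing Implicit Defensive.

Local Open Scope classical_set_scope.
Local Open Scope ring_scope.

(* Conventions: R^n is 'rV[R]_n (row vectors, with their canonical topology).
   A point of R^{2m} is x = row_mx r s, (r,s) in R^m x R^m, i.e. 'rV[R]_(m+m). *)

Section defs.
Variable R : realType.

Definition dotv (n : nat) (a b : 'rV[R]_n) : R := \sum_(i < n) a 0 i * b 0 i.

Definition borel_rV (n : nat) : set (set 'rV[R]_n) := <<s [set A | open A] >>.

Definition borel_fun (n k : nat) (f : 'rV[R]_n -> 'rV[R]_k) : Prop :=
  forall B, borel_rV B -> borel_rV (f @^-1` B).

Definition Sform (m : nat) (x y : 'rV[R]_(m + m)) : R :=
  dotv (rsubmx x) (lsubmx y) + dotv (lsubmx x) (rsubmx y).

(* the linear map S with S(x,y) = <Sx, y>: S(r,s) = (s,r) *)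
Definition Smap (m : nat) (x : 'rV[R]_(m + m)) : 'rV[R]_(m + m) :=
  row_mx (rsubmx x) (lsubmx x).

Definition S_isotropic (m : nat) (w : 'rV[R]_(m + m)) : Prop :=
  0 < `|w| /\ Sform w w = 0.

Definition S_monotone (m : nat) (G : set 'rV[R]_(m + m)) : Prop :=
  forall x y, G x -> G y -> 0 <= Sform (x - y) (x - y).

Definition maximal_S_monotone (m : nat) (G : set 'rV[R]_(m + m)) : Prop :=
  S_monotone G /\ forall G', S_monotone G' -> G `<=` G' -> G' = G.

Definition psi (m : nat) (G : set 'rV[R]_(m + m)) (y : 'rV[R]_(m + m)) : \bar R :=
  ereal_sup [set ((Sform x y - Sform x x / 2)%:E) | x in G].

Definition graph_of (m : nat) (f : 'rV[R]_m -> 'rV[R]_m) : set 'rV[R]_(m + m) :=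
  [set row_mx u (f u) | u in [set: 'rV[R]_m]].

Definition cont_points (m : nat) (f : 'rV[R]_m -> 'rV[R]_m) : set 'rV[R]_m :=
  [set u | {for u, continuous f}].

Definition monotone_map (m : nat) (f : 'rV[R]_m -> 'rV[R]_m) : Prop :=
  forall u r, 0 <= dotv (u - r) (f u - f r).

Definition convex_rV (n : nat) (A : set 'rV[R]_n) : Prop :=
  forall x y (t : R), A x -> A y -> 0 <= t -> t <= 1 -> A (t *: x + (1 - t) *: y).

Definition conv_hull (n : nat) (A : set 'rV[R]_n) : set 'rV[R]_n :=
  \bigcap_(B in [set B : set 'rV[R]_n | convex_rV B /\ A `<=` B]) B.

Definition convex_fun (n : nat) (g : 'rV[R]_n -> R) : Prop :=
  forall x y (t : R), 0 <= t -> t <= 1 ->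
    g (t *: x + (1 - t) *: y) <= t * g x + (1 - t) * g y.

Definition linear_growth (n : nat) (g : 'rV[R]_n -> R) : Prop :=
  exists c : R, forall z, `|g z| <= c * (1 + `|z|).

Definition grad (n : nat) (h : 'rV[R]_n -> R) (x : 'rV[R]_n) : 'rV[R]_n :=
  \row_(k < n) ('D_(delta_mx 0 k) h x : R).

Definition in_H (m : nat) (j : 'I_(m + m)) (C : set 'rV[R]_(m + m))
    (h : 'rV[R]_(m + m) -> R) : Prop :=
  exists (g1 g2 : 'rV[R]_(m + m).-1 -> R),
    [/\ convex_fun g1, convex_fun g2, linear_growth g1 & linear_growth g2] /\
        (forall x, h x = x 0 j + g1 (col' j x) - g2 (col' j x)) /\
        (forall x, differentiable g1 (col' j x) -> differentiable g2 (col' j x) ->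
           C (grad h x)).

Definition E0 (m : nat) (D : set 'rV[R]_(m + m)) : Prop :=
  borel_rV D /\
  forall delta : R, 0 < delta ->
    exists (js : nat -> 'I_(m + m)) (Cs : nat -> set 'rV[R]_(m + m))
           (hs : nat -> 'rV[R]_(m + m) -> R),
      (forall n, [/\ compact (Cs n),
          Cs n `<=` [set x : 'rV[R]_(m + m) | x 0 (js n) = 1 /\ 0 <= Sform x x <= delta] &
          in_H (js n) (Cs n) (hs n)]) /\
      D `<=` \bigcup_n [set x | hs n (Smap x) = 0].

Definition open_pair (m : nat) : set (set ('rV[R]_(m + m) * 'rV[R]_(m + m))) :=
  [set A | open A].

Definition pairspace (m : nat) := g_sigma_algebraType (@open_pair m).

End defs.

Section prob.
Context {R : realType} {d : measure_display} {T : measurableType d}.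
Variable P : probability T R.

Definition rvec (n : nat) (X : T -> 'rV[R]_n) : Prop :=
  forall i : 'I_n, measurable_fun setT (fun w => X w 0 i).

Definition L2 (n : nat) (X : T -> 'rV[R]_n) : Prop :=
  rvec X /\ forall i : 'I_n, P.-integrable setT (fun w => ((X w 0 i) ^+ 2)%:E).

Definition meas_wrt (n k : nat) (Y : T -> 'rV[R]_n) (X : T -> 'rV[R]_k) : Prop :=
  forall B, borel_rV B -> exists B', borel_rV B' /\ X @^-1` B = Y @^-1` B'.

(* Z = E[W | X] (Z sigma(X)-measurable is required separately) :
   Z integrable and E[W 1_{X in B}] = E[Z 1_{X in B}] for all Borel B *)
Definition is_condexp (n k : nat) (W : T -> 'rV[R]_k) (X : T -> 'rV[R]_n)
    (Z : T -> 'rV[R]_k) : Prop :=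
  rvec Z /\
  (forall i, P.-integrable setT (fun w => (Z w 0 i)%:E)) /\
  forall B, borel_rV B -> forall i : 'I_k,
    (\int[P]_(w in X @^-1` B) (W w 0 i)%:E = \int[P]_(w in X @^-1` B) (Z w 0 i)%:E)%E.

Definition pairY (m : nat) (U V : T -> 'rV[R]_m) : T -> 'rV[R]_(m + m) :=
  fun w => row_mx (U w) (V w).

Definition Y_equilibrium (m : nat) (U V : T -> 'rV[R]_m)
    (Rv : T -> 'rV[R]_m) (f : 'rV[R]_m -> 'rV[R]_m) : Prop :=
  [/\ L2 Rv, meas_wrt (pairY U V) Rv, borel_fun f,
      is_condexp V Rv (fun w => f (Rv w)) &
      {ae P, forall w, forall r : 'rV[R]_m,
          dotv (r - U w) (V w - f r) <= dotv (Rv w - U w) (V w - f (Rv w))}].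

Definition supp_law (n : nat) (Y : T -> 'rV[R]_n) : set 'rV[R]_n :=
  [set x | forall e : R, 0 < e -> (0 < P (Y @^-1` ball x e))%E].

Definition dual_value (m : nat) (Y : T -> 'rV[R]_(m + m)) (G : set 'rV[R]_(m + m)) : \bar R :=
  (\int[P]_w psi G (Y w))%E.

Definition dual_optimal (m : nat) (Y : T -> 'rV[R]_(m + m)) (H : set 'rV[R]_(m + m)) : Prop :=
  maximal_S_monotone H /\
  forall G, maximal_S_monotone G -> (dual_value Y H <= dual_value Y G)%E.

Definition admissible_map (m : nat) (Y X : T -> 'rV[R]_(m + m)) : Prop :=
  [/\ L2 X, meas_wrt Y X & is_condexp Y X X].

Definition map_value (m : nat) (Y X : T -> 'rV[R]_(m + m)) : \bar R :=
  (\int[P]_w (Sform (X w) (Y w) / 2)%:E)%E.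

Definition optimal_map (m : nat) (Y X : T -> 'rV[R]_(m + m)) : Prop :=
  admissible_map Y X /\
  forall X', admissible_map Y X' -> (map_value Y X' <= map_value Y X)%E.

Definition admissible_plan (m : nat) (Y : T -> 'rV[R]_(m + m))
    (gam : probability (pairspace R m) R) : Prop :=
  [/\ gam.-integrable setT
        (fun z : pairspace R m => (\sum_(k < m + m) (z.1 0 k ^+ 2 + z.2 0 k ^+ 2))%:E),
      (forall B, borel_rV B -> gam [set z : pairspace R m | B z.2] = P (Y @^-1` B)) &
      (forall A, borel_rV A -> forall k : 'I_(m + m),
        (\int[gam]_(z in [set z : pairspace R m | A z.1]) (z.2 0 k)%:E =
         \int[gam]_(z in [set z : pairspace R m | A z.1]) (z.1 0 k)%:E)%E)].

Definition plan_value (m : nat) (gam : probability (pairspace R m) R) : \bar R :=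
  (\int[gam]_z (Sform (z : pairspace R m).1 z.2 / 2)%:E)%E.

Definition optimal_plan (m : nat) (Y : T -> 'rV[R]_(m + m))
    (gam : probability (pairspace R m) R) : Prop :=
  admissible_plan Y gam /\
  forall gam', admissible_plan Y gam' -> (plan_value gam' <= plan_value gam)%E.

Definition law_pair (m : nat) (X Y : T -> 'rV[R]_(m + m)) (A : set (pairspace R m)) : \bar R :=
  P ((fun w => (X w, Y w) : pairspace R m) @^-1` A).

Definition unique_optimal_map (m : nat) (Y X : T -> 'rV[R]_(m + m)) : Prop :=
  optimal_map Y X /\
  forall X', optimal_map Y X' -> {ae P, forall w, X' w = X w}.

Definition unique_optimal_plan (m : nat) (Y X : T -> 'rV[R]_(m + m)) : Prop :=
  (exists gam, optimal_plan Y gam /\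
     forall A, measurable A -> gam A = law_pair X Y A) /\
  forall gam', optimal_plan Y gam' ->
     forall A, measurable A -> gam' A = law_pair X Y A.

End prob.

(* Main.v *)
(* Write gap G y = sup_{x in G} - S(x - y, x - y) / 2, so that psi_G = gap G + S / 2.
   If X is a martingale map for Y (that is, E[Y | X] = X), then E[- S(X - Y, X - Y) / 2]
   is at most E[gap G Y] whenever gap G >= 0, and equality forces X to lie in the polar
   {x | S(g - x, g - x) >= 0 for g in G} and to attain gap G Y almost surely.  For an
   equilibrium (R, f) the graph of f attains its gap at (R, f(R)) and
   Z = (E[U | R], f(R)) has the same value, so equality holds for Z; this gives (a), and
   (b) because a convex function is determined by its values on a dense set.
   For (c), two distinct maximisers, one in the polar and one in the closure of the
   graph, put y on one of countably many graphs of differences of convex functions with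
   normals in prescribed compact sets; (A1)-(A3) make these null.  Hence Z = (R, f(R)),
   and every optimal map or plan is carried by the same unique maximisers. *)
Require Import Defs.
From HB Require Import structures.
From mathcomp Require Import all_boot all_order all_algebra.
From mathcomp Require Import all_classical all_reals all_analysis.
From mathcomp Require Import measurable_realfun.
From mathcomp Require Import ring lra.
Import Order.TTheory GRing.Theory Num.Theory.
Import numFieldNormedType.Exports.
Import HBSimple HBNNSimple.
Local Open Scope classical_set_scope.
Local Open Scope ring_scope.

Set Implicit Arguments.
Unset Strict Implicit.
Unset Printing Implicit Defensive.

(** * Scalar products and the form S *)

(** An equilibrium does not say that E[U | R] = R, so (R, f(R)) is not known to be a martingale map
    and the duality cannot be applied to it directly. Replacing R by E[U | R] costs nothing: the
    value changes by E<R - E[U | R], V - f(R)>, which vanishes because f(R) = E[V | R]. Under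
    (A1)-(A3), uniqueness of maximisers gives back E[U | R] = R. Nor is the graph of f known to be
    monotone. The one property of G that drives the duality is gap G >= 0. It holds for every graph,
    since y can be compared with the graph point that has the same first component and the
    difference is then isotropic or zero, and it holds for every maximal monotone set. It also lets
    gap G be integrated in [0, +oo] before anything is known about integrability. The duality is
    proved for an arbitrary pair (X, Y) on an arbitrary probability space, so that a plan is the
    pair of its two coordinates on the product space. *)

Lemma dotvC (R : realType) n (x y : 'rV[R]_n) : dotv x y = dotv y x.
Proof. by apply: eq_bigr => i _; rewrite mulrC. Qed.

Lemma dotvDl (R : realType) n (x y z : 'rV[R]_n) :
  dotv (x + y) z = dotv x z + dotv y z.
Proof. by rewrite -big_split; apply: eq_bigr => i _; rewrite mxE mulrDl. Qed.

Lemma dotvZl (R : realType) n (c : R) (x y : 'rV[R]_n) :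
  dotv (c *: x) y = c * dotv x y.
Proof. by rewrite /dotv mulr_sumr; apply: eq_bigr => i _; rewrite mxE mulrA. Qed.

Lemma dotvNl (R : realType) n (x y : 'rV[R]_n) : dotv (- x) y = - dotv x y.
Proof. by rewrite -scaleN1r dotvZl mulN1r. Qed.

Lemma dotvDr (R : realType) n (x y z : 'rV[R]_n) :
  dotv x (y + z) = dotv x y + dotv x z.
Proof. by rewrite !(dotvC x) dotvDl. Qed.

Lemma dotvZr (R : realType) n (c : R) (x y : 'rV[R]_n) :
  dotv x (c *: y) = c * dotv x y.
Proof. by rewrite !(dotvC x) dotvZl. Qed.

Lemma dotvNr (R : realType) n (x y : 'rV[R]_n) : dotv x (- y) = - dotv x y.
Proof. by rewrite !(dotvC x) dotvNl. Qed.

Definition dotv_lin := (dotvDl, dotvDr, dotvNl, dotvNr, dotvZl, dotvZr).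

Lemma dotv0r (R : realType) n (x : 'rV[R]_n) : dotv x 0 = 0.
Proof. by rewrite -(scale0r 0) dotvZr mul0r. Qed.

Lemma dotv_delta (R : realType) n (x : 'rV[R]_n) k : dotv x (delta_mx 0 k) = x 0 k.
Proof.
rewrite /dotv (bigD1 k)//= mxE !eqxx mulr1 big1 ?addr0// => i ik.
by rewrite mxE (negPf ik) andbF mulr0.
Qed.

Lemma lsubmxD (R : realType) m (x y : 'rV[R]_(m + m)) :
  lsubmx (x + y) = lsubmx x + lsubmx y.
Proof. exact: raddfD. Qed.
Lemma rsubmxD (R : realType) m (x y : 'rV[R]_(m + m)) :
  rsubmx (x + y) = rsubmx x + rsubmx y.
Proof. exact: raddfD. Qed.

Lemma SformC (R : realType) m (x y : 'rV[R]_(m + m)) : Sform x y = Sform y x.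
Proof. by rewrite /Sform addrC (dotvC (lsubmx x)) (dotvC (rsubmx x)). Qed.

Lemma SformDl (R : realType) m (x y z : 'rV[R]_(m + m)) :
  Sform (x + y) z = Sform x z + Sform y z.
Proof. by rewrite /Sform lsubmxD rsubmxD !dotvDl; ring. Qed.

Lemma SformZl (R : realType) m (c : R) (x y : 'rV[R]_(m + m)) :
  Sform (c *: x) y = c * Sform x y.
Proof.
have rZ : rsubmx (c *: x) = c *: rsubmx x by apply/rowP => i; rewrite !mxE.
have lZ : lsubmx (c *: x) = c *: lsubmx x by apply/rowP => i; rewrite !mxE.
by rewrite /Sform rZ lZ !dotvZl; ring.
Qed.

Lemma SformNl (R : realType) m (x y : 'rV[R]_(m + m)) : Sform (- x) y = - Sform x y.
Proof. by rewrite -scaleN1r SformZl mulN1r. Qed.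

Lemma SformDr (R : realType) m (x y z : 'rV[R]_(m + m)) :
  Sform x (y + z) = Sform x y + Sform x z.
Proof. by rewrite !(SformC x) SformDl. Qed.

Lemma SformZr (R : realType) m (c : R) (x y : 'rV[R]_(m + m)) :
  Sform x (c *: y) = c * Sform x y.
Proof. by rewrite !(SformC x) SformZl. Qed.

Lemma SformNr (R : realType) m (x y : 'rV[R]_(m + m)) : Sform x (- y) = - Sform x y.
Proof. by rewrite !(SformC x) SformNl. Qed.

Definition Sform_lin := (SformDl, SformDr, SformNl, SformNr, SformZl, SformZr).

Lemma Sform_row (R : realType) m (a b c d : 'rV[R]_m) :
  Sform (row_mx a b) (row_mx c d) = dotv b c + dotv a d.
Proof. by rewrite /Sform !row_mxKl !row_mxKr. Qed.

Lemma Sform_Smap (R : realType) m (x y : 'rV[R]_(m + m)) :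
  Sform x y = dotv x (Smap y).
Proof.
rewrite /Sform /dotv big_split_ord/= addrC; congr (_ + _); apply: eq_bigr => i _.
  by rewrite /Smap row_mxEr !mxE.
by rewrite /Smap row_mxEl !mxE.
Qed.

(** * The maximum norm; limits and continuity by coordinates *)

Lemma norm_rV_le (R : realType) n (x : 'rV[R]_n) (e : R) : 0 <= e ->
  (`|x| <= e) <-> (forall i, `|x 0 i| <= e).
Proof.
move=> e0; change `|x| with (mx_norm x); rewrite mx_normrE; split.
  by move=> /bigmax_leP[_ h] i; exact: (h (0, i)).
by move=> h; apply/bigmax_leP; split => // -[i j] _ /=; rewrite ord1.
Qed.

Lemma norm_rV_lt (R : realType) n (x : 'rV[R]_n) (e : R) : 0 < e ->
  (`|x| < e) <-> (forall i, `|x 0 i| < e).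
Proof.
move=> e0; change `|x| with (mx_norm x); rewrite mx_normrE; split.
  by move=> /bigmax_ltP[_ h] i; exact: (h (0, i)).
by move=> h; apply/bigmax_ltP; split => // -[i j] _ /=; rewrite ord1.
Qed.

Lemma norm_coord_le (R : realType) n (x : 'rV[R]_n) i : `|x 0 i| <= `|x|.
Proof. by have /norm_rV_le := lexx `|x|; apply. Qed.

Lemma norm_dotv_le (R : realType) n (x y : 'rV[R]_n) :
  `|dotv x y| <= n%:R * `|x| * `|y|.
Proof.
apply: le_trans (ler_norm_sum _ _ _) _.
apply: (@le_trans _ _ (\sum_(i < n) `|x| * `|y|)).
  by apply: ler_sum => i _; rewrite normrM ler_pM// norm_coord_le.
by rewrite sumr_const card_ord -mulrA mulr_natl.
Qed.

Lemma cvg_rV (R : realType) n (T : Type) (F : set_system T) (FF : Filter F)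
    (f : T -> 'rV[R]_n) (y : 'rV[R]_n) :
  (forall i, f x 0 i @[x --> F] --> y 0 i) -> f @ F --> y.
Proof.
move=> h; apply/cvgrPdist_lt => e e0.
have : \forall x \near F, forall i, `|y 0 i - f x 0 i| < e.
  by apply: filter_forall => i; have /cvgrPdist_lt := h i; exact.
apply: filterS => x hx; apply/norm_rV_lt => // i; by rewrite !mxE.
Qed.

Lemma continuous_rV (R : realType) n (T : topologicalType) (f : T -> 'rV[R]_n) :
  (forall i, continuous (fun x => f x 0 i)) -> continuous f.
Proof. by move=> h x; apply: cvg_rV => i; exact: h. Qed.

Lemma continuous_coord (R : realType) n (T : topologicalType) (f : T -> 'rV[R]_n) i :
  continuous f -> continuous (fun x => f x 0 i).
Proof. move=> cf x; apply: (@continuous_comp _ _ _ f (fun M : 'rV[R]_n => M 0 i)).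
  exact: cf.
exact: coord_continuous. Qed.

Lemma continuous_dotv (R : realType) n (T : topologicalType) (f g : T -> 'rV[R]_n) :
  continuous f -> continuous g -> continuous (fun x => dotv (f x) (g x)).
Proof.
move=> cf cg; apply: continuous_big => [|i _ x]; first exact: add_continuous.
by apply: cvgM; apply: continuous_coord.
Qed.

Lemma continuous_lsubmx (R : realType) m : continuous (@lsubmx R 1 m m).
Proof.
apply: continuous_rV => i; under eq_fun do rewrite mxE; exact: coord_continuous.
Qed.

Lemma continuous_rsubmx (R : realType) m : continuous (@rsubmx R 1 m m).
Proof.
apply: continuous_rV => i; under eq_fun do rewrite mxE; exact: coord_continuous.
Qed.

Lemma continuous_Smap (R : realType) m : continuous (@Smap R m).
Proof.
apply: continuous_rV => i; rewrite /Smap.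
case: (split_ordP i) => k ->.
  by under eq_fun do rewrite row_mxEl mxE; exact: coord_continuous.
by under eq_fun do rewrite row_mxEr mxE; exact: coord_continuous.
Qed.

Lemma continuous_Sform (R : realType) m (T : topologicalType)
    (f g : T -> 'rV[R]_(m + m)) :
  continuous f -> continuous g -> continuous (fun x => Sform (f x) (g x)).
Proof.
move=> cf cg; under eq_fun do rewrite Sform_Smap.
apply: continuous_dotv => // x; apply: continuous_comp; first exact: cg.
exact: continuous_Smap.
Qed.

Lemma continuous_subv (R : realType) n (T : topologicalType) (f g : T -> 'rV[R]_n) :
  continuous f -> continuous g -> continuous (fun x => f x - g x).
Proof. by move=> cf cg x; apply: cvgB; [exact: cf|exact: cg]. Qed.

Lemma continuous_oppf (R : realType) (T : topologicalType) (f : T -> R) :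
  continuous f -> continuous (fun x => - f x).
Proof. by move=> cf x; apply: cvgN; exact: cf. Qed.

Lemma continuous_addf (R : realType) (T : topologicalType) (f g : T -> R) :
  continuous f -> continuous g -> continuous (fun x => f x + g x).
Proof. by move=> cf cg x; apply: cvgD; [exact: cf|exact: cg]. Qed.

Lemma continuous_mulf (R : realType) (T : topologicalType) (f g : T -> R) :
  continuous f -> continuous g -> continuous (fun x => f x * g x).
Proof. by move=> cf cg x; apply: cvgM; [exact: cf|exact: cg]. Qed.

Lemma continuous_normv (R : realType) n (T : topologicalType) (f : T -> 'rV[R]_n) :
  continuous f -> continuous (fun x => `|f x|).
Proof. by move=> cf x; apply: cvg_norm; exact: cf. Qed.

(** * Convex functions are continuous *)

(** [M] bounds the rise of g from y to y + e and from y to y - e; on each side g stays below the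
    chord, so it rises by at most |t| * M. *)
Lemma convex_usc_line (R : realType) n (g : 'rV[R]_n -> R) (y e : 'rV[R]_n) (eps : R) :
  convex_fun g -> 0 < eps ->
  exists2 d : R, 0 < d & forall t, `|t| < d -> g (y + t *: e) <= g y + eps.
Proof.
move=> cg eps0.
pose M : R := `|g (y + e) - g y| + `|g (y - e) - g y| + 1.
have M0 : 0 < M by rewrite /M ltr_wpDl// addr_ge0.
exists (Num.min 1 (eps / M)); first by rewrite lt_min ltr01/= divr_gt0.
move=> t; rewrite lt_min => /andP[t1 tM].
have tME : `|t| * M <= eps by rewrite -ler_pdivlMr// ltW.
have key (s : R) (v : 'rV[R]_n) : 0 <= s -> s <= 1 -> `|g (y + v) - g y| <= M ->
    s * M <= eps -> g (y + s *: v) <= g y + eps.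
  move=> s0 s1 hv sM; have := cg (y + v) y s s0 s1.
  rewrite (_ : s *: (y + v) + (1 - s) *: y = y + s *: v); last first.
    by apply/rowP => k; rewrite !mxE; ring.
  move=> /le_trans; apply; have := ler_norm (g (y + v) - g y); nra.
have [t0|t0] := leP 0 t.
  move: t1 tME; rewrite ger0_norm// => t1 tM'; apply: key => //; first exact: ltW.
  by rewrite /M -addrA lerDl addr_ge0.
move: t1 tME; rewrite ltr0_norm// => t1 tM'.
rewrite (_ : t *: e = (- t) *: (- e)); last by rewrite scalerN scaleNr opprK.
apply: key => //; [by rewrite oppr_ge0 ltW|exact: ltW|].
by rewrite /M addrAC lerDr addr_ge0.
Qed.

(** Induction on the coordinates of x that may be nonzero: y + x is the midpoint of y + 2 x', where
    x' has no i-th coordinate, and of a point on the line through y in direction i. Two bounds by g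
    y + eps average to a third. *)
Lemma convex_usc (R : realType) n (g : 'rV[R]_n -> R) (y : 'rV[R]_n) (eps : R) :
  convex_fun g -> 0 < eps ->
  exists2 d : R, 0 < d & forall x, `|x| < d -> g (y + x) <= g y + eps.
Proof.
move=> cg eps0.
suff [d d0 h] : exists2 d : R, 0 < d & forall x : 'rV[R]_n,
    (forall i, i \notin enum 'I_n -> x 0 i = 0) -> `|x| < d -> g (y + x) <= g y + eps.
  by exists d => // x xd; apply: h => // i; rewrite mem_enum.
elim: (enum 'I_n) => [|i s [d d0 IH]].
  exists 1 => // x x0 _; have -> : x = 0 by apply/rowP => i; rewrite mxE x0.
  by rewrite addr0 lerDl ltW.
have [d' d'0 hd'] := @convex_usc_line R n g y (delta_mx 0 i) eps cg eps0.
exists (Num.min d d' / 2); first by rewrite divr_gt0// lt_min d0.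
move=> x xs xd; pose x' := x - x 0 i *: delta_mx 0 i.
have x'E k : x' 0 k = if k == i then 0 else x 0 k.
  rewrite !mxE eqxx/=; case: eqP => [->|_]; first by rewrite mulr1 subrr.
  by rewrite mulr0 subr0.
have d2 : 0 < Num.min d d' / 2 by rewrite divr_gt0// lt_min d0.
have mind : Num.min d d' <= d by rewrite ge_min lexx.
have mind' : Num.min d d' <= d' by rewrite ge_min lexx orbT.
have h1 : g (y + 2 *: x') <= g y + eps.
  apply: IH => [k ks|].
    rewrite mxE x'E; case: ifPn => [_|ki]; first by rewrite mulr0.
    by rewrite xs ?mulr0// inE negb_or ki.
  rewrite normrZ ger0_norm//; suff : `|x'| < Num.min d d' / 2 by lra.
  apply/norm_rV_lt => // k; rewrite x'E; case: ifPn => _; first by rewrite normr0.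
  by apply: le_lt_trans xd; exact: norm_coord_le.
have h2 : g (y + (2 * x 0 i) *: delta_mx 0 i) <= g y + eps.
  apply: hd'; rewrite normrM ger0_norm//; have := norm_coord_le x i; lra.
have := cg (y + 2 *: x') (y + (2 * x 0 i) *: delta_mx 0 i) (2^-1).
rewrite invr_ge0 ler0n invf_le1// ler1n => /(_ isT isT).
rewrite (_ : _ *: _ + _ *: _ = y + x); last first.
  by apply/rowP => k; rewrite !mxE; field; lra.
lra.
Qed.

(** The lower bound at x comes from the upper bound at the reflected point 2 y - x, because y is the
    midpoint of the two. *)
Lemma convex_continuous (R : realType) n (g : 'rV[R]_n -> R) :
  convex_fun g -> continuous g.
Proof.
move=> cg y; apply/(@cvgrPdist_le R R _ (nbhs y)) => e e0.
have [d d0 h] := @convex_usc R n g y e cg e0.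
near=> x.
have xd : `|x - y| < d by rewrite distrC; near: x; exact: cvgr_dist_lt.
have h1 := h _ xd; rewrite addrC subrK in h1.
have h2 : g (y - (x - y)) <= g y + e by apply: h; rewrite normrN.
have := cg x (y - (x - y)) (2^-1).
rewrite invr_ge0 ler0n invf_le1// ler1n => /(_ isT isT).
rewrite (_ : _ *: _ + _ *: _ = y); last by apply/rowP => k; rewrite !mxE; field; lra.
by move=> h3; rewrite ler_norml; apply/andP; split; lra.
Unshelve. all: by end_near. Qed.

(** Coordinates are made exact one at a time: two points of C, exact in the coordinates already
    treated and close to a plus and minus (e / 2) times the i-th unit vector, straddle a in
    coordinate i, and a convex combination of them hits a 0 i while staying within e of a. The
    application is to the set where a gap is finite. *)
Lemma convex_dense_setT (R : realType) n (C : set 'rV[R]_n) :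
  convex_rV C -> (forall a (e : R), 0 < e -> exists2 x, C x & `|x - a| < e) ->
  forall a, C a.
Proof.
move=> cC dC a.
suff h : forall e : R, 0 < e -> exists2 x, C x &
    `|x - a| < e /\ (forall i, i \in enum 'I_n -> x 0 i = a 0 i).
  have [x Cx [_ xa]] := h 1 ltr01.
  by have <- : x = a by apply/rowP => i; apply: xa; rewrite mem_enum.
elim: (enum 'I_n) a => [a e e0|i s IH a e e0].
  by have [x Cx xa] := dC a e e0; exists x.
have e20 : 0 < e / 2 by lra.
have [p Cp [pa ps]] := IH (a + (e / 2) *: delta_mx 0 i) _ e20.
have [q Cq [qa qs]] := IH (a - (e / 2) *: delta_mx 0 i) _ e20.
have dE k : (delta_mx 0 i : 'rV[R]_n) 0 k = (k == i)%:R by rewrite mxE eqxx.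
have pk k : `|p 0 k - a 0 k - e / 2 * (k == i)%:R| < e / 2.
  move/norm_rV_lt : pa => /(_ e20 k).
  by rewrite !mxE eqxx/= opprD addrA.
have qk k : `|q 0 k - a 0 k + e / 2 * (k == i)%:R| < e / 2.
  move/norm_rV_lt : qa => /(_ e20 k).
  by rewrite !mxE eqxx/= opprD opprK addrA.
have pi : a 0 i < p 0 i by move: (pk i); rewrite eqxx mulr1 ltr_norml => /andP[]; lra.
have qi : q 0 i < a 0 i by move: (qk i); rewrite eqxx mulr1 ltr_norml => /andP[]; lra.
pose t := (a 0 i - q 0 i) / (p 0 i - q 0 i).
have pq : 0 < p 0 i - q 0 i by lra.
have t0 : 0 <= t by rewrite divr_ge0// ltW//; lra.
have t1 : t <= 1 by rewrite ler_pdivrMr//; lra.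
exists (t *: p + (1 - t) *: q); first exact: cC.
split.
  apply/norm_rV_lt => // k; rewrite !mxE.
  have b (z : R) (c : bool) : 0 <= e / 2 * c%:R <= e / 2.
    by case: c; rewrite ?mulr1 ?mulr0 lexx ltW.
  have hp : `|p 0 k - a 0 k| < e.
    by move: (pk k) (b 0 (k == i)); rewrite !ltr_norml => /andP[? ?] /andP[? ?]; apply/andP; split; lra.
  have hq : `|q 0 k - a 0 k| < e.
    by move: (qk k) (b 0 (k == i)); rewrite !ltr_norml => /andP[? ?] /andP[? ?]; apply/andP; split; lra.
  have -> : t * p 0 k + (1 - t) * q 0 k - a 0 k =
      t * (p 0 k - a 0 k) + (1 - t) * (q 0 k - a 0 k) by ring.
  apply: le_lt_trans (ler_normD _ _) _.
  rewrite (normrM t) (normrM (1 - t)) (ger0_norm t0) (@ger0_norm _ (1 - t)) ?subr_ge0//.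
  have := leP `|p 0 k - a 0 k| `|q 0 k - a 0 k|.
  move: (`|_|) (`|_|) hp hq => x y xe ye [] xy.
    by have := ler_wpM2l t0 xy; lra.
  have t1' : 0 <= 1 - t by lra.
  by have := ler_wpM2l t1' (ltW xy); lra.
move=> k; rewrite inE; have [-> _|ki /= ks] := eqVneq k i.
  rewrite !mxE /t; field; lra.
rewrite !mxE ps// qs// !mxE eqxx (negPf ki)/=; ring.
Qed.

Lemma Sform0l (R : realType) m (y : 'rV[R]_(m + m)) : Sform 0 y = 0.
Proof. by rewrite -(scale0r 0) SformZl mul0r. Qed.

Lemma closed_ge_fun (R : realType) (T : topologicalType) (f : T -> R) (c : R) :
  continuous f -> closed [set x | c <= f x].
Proof.
move=> cf; have := @preimage_closed T R f [set r | c <= r].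
by apply; [move=> x _; exact: cf|exact: closed_ge].
Qed.

Lemma open_gt_fun (R : realType) (T : topologicalType) (f : T -> R) (c : R) :
  continuous f -> open [set x | c < f x].
Proof.
move=> cf; have := @open_comp T R f [set r | c < r].
by apply; [move=> x _; exact: cf|exact: open_gt].
Qed.

Lemma continuous_Sform_sub (R : realType) m (g : 'rV[R]_(m + m)) :
  continuous (fun x : 'rV[R]_(m + m) => Sform (g - x) (g - x)).
Proof.
have c : continuous (fun x : 'rV[R]_(m + m) => g - x).
  by apply: continuous_subv; [exact: cst_continuous|move=> x].
exact: continuous_Sform.
Qed.

Lemma Sform_subC (R : realType) m (x y : 'rV[R]_(m + m)) :
  Sform (x - y) (x - y) = Sform (y - x) (y - x).
Proof. by rewrite -opprB SformNl SformNr opprK. Qed.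

(** * Gap functions and polars of sets *)

Definition gap (R : realType) m (G : set 'rV[R]_(m + m)) (y : 'rV[R]_(m + m)) : \bar R :=
  ereal_sup [set (- Sform (x - y) (x - y) / 2)%:E | x in G].

Definition polar (R : realType) m (G : set 'rV[R]_(m + m)) : set 'rV[R]_(m + m) :=
  [set x | forall g, G g -> 0 <= Sform (g - x) (g - x)].

Lemma gap_ge (R : realType) m (G : set 'rV[R]_(m + m)) x y : G x ->
  ((- Sform (x - y) (x - y) / 2)%:E <= gap G y)%E.
Proof. by move=> Gx; apply: ereal_sup_ubound; exists x. Qed.

Lemma gap_le (R : realType) m (G : set 'rV[R]_(m + m)) y (M : \bar R) :
  (gap G y <= M)%E <-> (forall x, G x -> ((- Sform (x - y) (x - y) / 2)%:E <= M)%E).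
Proof.
split=> [h x Gx|h]; first by apply: le_trans h; exact: gap_ge.
by apply: ub_ereal_sup => _ [x Gx <-]; exact: h.
Qed.

Lemma psi_gap (R : realType) m (G : set 'rV[R]_(m + m)) y :
  psi G y = (gap G y + (Sform y y / 2)%:E)%E.
Proof.
have E x : Sform x y - Sform x x / 2 = - Sform (x - y) (x - y) / 2 + Sform y y / 2.
  by rewrite !Sform_lin (SformC y x); lra.
apply/eqP; rewrite eq_le; apply/andP; split.
  apply: ub_ereal_sup => _ [x Gx <-]; rewrite E EFinD leeD2r//; exact: gap_ge.
rewrite -leeBrDr//; apply/gap_le => x Gx; rewrite leeBrDr// -EFinD -E.
by apply: ereal_sup_ubound; exists x.
Qed.

Lemma gap_le0 (R : realType) m (G : set 'rV[R]_(m + m)) x :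
  (gap G x <= 0)%E <-> polar G x.
Proof.
split=> [/gap_le h g Gg|h]; first by have := h _ Gg; rewrite lee_fin; lra.
by apply/gap_le => g Gg; rewrite lee_fin; have := h _ Gg; lra.
Qed.

(* The function gap G + S/2 is convex and dominates S/2, with equality at the
   points of the polar; hence S x is a subgradient of it at such a point x. *)
Lemma polar_gap (R : realType) m (G : set 'rV[R]_(m + m)) x y :
  (forall z, (0 <= gap G z)%E) -> polar G x ->
  ((- Sform (x - y) (x - y) / 2)%:E <= gap G y)%E.
Proof.
move=> G0 Px; have := G0 y.
case My : (gap G y) => [M| |]; [|by move=> _; rewrite leey|by []].
rewrite !lee_fin => M0; rewrite leNgt; apply/negP => lt.
pose s := - Sform (x - y) (x - y).
have s2 : 2 * M < s by rewrite /s; lra.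
(* With t * s = (s - 2 * M) / 2, the lower bound t * ((1 - t) * s - 2 * M) for S(g - z, g - z) at z
   = x + t (y - x) equals t * (s - 2 * M) / 2 = 4 * eta, whereas gap G z >= 0 supplies a g for which
   it is below 2 * eta. *)
pose t := (s - 2 * M) / (2 * s).
have s0 : 0 < 2 * s by lra.
have t0 : 0 < t by rewrite divr_gt0//; lra.
have t1 : t < 1 by rewrite ltr_pdivrMr//; lra.
have ts : t * s = (s - 2 * M) / 2 by clear My; rewrite /t; field; lra.
pose eta := t * (s - 2 * M) / 8.
have eta0 : 0 < eta by rewrite divr_gt0// mulr_gt0//; lra.
have /ereal_sup_gt[_ [g Gg <-]] : ((- eta)%:E < gap G (x + t *: (y - x)))%E.
  by apply: lt_le_trans (G0 _); rewrite lte_fin; lra.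
rewrite lte_fin.
have -> : Sform (g - (x + t *: (y - x))) (g - (x + t *: (y - x))) =
    (1 - t) * Sform (g - x) (g - x) + t * Sform (g - y) (g - y)
    - t * (1 - t) * Sform (x - y) (x - y).
  by rewrite !Sform_lin (SformC y x) (SformC x g) (SformC y g); ring.
have Pg := Px _ Gg.
have /gap_le/(_ g Gg) : (gap G y <= M%:E)%E by rewrite My.
rewrite lee_fin /eta => hM.
have h1 : 0 <= (1 - t) * Sform (g - x) (g - x) by rewrite mulr_ge0//; lra.
have h2 : t * - (2 * M) <= t * Sform (g - y) (g - y) by rewrite ler_pM2l//; lra.
have h3 : - (t * (1 - t) * Sform (x - y) (x - y)) = t * (s - (s - 2 * M) / 2).
  by rewrite -ts /s; ring.
have h4 : 0 < t * (s - 2 * M) by rewrite mulr_gt0//; lra.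
lra.
Qed.

(** The polar of an arbitrary set need not be monotone; gap G >= 0 makes it so, because [polar_gap]
    bounds the value of x at y by gap G y, which is at most 0 on the polar. *)
Lemma polar_monotone (R : realType) m (G : set 'rV[R]_(m + m)) x y :
  (forall z, (0 <= gap G z)%E) -> polar G x -> polar G y -> 0 <= Sform (x - y) (x - y).
Proof.
move=> G0 Px /gap_le0 Py; have := le_trans (polar_gap y G0 Px) Py.
rewrite lee_fin; lra.
Qed.

Lemma gap_graph_ge0 (R : realType) m (f : 'rV[R]_m -> 'rV[R]_m) y :
  (0 <= gap (graph_of f) y)%E.
Proof.
have [u [v ->]] : exists u v, y = row_mx u v.
  by exists (lsubmx y), (rsubmx y); rewrite hsubmxK.
have Gx : graph_of f (row_mx u (f u)) by exists u.
apply: le_trans (gap_ge _ Gx); rewrite lee_fin opp_row_mx add_row_mx subrr Sform_row.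
by rewrite dotv0r dotvC dotv0r; lra.
Qed.

Lemma polar_maximal (R : realType) m (G : set 'rV[R]_(m + m)) :
  maximal_S_monotone G -> polar G = G.
Proof.
move=> [mG maxG]; apply/seteqP; split => y; last by move=> Gy g Gg; exact: mG.
move=> Py; rewrite -(maxG (G `|` [set y])); [by right| |by move=> z; left].
move=> a b [Ga|->] [Gb|->]; [exact: mG|exact: Py| |by rewrite subrr Sform0l].
by rewrite Sform_subC; exact: Py.
Qed.

(** A point with negative gap would lie in the polar, hence in G, where the choice x = y already
    gives 0. *)
Lemma gap_maximal_ge0 (R : realType) m (G : set 'rV[R]_(m + m)) y :
  maximal_S_monotone G -> (0 <= gap G y)%E.
Proof.
move=> mG; rewrite leNgt; apply/negP => lt.
have Gy : G y by rewrite -(polar_maximal mG); apply/gap_le0/ltW.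
have := lt_le_trans (le_lt_trans (gap_ge y Gy) lt) (lexx _).
by rewrite subrr Sform0l oppr0 mul0r ltxx.
Qed.

Lemma polar_closed (R : realType) m (G : set 'rV[R]_(m + m)) : closed (polar G).
Proof.
rewrite (_ : polar G = \bigcap_(g in G) [set x | 0 <= Sform (g - x) (g - x)]); last first.
  by apply/seteqP; split=> x h g; exact: h.
by apply: closed_bigI => g Gg; apply/closed_ge_fun/continuous_Sform_sub.
Qed.

(** For a G that may fail to be monotone, nonnegativity is available only between the polar and the
    closure of G; these are the two closed families whose maximisers are compared in
    [gap_attained_unique]. *)
Lemma cross_closure (R : realType) m (G : set 'rV[R]_(m + m)) x g :
  polar G x -> closure G g -> 0 <= Sform (g - x) (g - x).
Proof.
move=> Px cg.
rewrite Sform_subC.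
have cl : closed [set z | 0 <= Sform (x - z) (x - z)].
  exact/closed_ge_fun/continuous_Sform_sub.
apply: cl; apply: closure_subset cg => z Gz /=; rewrite Sform_subC; exact: Px.
Qed.

Lemma gap_closure (R : realType) m (G : set 'rV[R]_(m + m)) g y :
  closure G g -> ((- Sform (g - y) (g - y) / 2)%:E <= gap G y)%E.
Proof.
move=> cg; case My : (gap G y) => [M| |]; [|by rewrite leey|].
  rewrite lee_fin.
  rewrite Sform_subC.
  have cl : closed [set z | - (2 * M) <= Sform (y - z) (y - z)].
    exact/closed_ge_fun/continuous_Sform_sub.
  suff : - (2 * M) <= Sform (y - g) (y - g) by lra.
  apply: cl; apply: closure_subset cg => z Gz /=.
  by have := gap_ge y Gz; rewrite My lee_fin Sform_subC; lra.
have : G = set0.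
  by apply/seteqP; split => // z Gz; have := gap_ge y Gz; rewrite My.
by move=> G0; move: cg; rewrite G0 closure0.
Qed.

(** * Dense sequences and compact cubes *)

Lemma rat_dense_rV (R : realType) n (g : 'rV[R]_n) (e : R) : 0 < e ->
  exists c : 'rV[rat]_n, `|g - map_mx ratr c| < e.
Proof.
move=> e0.
have h i : exists c : rat, `|g 0 i - ratr c| < e.
  have [c] := @rat_in_itvoo R (g 0 i - e) (g 0 i + e) ltac:(lra).
  rewrite in_itv/= => /andP[c1 c2]; exists c; rewrite ltr_norml; apply/andP; split; lra.
have [c hc] := choice h.
exists (\row_i c i); apply/norm_rV_lt => // i; rewrite !mxE; exact: hc.
Qed.

Lemma invS_lt (R : realType) (e : R) : 0 < e -> exists k : nat, k.+1%:R^-1 < e.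
Proof.
by move=> e0; have [k] := @ltr_add_invr R 0 e e0; rewrite add0r; exists k.
Qed.

(** Indices code a rational vector c and a scale k; each selects a point of G within 1 / (k + 1) of
    c if there is one, and the default point x0 otherwise. *)
Lemma dense_seq (R : realType) n (G : set 'rV[R]_n) : G !=set0 ->
  exists x : nat -> 'rV[R]_n, (forall i, G (x i)) /\
    (forall g, G g -> forall e : R, 0 < e -> exists i, `|x i - g| < e).
Proof.
move=> [x0 Gx0].
have h (t : 'rV[rat]_n * nat) : exists x, G x /\
    ((exists2 g, G g & `|g - map_mx ratr t.1| < t.2.+1%:R^-1) ->
      `|x - map_mx ratr t.1| < t.2.+1%:R^-1).
  have [[g Gg gt]|n'] := pselect (exists2 g, G g & `|g - map_mx ratr t.1| < t.2.+1%:R^-1).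
    by exists g.
  by exists x0.
have [x hx] := choice h.
exists (fun i => if unpickle i is Some t then x t else x0); split.
  by move=> i; case: unpickle => // t; exact: (hx t).1.
move=> g Gg e e0; have [k ke] := @invS_lt R (e / 2) ltac:(lra).
have [c hc] := @rat_dense_rV R n g (k.+1%:R^-1) ltac:(by rewrite invr_gt0).
exists (pickle (c, k)); rewrite pickleK.
have := (hx (c, k)).2 (ex_intro2 _ _ g Gg hc) => /= h'.
rewrite -(subrKA (map_mx ratr c)); apply: le_lt_trans (ler_normD _ _) _.
by rewrite [X in _ + X < _]distrC; apply: lt_trans (ltrD h' hc) _; rewrite [ltRHS]splitr ltrD.
Qed.

Lemma closed_ball_closed (R : realType) n (c : 'rV[R]_n) (e : R) :
  closed [set x | `|x - c| <= e].
Proof.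
have c' : continuous (fun z : 'rV[R]_n => - `|z - c|).
  apply: continuous_oppf; apply: continuous_normv.
  by apply: continuous_subv; [move=> x|exact: cst_continuous].
have := @closed_ge_fun _ _ _ (- e) c'.
by under eq_set do rewrite lerN2.
Qed.

Lemma compact_setI_ball (R : realType) n (A : set 'rV[R]_n) c (e : R) :
  closed A -> compact (A `&` [set x | `|x - c| <= e]).
Proof.
move=> cA; apply: bounded_closed_compact; last first.
  apply: closedI => //; exact: closed_ball_closed.
exists (`|c| + e); split; first exact: num_real.
move=> M hM x [_ /= xe]; rewrite -(subrK c x); apply: le_trans (ler_normD _ _) _.
by rewrite addrC; apply: ltW; apply: le_lt_trans hM; rewrite lerD2l.
Qed.

(** * Hypersurfaces separating two families of maximisers *)

Lemma affine_minorant_convex (R : realType) n (g : 'rV[R]_n -> R) :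
  (forall z0, exists l, forall z, g z0 + dotv l (z - z0) <= g z) -> convex_fun g.
Proof.
move=> h x y t t0 t1; have [l hl] := h (t *: x + (1 - t) *: y).
have := hl x; have := hl y.
set g0 := g (t *: x + _).
rewrite !dotv_lin => hy hx.
have t1' : 0 <= 1 - t by lra.
have := ler_wpM2l t0 hx; have := ler_wpM2l t1' hy; lra.
Qed.

(** Testing the minorant along d with steps of both signs pins the directional derivative to that of
    the affine function. The conclusion keeps the difference quotient because the gradient of h in
    [hypersurface] is assembled from such quotients. *)
Lemma minorant_derive (R : realType) n (g : 'rV[R]_n -> R) z0 l (d : 'rV[R]_n) :
  differentiable g z0 -> (forall z, g z0 + dotv l (z - z0) <= g z) ->
  (fun t : R => t^-1 *: ((g \o shift z0) (t *: d) - g z0)) @ 0^' --> dotv l d.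
Proof.
move=> dg hl.
have /cvg_ex[/= D cD] := @diff_derivable _ _ _ g z0 d dg.
suff <- : D = dotv l d by [].
have qE (t : R) : t * dotv l d <= (g \o shift z0) (t *: d) - g z0.
  by have := hl (t *: d + z0); rewrite addrK dotvZr /=; lra.
apply/eqP; rewrite eq_le; apply/andP; split; rewrite leNgt; apply/negP => lt.
- have e0 : 0 < D - dotv l d by lra.
  move/cvgrPdist_lt : cD => /(_ _ e0) /nbhs_ballP[r /= r0 hr].
  have s0 : 0 < r / 2 by lra.
  have := hr (- (r / 2)).
  rewrite /ball/= sub0r opprK (gtr0_norm s0) => /(_ ltac:(lra) ltac:(lra)).
  have := qE (- (r / 2)); rewrite /=; set w := _ - g z0 => hw.
  rewrite ltr_norml => /andP[_]; rewrite /GRing.scale/= invrN mulNr.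
  have := ler_wpM2l (ltW (eqbRL (invr_gt0 _) s0)) hw.
  rewrite mulNr mulrN mulKf ?gt_eqF//; lra.
- have e0 : 0 < dotv l d - D by lra.
  move/cvgrPdist_lt : cD => /(_ _ e0) /nbhs_ballP[r /= r0 hr].
  have s0 : 0 < r / 2 by lra.
  have := hr (r / 2).
  rewrite /ball/= sub0r normrN (gtr0_norm s0) => /(_ ltac:(lra) ltac:(lra)).
  have := qE (r / 2); rewrite /=; set w := _ - g z0 => hw.
  rewrite ltr_norml => /andP[+ _]; rewrite /GRing.scale/=.
  have := ler_wpM2l (ltW (eqbRL (invr_gt0 _) s0)) hw.
  rewrite mulKf ?gt_eqF//; lra.
Qed.

Lemma in_H_sub (R : realType) m (j : 'I_(m + m)) (C C' : set 'rV[R]_(m + m)) h :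
  C `<=` C' -> in_H j C h -> in_H j C' h.
Proof.
move=> CC' [g1 [g2 [H1 [H2 H3]]]]; exists g1, g2; split => //; split => // x d1 d2.
by apply: CC'; exact: H3.
Qed.

(** The affine functions <a, .> - s and <b, .> - t agree on a hyperplane with normal b - a; here it
    is rescaled to have j-th coordinate 1, as the sets C of the families [in_H] demand. *)
Definition normals (R : realType) m (j : 'I_(m + m)) (A B : set 'rV[R]_(m + m)) :
    set 'rV[R]_(m + m) :=
  [set (ab.2 0 j - ab.1 0 j)^-1 *: (ab.2 - ab.1) | ab in A `*` B].

Lemma dotv_col' (R : realType) n (j : 'I_n) (b x : 'rV[R]_n) :
  dotv b x = dotv (col' j b) (col' j x) + b 0 j * x 0 j.
Proof.
rewrite /dotv (bigD1_ord j)//= addrC; congr (_ + _).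
by apply: eq_bigr => i _; rewrite !mxE.
Qed.

Lemma norm_col' (R : realType) n (j : 'I_n) (b : 'rV[R]_n) : `|col' j b| <= `|b|.
Proof. by apply/norm_rV_le => // i; rewrite mxE; exact: norm_coord_le. Qed.

Lemma continuous_col' (R : realType) n (j : 'I_n) :
  continuous (fun b : 'rV[R]_n => col' j b).
Proof.
apply: continuous_rV => i; under eq_fun do rewrite mxE; exact: coord_continuous.
Qed.

Lemma compact_bounded_fun (R : realType) n (A : set 'rV[R]_n) (q : 'rV[R]_n -> R) :
  compact A -> continuous q -> exists2 M : R, 0 <= M & forall a, A a -> `|q a| <= M.
Proof.
move=> cA cq; have [->|/set0P A0] := eqVneq A set0; first by exists 0.
have cq' : continuous (fun a => `|q a|).
  move=> a; apply: (@continuous_comp _ _ _ q Num.norm); first exact: cq.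
  exact: norm_continuous.
have [|c cAc hc] := @EVT_max_rV R n (fun a => `|q a|) A A0 cA.
  exact: continuous_subspaceT.
by exists `|q c| => // a Aa; apply: hc; rewrite inE.
Qed.

Lemma linear_growth_sub (R : realType) n (f g : 'rV[R]_n -> R) (k1 k2 : R) :
  linear_growth f -> linear_growth g -> linear_growth (fun z => k1 * f z + k2 * g z).
Proof.
move=> [c hc] [c' hc']; exists (`|k1| * c + `|k2| * c') => z.
apply: le_trans (ler_normD _ _) _; rewrite !normrM.
have := ler_wpM2l (normr_ge0 k1) (hc z); have := ler_wpM2l (normr_ge0 k2) (hc' z).
lra.
Qed.

(* L b z t is the affine function <b, .> - q b at the point with j-th coordinate
   t and other coordinates z; u and v are its maxima over B and A.  The
   hypersurface is the graph of w, where u and v agree, and Phi := u + v -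
   (al + be) w controls the second differences of w. *)
Lemma hypersurface (R : realType) m (j : 'I_(m + m)) (A B : set 'rV[R]_(m + m))
    (q : 'rV[R]_(m + m) -> R) (al be e : R) :
  compact A -> compact B -> A !=set0 -> B !=set0 -> continuous q ->
  4 * e < be - al -> (forall a, A a -> `|a 0 j - al| <= e) ->
  (forall b, B b -> `|b 0 j - be| <= e) ->
  exists2 h, in_H j (normals j A B) h &
    forall p a b, A a -> B b ->
      (forall a', A a' -> dotv a' p - q a' <= dotv a p - q a) ->
      (forall b', B b' -> dotv b' p - q b' <= dotv b p - q b) ->
      dotv a p - q a = dotv b p - q b -> h p = 0.
Proof.
move=> cA cB A0 B0 cq e4 hA hB.
have e0 : 0 <= e by have [a Aa] := A0; apply: le_trans (hA _ Aa).
pose L (b : 'rV[R]_(m + m)) (z : 'rV[R]_(m + m).-1) (t : R) :=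
  dotv (col' j b) z + b 0 j * t - q b.
have Lcont z t : continuous (fun b => L b z t).
  apply: continuous_addf; last exact: continuous_oppf.
  apply: continuous_addf; last first.
    by apply: continuous_mulf; [exact: coord_continuous|exact: cst_continuous].
  apply: continuous_dotv; first exact: continuous_col'.
  exact: cst_continuous.
have maxE (D : set 'rV[R]_(m + m)) : compact D -> D !=set0 ->
    exists am : 'rV[R]_(m + m).-1 * R -> 'rV[R]_(m + m),
      forall zt, D (am zt) /\ forall a, D a -> L a zt.1 zt.2 <= L (am zt) zt.1 zt.2.
  move=> cD D0; suff /choice[am ham] : forall zt : 'rV[R]_(m + m).-1 * R, exists b, D b /\
      forall a, D a -> L a zt.1 zt.2 <= L b zt.1 zt.2 by exists am.
  move=> [z t] /=.
  have [|c Dc hc] := @EVT_max_rV R _ (fun b => L b z t) D D0 cD.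
    exact: continuous_subspaceT (Lcont z t).
  by exists c; split; [exact: set_mem|move=> a Da; apply: hc; rewrite inE].
have [am am_max] := maxE _ cA A0.
have [bm bm_max] := maxE _ cB B0.
pose u z t := L (bm (z, t)) z t.
pose v z t := L (am (z, t)) z t.
have uge b z t : B b -> L b z t <= u z t by move=> Bb; exact: (bm_max (z, t)).2.
have vge a z t : A a -> L a z t <= v z t by move=> Aa; exact: (am_max (z, t)).2.
have Bbm z t : B (bm (z, t)) := (bm_max (z, t)).1.
have Aam z t : A (am (z, t)) := (am_max (z, t)).1.
have hAj a : A a -> al - e <= a 0 j <= al + e.
  by move=> /hA; rewrite ler_norml => /andP[? ?]; apply/andP; split; lra.
have hBj b : B b -> be - e <= b 0 j <= be + e.
  by move=> /hB; rewrite ler_norml => /andP[? ?]; apply/andP; split; lra.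
have LD b z t s : L b z t = L b z s + b 0 j * (t - s) by rewrite /L; ring.
(* The least possible value of b 0 j - a 0 j for a in A and b in B. Hence F z below grows in t at
   rate at least c and has exactly one zero, w z. *)
pose c := be - al - 2 * e.
have c0 : 0 < c by rewrite /c; lra.
have uincr z s t : s <= t -> (be - e) * (t - s) <= u z t - u z s <= (be + e) * (t - s).
  move=> st; have ts : 0 <= t - s by lra.
  have h1 := uge _ z t (Bbm z s); rewrite (LD _ _ t s) -/(u z s) in h1.
  have h2 := uge _ z s (Bbm z t); rewrite (LD _ _ s t) -/(u z t) in h2.
  have /andP[b1 b1'] := hBj _ (Bbm z s); have /andP[b2 b2'] := hBj _ (Bbm z t).
  have := ler_wpM2r ts b1; have := ler_wpM2r ts b2'.
  by move=> ? ?; apply/andP; split; lra.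
have vincr z s t : s <= t -> (al - e) * (t - s) <= v z t - v z s <= (al + e) * (t - s).
  move=> st; have ts : 0 <= t - s by lra.
  have h1 := vge _ z t (Aam z s); rewrite (LD _ _ t s) -/(v z s) in h1.
  have h2 := vge _ z s (Aam z t); rewrite (LD _ _ s t) -/(v z t) in h2.
  have /andP[b1 b1'] := hAj _ (Aam z s); have /andP[b2 b2'] := hAj _ (Aam z t).
  have := ler_wpM2r ts b1; have := ler_wpM2r ts b2'.
  by move=> ? ?; apply/andP; split; lra.
pose F z t := u z t - v z t.
pose K0 := be - al + 2 * e.
have Fincr z s t : s <= t -> c * (t - s) <= F z t - F z s <= K0 * (t - s).
  move=> st; have /andP[? ?] := uincr z s t st; have /andP[? ?] := vincr z s t st.
  by rewrite /F /c /K0; apply/andP; split; lra.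
have Fcont z : continuous (F z).
  move=> t; apply/cvgrPdist_le => eps eps0.
  have K00 : 0 < K0 by rewrite /K0; lra.
  near=> s.
  have st : `|t - s| <= eps / K0.
    by near: s; apply: cvgr_dist_le; [exact: cvg_id|rewrite divr_gt0].
  rewrite -(ler_pM2l K00) in st; rewrite [K0 * (_ / _)]mulrC divfK ?gt_eqF// in st.
  have [ts|ts] := leP t s.
    have /andP[F1 F2] := Fincr z t s ts; rewrite distrC ger0_norm; last first.
      by apply: le_trans F1; apply: mulr_ge0; [exact: ltW|lra].
    by apply: le_trans F2 _; apply: le_trans st; rewrite distrC ger0_norm//; lra.
  have /andP[F1 F2] := Fincr z s t (ltW ts); rewrite ger0_norm; last first.
    by apply: le_trans F1; apply: mulr_ge0; [exact: ltW|lra].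
  by apply: le_trans F2 _; apply: le_trans st; rewrite ger0_norm//; lra.
have [w hw] : exists w : 'rV[R]_(m + m).-1 -> R,
    forall z, F z (w z) = 0 /\ `|w z| <= `|F z 0| / c.
  suff /choice[w hw] : forall z, exists t, F z t = 0 /\ `|t| <= `|F z 0| / c by exists w.
  (* A function growing at rate at least c cancels its value at 0 within this distance, so the zero
     lies in [- T, T]. *)
  move=> z; pose T := `|F z 0| / c.
  have T0 : 0 <= T by rewrite divr_ge0// ltW.
  have cT : c * T = `|F z 0| by rewrite /T mulrC divfK ?gt_eqF.
  have TT : - T <= T by lra.
  have h1 : F z (- T) <= 0.
    have /andP[+ _] := Fincr z (- T) 0 ltac:(lra).
    by have := ler_norm (F z 0); rewrite sub0r opprK cT; lra.
  have h2 : 0 <= F z T.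
    have /andP[+ _] := Fincr z 0 T ltac:(lra).
    by have := ler_norm (- F z 0); rewrite normrN subr0 cT; lra.
  have [|x xT Fx] := @IVT R (F z) (- T) T 0 TT (continuous_subspaceT (@Fcont z)).
    by rewrite ge_min h1 le_max h2 orbT.
  by exists x; split => //; rewrite ler_norml; move: xT; rewrite in_itv.
have Fw z : u z (w z) = v z (w z) by have := (hw z).1; rewrite /F; lra.
have Funiq z t : F z t = 0 -> t = w z.
  move=> Ft; have Fw0 := (hw z).1.
  have [tw|tw] := leP t (w z).
    have /andP[+ _] := Fincr z t (w z) tw; rewrite Ft Fw0 subrr pmulr_rle0//; lra.
  have /andP[+ _] := Fincr z (w z) t (ltW tw); rewrite Ft Fw0 subrr pmulr_rle0//; lra.
have [MA MA0 hMA] := compact_bounded_fun cA cq.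
have [MB MB0 hMB] := compact_bounded_fun cB cq.
have cn : continuous (fun a : 'rV[R]_(m + m) => `|a|) by exact: norm_continuous.
have [NA NA0 hNA] := compact_bounded_fun cA cn.
have [NB NB0 hNB] := compact_bounded_fun cB cn.
pose M := MA + MB + NA + NB.
have M0 : 0 <= M by rewrite /M !addr_ge0.
pose N0 : R := ((m + m).-1)%:R.
have Lbnd b z t : `|b| <= M -> `|q b| <= M -> `|L b z t| <= N0 * M * `|z| + M * `|t| + M.
  move=> bM qM; apply: le_trans (ler_normB _ _) _; rewrite lerD//.
  apply: le_trans (ler_normD _ _) _; rewrite lerD//.
    apply: le_trans (norm_dotv_le _ _) _; rewrite ler_wpM2r// ler_wpM2l//.
    by apply: le_trans bM; exact: norm_col'.
  rewrite normrM ler_wpM2r//; apply: le_trans bM; exact: norm_coord_le.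
have ubnd z t : `|u z t| <= N0 * M * `|z| + M * `|t| + M.
  have Bb := Bbm z t.
  have /= := hMB _ Bb; have /= := hNB _ Bb; rewrite normr_id => h1 h2.
  by apply: Lbnd; rewrite /M; lra.
have vbnd z t : `|v z t| <= N0 * M * `|z| + M * `|t| + M.
  have Aa := Aam z t.
  have /= := hMA _ Aa; have /= := hNA _ Aa; rewrite normr_id => h1 h2.
  by apply: Lbnd; rewrite /M; lra.
have N00 : 0 <= N0 by rewrite ler0n.
have wbnd : exists2 k : R, 0 <= k & forall z, `|w z| <= k * (1 + `|z|).
  exists (2 * (N0 * M + M) / c).
    by rewrite divr_ge0 ?(ltW c0)// mulr_ge0// addr_ge0// mulr_ge0.
  move=> z; apply: le_trans (hw z).2 _; rewrite mulrAC ler_pM2r ?invr_gt0//.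
  have := ubnd z 0; have := vbnd z 0; rewrite normr0 mulr0 addr0 => h1 h2.
  apply: le_trans (ler_normB _ _) _.
  have z0 := normr_ge0 z; have := mulr_ge0 N00 M0; have := mulr_ge0 M0 z0; nra.
have [kw kw0 hkw] := wbnd.
pose Phi z := u z (w z) + v z (w z) - (al + be) * w z.
have lw : linear_growth w by exists kw.
have lu : linear_growth (fun z => u z (w z)).
  exists (N0 * M + M * kw + M) => z; apply: le_trans (ubnd _ _) _.
  have z0 := normr_ge0 z; have := ler_wpM2l M0 (hkw z).
  have := mulr_ge0 N00 M0; have := mulr_ge0 M0 z0; nra.
have lPhi : linear_growth Phi.
  have := linear_growth_sub 2 (- (al + be)) lu lw.
  by congr linear_growth; apply/funext => z; rewrite /Phi -Fw; ring.
(* In the notation of [support] below, w bends by r with c * |r| <= e1 + e2, and Phi bends by s_ * r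
   + e1 + e2 with |s_| <= 2 * e, hence by at least (c - 2 * e) * |r|. So K * Phi + w and K * Phi - w
   are both convex; 4 * e < be - al says exactly that c - 2 * e > 0. *)
pose K := (c - 2 * e)^-1.
have ce0 : 0 < c - 2 * e by rewrite /c; lra.
have K_gt0 : 0 < K by rewrite invr_gt0.
have KcE : K * (c - 2 * e) = 1 by rewrite mulVf// gt_eqF.
(* g1 - g2 = - w, so that h is x 0 j - w; the common summand K / 2 * Phi only serves to make both
   convex. *)
pose g1 z := K / 2 * Phi z + - 2^-1 * w z.
pose g2 z := K / 2 * Phi z + 2^-1 * w z.
pose a_ z := am (z, w z).
pose b_ z := bm (z, w z).
pose N z := (b_ z 0 j - a_ z 0 j)^-1 *: (b_ z - a_ z).
(* In the direction t the function u + v has slope a_ 0 j + b_ 0 j; removing (al + be) * w in Phi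
   leaves this small factor, of size at most 2 * e. *)
pose s_ z := a_ z 0 j + b_ z 0 j - al - be.
pose lam z := col' j (a_ z) + col' j (b_ z) - s_ z *: col' j (N z).
pose l1 z := (K / 2) *: lam z + 2^-1 *: col' j (N z).
pose l2 z := (K / 2) *: lam z - 2^-1 *: col' j (N z).
have gap_ba z : c <= b_ z 0 j - a_ z 0 j.
  have /andP[? ?] := hAj _ (Aam z (w z)); have /andP[? ?] := hBj _ (Bbm z (w z)).
  by rewrite /c /a_ /b_; lra.
have Nj z : N z 0 j = 1.
  by rewrite !mxE mulVf// gt_eqF//; apply: lt_le_trans (gap_ba z).
have support z0 z : exists e1 e2 r : R, [/\ 0 <= e1, 0 <= e2,
    (b_ z0 0 j - a_ z0 0 j) * r = e2 - e1,
    w z = w z0 - dotv (col' j (N z0)) (z - z0) + r &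
    Phi z = Phi z0 + dotv (lam z0) (z - z0) + s_ z0 * r + e1 + e2].
  (* e1 and e2 are the losses incurred at z by keeping the maximisers of z0, and r is the deviation
     of w from its tangent hyperplane at z0. Since u = v on the graph of w, r is proportional to e2
     - e1. *)
  pose e1 := u z (w z) - L (b_ z0) z (w z).
  pose e2 := v z (w z) - L (a_ z0) z (w z).
  have e10 : 0 <= e1 by rewrite subr_ge0; apply: uge; exact: Bbm.
  have e20 : 0 <= e2 by rewrite subr_ge0; apply: vge; exact: Aam.
  pose r := w z - w z0 + dotv (col' j (N z0)) (z - z0).
  have u0 : u z0 (w z0) = L (b_ z0) z0 (w z0) by [].
  have v0 : v z0 (w z0) = L (a_ z0) z0 (w z0) by [].
  have ba0 : b_ z0 0 j - a_ z0 0 j != 0.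
    by rewrite gt_eqF//; apply: lt_le_trans (gap_ba z0).
  have NE : (b_ z0 0 j - a_ z0 0 j) * dotv (col' j (N z0)) (z - z0) =
      dotv (col' j (b_ z0)) (z - z0) - dotv (col' j (a_ z0)) (z - z0).
    rewrite -dotvZl -dotvNl -dotvDl; congr dotv.
    by apply/rowP => i; rewrite !mxE mulVKf.
  have e1E : u z (w z) = u z0 (w z0) + dotv (col' j (b_ z0)) (z - z0) +
      b_ z0 0 j * (w z - w z0) + e1.
    by rewrite u0 /e1 /L !dotv_lin; ring.
  have e2E : v z (w z) = v z0 (w z0) + dotv (col' j (a_ z0)) (z - z0) +
      a_ z0 0 j * (w z - w z0) + e2.
    by rewrite v0 /e2 /L !dotv_lin; ring.
  exists e1, e2, r; split => //.
  - rewrite /r mulrDr NE; have := Fw z; have := Fw z0; rewrite e1E e2E; lra.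
  - by rewrite /r; ring.
  - rewrite /Phi e1E e2E /lam dotvDl dotvNl dotvZl dotvDl /r /s_; ring.
have key z0 z (sg : R) : sg = 1 \/ sg = -1 ->
    K / 2 * Phi z0 + sg / 2 * w z0 +
      dotv ((K / 2) *: lam z0 - (sg / 2) *: col' j (N z0)) (z - z0) <=
    K / 2 * Phi z + sg / 2 * w z.
  move=> sgE; have [e1 [e2 [r [e10 e20 rE -> ->]]]] := support z0 z.
  rewrite dotvDl dotvNl !dotvZl.
  have r1 : c * `|r| <= e1 + e2.
    apply: (@le_trans _ _ `|(b_ z0 0 j - a_ z0 0 j) * r|).
      rewrite normrM ler_wpM2r//; apply: le_trans (gap_ba z0) _; exact: ler_norm.
    by rewrite rE; apply: le_trans (ler_normB _ _) _; rewrite !ger0_norm//; lra.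
  have sr : - (2 * e * `|r|) <= s_ z0 * r.
    have : `|s_ z0 * r| <= 2 * e * `|r|.
      rewrite normrM ler_wpM2r// /s_ ler_norml.
      have /andP[? ?] := hAj _ (Aam z0 (w z0)); have /andP[? ?] := hBj _ (Bbm z0 (w z0)).
      by rewrite /a_ /b_; apply/andP; split; lra.
    by rewrite ler_norml => /andP[].
  have rr : - `|r| <= sg * r.
    by case: sgE => ->; have := ler_norm r; have := ler_norm (- r); rewrite normrN; lra.
  have h1 : K * (c * `|r|) <= K * (e1 + e2) by rewrite ler_pM2l.
  have h2 : K * - (2 * e * `|r|) <= K * (s_ z0 * r) by rewrite ler_pM2l.
  have h3 : K * (c * `|r|) - K * (2 * e * `|r|) = `|r|.
    by rewrite -mulrBr -mulrBl mulrA KcE mul1r.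
  lra.
have m1 z0 z : g1 z0 + dotv (l1 z0) (z - z0) <= g1 z.
  have := key z0 z (-1) (or_intror erefl).
  by rewrite /g1 /l1 !mulNr !mul1r scaleNr opprK.
have m2 z0 z : g2 z0 + dotv (l2 z0) (z - z0) <= g2 z.
  by have := key z0 z 1 (or_introl erefl); rewrite /g2 /l2 !mul1r.
pose h (x : 'rV[R]_(m + m)) : R := x 0 j + g1 (col' j x) - g2 (col' j x).
have hE x : h x = x 0 j - w (col' j x) by rewrite /h /g1 /g2; lra.
exists h; last first.
  move=> p a b Aa Bb ha hb ab.
  have LE b' : L b' (col' j p) (p 0 j) = dotv b' p - q b'.
    by rewrite /L (dotv_col' j b' p).
  rewrite hE; suff -> : p 0 j = w (col' j p) by rewrite subrr.
  apply: Funiq; rewrite /F; apply/eqP; rewrite subr_eq0; apply/eqP.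
  transitivity (L b (col' j p) (p 0 j)).
    apply/eqP; rewrite eq_le uge// andbT /u !LE; exact: hb.
  rewrite LE -ab -LE; apply/eqP; rewrite eq_le vge//= /v !LE; exact: ha.
exists g1, g2; split.
  split; [by apply: affine_minorant_convex => z0; exists (l1 z0)|
    by apply: affine_minorant_convex => z0; exists (l2 z0)|
    exact: linear_growth_sub|exact: linear_growth_sub].
split => // x d1 d2.
exists (a_ (col' j x), b_ (col' j x)); first by split; [exact: Aam|exact: Bbm].
apply/rowP => k; rewrite [RHS]mxE -[LHS]/(N (col' j x) 0 k).
pose d := col' j (delta_mx 0 k : 'rV[R]_(m + m)).
(* Where both are differentiable, g1 and g2 have gradients l1 and l2, and l1 - l2 = col' j N;
   together with N 0 j = 1 this makes N the gradient of h. *)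
have c1 := minorant_derive (d := d) d1 (m1 (col' j x)).
have c2 := minorant_derive (d := d) d2 (m2 (col' j x)).
apply/esym/cvg_lim => //.
have NkE : N (col' j x) 0 k = (delta_mx 0 k : 'rV[R]_(m + m)) 0 j +
    (dotv (l1 (col' j x)) d - dotv (l2 (col' j x)) d).
  rewrite -(dotv_delta (N _) k) (dotv_col' j) Nj mul1r /l1 /l2 !dotvDl dotvNl !dotvZl -/d.
  lra.
rewrite NkE.
have c3 : (fun t : R => (delta_mx 0 k : 'rV[R]_(m + m)) 0 j +
    (t^-1 *: ((g1 \o shift (col' j x)) (t *: d) - g1 (col' j x)) -
     t^-1 *: ((g2 \o shift (col' j x)) (t *: d) - g2 (col' j x)))) @ 0^' -->
    (delta_mx 0 k : 'rV[R]_(m + m)) 0 j +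
    (dotv (l1 (col' j x)) d - dotv (l2 (col' j x)) d).
  by apply: cvgD; [exact: cvg_cst|exact: cvgB].
apply: cvg_trans c3; apply: near_eq_cvg.
near=> t.
have t0 : t != 0 by near: t; exact: nbhs_dnbhs_neq.
have colE : col' j (t *: delta_mx 0 k + x) = t *: d + col' j x.
  by apply/rowP => i; rewrite !mxE.
have jE : (t *: delta_mx 0 k + x) 0 j = t * (delta_mx 0 k : 'rV[R]_(m + m)) 0 j + x 0 j.
  by rewrite [LHS]mxE; congr (_ + _); rewrite mxE.
rewrite /= /h colE jE.
move: (g1 _) (g2 _) (g1 _) (g2 _) ((delta_mx 0 k : 'rV[R]_(m + m)) 0 j) => y1 y2 y3 y4 y5.
rewrite /GRing.scale/=; by field.
Unshelve. all: by end_near. Qed.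

Lemma cvg_scaleV (R : realType) n (T : topologicalType) (f : T -> R)
    (g : T -> 'rV[R]_n) x : f x != 0 ->
  {for x, continuous f} -> {for x, continuous g} ->
  {for x, continuous (fun y => (f y)^-1 *: g y)}.
Proof. by move=> fx cf cg; apply: cvgZ => //; exact: cvgV. Qed.

Lemma cvg_normal (R : realType) m (j : 'I_(m + m))
    (ab : 'rV[R]_(m + m) * 'rV[R]_(m + m)) :
  ab.2 0 j - ab.1 0 j != 0 ->
  {for ab, continuous (fun x : 'rV[R]_(m + m) * 'rV[R]_(m + m) =>
     (x.2 0 j - x.1 0 j)^-1 *: (x.2 - x.1))}.
Proof.
move=> ab0.
have c1 i : {for ab, continuous (fun x : 'rV[R]_(m + m) * 'rV[R]_(m + m) => x.1 0 i)}.
  by apply: continuous_coord => x; exact: cvg_fst.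
have c2 i : {for ab, continuous (fun x : 'rV[R]_(m + m) * 'rV[R]_(m + m) => x.2 0 i)}.
  by apply: continuous_coord => x; exact: cvg_snd.
have c3 : {for ab, continuous (fun x : 'rV[R]_(m + m) * 'rV[R]_(m + m) => x.2 - x.1)}.
  by apply: continuous_subv => x; [exact: cvg_snd|exact: cvg_fst].
apply: (@cvg_scaleV _ _ _ (fun x : 'rV[R]_(m + m) * 'rV[R]_(m + m) => x.2 0 j - x.1 0 j)
  (fun x => x.2 - x.1)) => //.
exact: (continuousB (c2 j) (c1 j)).
Qed.

Lemma compact_normals (R : realType) m (j : 'I_(m + m)) (A B : set 'rV[R]_(m + m)) :
  compact A -> compact B -> (forall a b, A a -> B b -> b 0 j - a 0 j != 0) ->
  compact (normals j A B).
Proof.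
move=> cA cB AB; apply: continuous_compact; last exact: compact_setX.
apply: continuous_in_subspaceT => ab; rewrite inE => -[Aa Bb].
by apply: cvg_normal; exact: AB.
Qed.

(** [hypersurface] wants the larger j-th coordinates in B; pieces in the opposite order are swapped,
    and their normals stay the same. *)
Lemma normalsC (R : realType) m (j : 'I_(m + m)) (A B : set 'rV[R]_(m + m)) :
  normals j B A `<=` normals j A B.
Proof.
move=> _ [[b a] [/= Bb Aa] <-]; exists (a, b) => //=.
by rewrite -[in RHS]opprB invrN scaleNr -scalerN opprB.
Qed.

Lemma normals_subset (R : realType) m (j : 'I_(m + m)) (A B A' B' : set 'rV[R]_(m + m)) :
  A `<=` A' -> B `<=` B' -> normals j A B `<=` normals j A' B'.
Proof. by move=> AA' BB' _ [[a b] [/= Aa Bb] <-]; exists (a, b) => //; split; [exact: AA'|exact: BB']. Qed.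

(** For q x = S(x, x) / 2 and p = [Smap y] the functional is S(x, y) - S(x, x) / 2, whose supremum
    defines [psi]. *)
Definition maximiser (R : realType) n (q : 'rV[R]_n -> R) (A : set 'rV[R]_n) p a :=
  A a /\ forall a', A a' -> dotv a' p - q a' <= dotv a p - q a.

(** A0 and B0 are cut into closed pieces of radius 1 / (l + 1) around dense sequences. A pair of
    pieces is kept for coordinate j if the centres are more than 4 radii apart in that coordinate,
    as [hypersurface] asks, and if all normals between the pieces lie in W; other indices give
    [None]. Distinct maximisers a and b fall into a kept pair at a fine enough scale, because the
    normal depends continuously on (a, b) and W is open, and they remain maximisers over the
    pieces. *)
Lemma maximisers_cover (R : realType) m (A0 B0 W : set 'rV[R]_(m + m)) (q : 'rV[R]_(m + m) -> R) :
  closed A0 -> closed B0 -> open W -> continuous q ->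
  exists tr : nat -> option ('I_(m + m) * set 'rV[R]_(m + m) * ('rV[R]_(m + m) -> R)),
    (forall i j C h, tr i = Some (j, C, h) ->
      [/\ compact C, C `<=` [set x | x 0 j = 1], C `<=` W, C `<=` normals j A0 B0 &
          in_H j C h]) /\
    (forall p a b j, maximiser q A0 p a -> maximiser q B0 p b ->
      dotv a p - q a = dotv b p - q b -> a 0 j != b 0 j ->
      W ((b 0 j - a 0 j)^-1 *: (b - a)) ->
      exists i j' C h, tr i = Some (j', C, h) /\ h p = 0).
Proof.
move=> cA cB oW cq.
have [[A00 B00]|n00] := pselect (A0 !=set0 /\ B0 !=set0); last first.
  exists (fun=> None); split => // p a b j [Aa _] [Bb _].
  by exfalso; apply: n00; split; [exists a|exists b].
have [al [al1 al2]] := dense_seq A00.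
have [be [be1 be2]] := dense_seq B00.
pose ep (l : nat) : R := l.+1%:R^-1.
have ep0 l : 0 < ep l by rewrite invr_gt0.
pose A i l := A0 `&` [set x | `|x - al i| <= ep l].
pose B k l := B0 `&` [set x | `|x - be k| <= ep l].
pose good i k l (j : 'I_(m + m)) :=
  4 * ep l < `|be k 0 j - al i 0 j| /\ normals j (A i l) (B k l) `<=` W.
have Aj i l (j : 'I_(m + m)) a : A i l a -> `|a 0 j - al i 0 j| <= ep l.
  by move=> [_ /=]; apply: le_trans; have := norm_coord_le (a - al i) j; rewrite !mxE.
have Bj k l (j : 'I_(m + m)) b : B k l b -> `|b 0 j - be k 0 j| <= ep l.
  by move=> [_ /=]; apply: le_trans; have := norm_coord_le (b - be k) j; rewrite !mxE.
have ABj i k l (j : 'I_(m + m)) a b : 4 * ep l < `|be k 0 j - al i 0 j| ->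
    A i l a -> B k l b -> b 0 j - a 0 j != 0.
  move=> h /(Aj _ _ j) ha /(Bj _ _ j) hb; apply/negP => /eqP ab.
  have abE : b 0 j = a 0 j by lra.
  rewrite abE in hb; have := ler_distD (a 0 j) (be k 0 j) (al i 0 j).
  by rewrite [`|be k 0 j - a 0 j|]distrC; have := ep0 l; lra.
have cAi i l : compact (A i l) by exact: compact_setI_ball.
have cBk k l : compact (B k l) by exact: compact_setI_ball.
have surf i k l j : good i k l j -> exists h, in_H j (normals j (A i l) (B k l)) h /\
    (forall p a b, maximiser q (A i l) p a -> maximiser q (B k l) p b ->
      dotv a p - q a = dotv b p - q b -> h p = 0).
  move=> [g1 g2].
  have A1 : A i l !=set0 by exists (al i); split => //=; rewrite subrr normr0 ltW.
  have B1 : B k l !=set0 by exists (be k); split => //=; rewrite subrr normr0 ltW.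
  have [lt|lt] := leP (al i 0 j) (be k 0 j).
    rewrite ger0_norm in g1; last by lra.
    have [h h1 h2] := hypersurface (cAi i l) (cBk k l) A1 B1 cq g1 (@Aj i l j) (@Bj k l j).
    by exists h; split => // p a b [Aa ma] [Bb mb] ab; exact: (h2 p a b).
  rewrite ltr0_norm ?opprB in g1; last by lra.
  have [h h1 h2] := hypersurface (cBk k l) (cAi i l) B1 A1 cq g1 (@Bj k l j) (@Aj i l j).
  exists h; split; first exact: in_H_sub (@normalsC _ _ _ _ _) h1.
  by move=> p a b [Aa ma] [Bb mb] ab; exact: (h2 p b a).
pose goodt (t : nat * nat * nat * 'I_(m + m)) := good t.1.1.1 t.1.1.2 t.1.2 t.2.
have surf' (t : nat * nat * nat * 'I_(m + m)) :
  exists o : option ('I_(m + m) * set 'rV[R]_(m + m) * ('rV[R]_(m + m) -> R)),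
    (forall j C h, o = Some (j, C, h) -> [/\ goodt t, j = t.2,
       C = normals t.2 (A t.1.1.1 t.1.2) (B t.1.1.2 t.1.2) & in_H j C h]) /\
    (goodt t -> exists j C h, o = Some (j, C, h) /\
      forall p a b, maximiser q (A t.1.1.1 t.1.2) p a ->
        maximiser q (B t.1.1.2 t.1.2) p b -> dotv a p - q a = dotv b p - q b -> h p = 0).
  have [gt|ngt] := pselect (goodt t); last by exists None.
  have [h [h1 h2]] := surf _ _ _ _ gt.
  exists (Some (t.2, normals t.2 (A t.1.1.1 t.1.2) (B t.1.1.2 t.1.2), h)); split.
    by move=> _ _ _ [<- <- <-].
  by move=> _; do 3!eexists; split; first by [].
have [tau htau] := choice surf'.
exists (fun n => if unpickle n is Some t then tau t else None); split.
  move=> n j C h; case: unpickle => // t /(htau t).1[[g1 g2] -> -> hH].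
  split => //.
  - by apply: compact_normals => // a b Aa Bb; exact: ABj g1 Aa Bb.
  - move=> _ [[a b] [/= Aa Bb] <-] /=.
    by rewrite !mxE mulVf//; exact: ABj g1 Aa Bb.
  - by apply: normals_subset => x [].
move=> p a b j [Aa ma] [Bb mb] ab abj Wab.
have ab0 : b 0 j - a 0 j != 0 by rewrite subr_eq0 eq_sym.
have := @cvg_normal R m j (a, b) ab0 W.
have nW : nbhs ((b 0 j - a 0 j)^-1 *: (b - a)) W by exact: open_nbhs_nbhs.
move=> /(_ nW) /nbhs_ballP[r /= r0 hr].
(* The factor 6 is 4 radii of required separation plus one radius of error at each centre; r / 2
   allows for two radii, the diameter of a piece. *)
have [l hl] := @invS_lt R (Num.min (r / 2) (`|b 0 j - a 0 j| / 6))
  ltac:(by rewrite lt_min !divr_gt0// normr_gt0).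
move: hl; rewrite lt_min -/(ep l) => /andP[lr lab].
have [i hi] := al2 a Aa _ (ep0 l).
have [k hk] := be2 b Bb _ (ep0 l).
have hij : `|al i 0 j - a 0 j| < ep l.
  by apply: le_lt_trans hi; have := norm_coord_le (al i - a) j; rewrite !mxE.
have hkj : `|be k 0 j - b 0 j| < ep l.
  by apply: le_lt_trans hk; have := norm_coord_le (be k - b) j; rewrite !mxE.
have gt : goodt (i, k, l, j).
  split => /=.
    have h1 := ler_distD (be k 0 j) (b 0 j) (a 0 j).
    have h2 := ler_distD (al i 0 j) (be k 0 j) (a 0 j).
    rewrite [`|b 0 j - be k 0 j|]distrC in h1; lra.
  move=> _ [[a' b'] [/= [_ /= Aa'] [_ /= Bb']] <-] /=.
  apply: (hr (a', b')); split => /=; rewrite mx_norm_ball /ball_/=.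
    have := ler_distD (al i) a a'; rewrite [`|a - al i|]distrC [`|al i - a'|]distrC; lra.
  have := ler_distD (be k) b b'; rewrite [`|b - be k|]distrC [`|be k - b'|]distrC; lra.
have [j' [C [h [tauE hC]]]] := (htau (i, k, l, j)).2 gt.
exists (pickle (i, k, l, j)), j', C, h; rewrite pickleK; split => //.
apply: (hC p a b) => //=.
  by split; [split => //=; rewrite distrC ltW|move=> a' [Aa' _]; exact: ma].
by split; [split => //=; rewrite distrC ltW|move=> b' [Bb' _]; exact: mb].
Qed.

(** * Borel sets and Borel maps *)

Definition BV (R : realType) n := g_sigma_algebraType [set A : set 'rV[R]_n | open A].

Lemma borelE (R : realType) n (B : set 'rV[R]_n) :
  borel_rV B <-> measurable (B : set (BV R n)).
Proof. by []. Qed.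

Lemma borel_open (R : realType) n (O : set 'rV[R]_n) : open O -> borel_rV O.
Proof. by move=> oO; apply: sub_sigma_algebra. Qed.

Lemma borel0 (R : realType) n : borel_rV (set0 : set 'rV[R]_n).
Proof. by apply: borel_open; exact: open0. Qed.

Lemma borel_closed (R : realType) n (O : set 'rV[R]_n) : closed O -> borel_rV O.
Proof.
move=> cO; apply/borelE; rewrite -(setCK O); apply: measurableC.
apply: borel_open; exact: closed_openC cO.
Qed.

Lemma continuous_measurable (R : realType) (T : ptopologicalType) (G : set (set T))
    (h : T -> R) : [set A | open A] `<=` G -> continuous h ->
  measurable_fun setT (h : g_sigma_algebraType G -> R).
Proof.
move=> openG ch; apply: (@measurability _ _ (g_sigma_algebraType G) R setT
  h _ (measurable_realfun.RGenOpens.measurableE R)).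
move=> _ [_ [a [b ->]] <-]; rewrite setTI; apply: sub_sigma_algebra; apply: openG => /=.
by apply: open_comp; [move=> x _; exact: ch|exact: interval_open].
Qed.

(** Cubes are finite intersections of coordinate slabs, so this reduces Borel measurability of a
    vector to that of its coordinates ([rvec_measurable]). The radius -1 codes the empty cube. *)
Lemma open_cubes (R : realType) n (O : set 'rV[R]_n) : open O ->
  exists x : nat -> 'rV[R]_n, exists e : nat -> R,
    O = \bigcup_i [set z | `|z - x i| <= e i].
Proof.
move=> oO; have [->|/set0P O0] := eqVneq O set0.
  exists (fun=> 0), (fun=> -1); apply/seteqP; split => // z [i _ /=].
  by move=> h; have := normr_ge0 (z - 0); rewrite leNgt (le_lt_trans h)//; lra.
have [x [x1 x2]] := dense_seq O0.
have h (k : nat) : exists p : 'rV[R]_n * R, [set z | `|z - p.1| <= p.2] `<=` O /\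
    forall i l, unpickle k = Some (i, l) ->
    [set z | `|z - x i| <= l.+1%:R^-1] `<=` O -> p = (x i, l.+1%:R^-1).
  case uk : (unpickle k) => [[i l]|]; last first.
    exists (0, -1); split => // z /= h.
    by have := normr_ge0 (z - 0); rewrite leNgt (le_lt_trans h)//; lra.
  have [sub|nsub] := pselect ([set z | `|z - x i| <= l.+1%:R^-1] `<=` O).
    by exists (x i, l.+1%:R^-1); split => // i' l' [<- <-].
  exists (0, -1); split; last by move=> i' l' [<- <-].
  by move=> z /= h; have := normr_ge0 (z - 0); rewrite leNgt (le_lt_trans h)//; lra.
have [p hp] := choice h.
exists (fun k => (p k).1), (fun k => (p k).2); apply/seteqP; split; last first.
  by move=> z [k _ hz]; exact: (hp k).1.
move=> z Oz.
have /nbhs_ballP[r /= r0] : nbhs z O by exact: open_nbhs_nbhs.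
rewrite mx_norm_ball => hr.
have [l hl] := @invS_lt R (r / 2) ltac:(lra).
have l0 : 0 < l.+1%:R^-1 :> R by rewrite invr_gt0.
have [i hi] := x2 z Oz _ l0.
exists (pickle (i, l)) => //=; rewrite ((hp (pickle (i, l))).2 i l).
- by rewrite /= distrC ltW.
- by rewrite pickleK.
- move=> y /= hy; apply: hr; rewrite /ball_/=.
  have := ler_distD (x i) z y; rewrite [`|z - x i|]distrC [`|x i - y|]distrC.
  by move: (l.+1%:R^-1) hl hi hy => e ? ? ?; lra.
Qed.

Lemma rvec_measurable (R : realType) d (T : measurableType d) n (X : T -> 'rV[R]_n) :
  rvec X -> measurable_fun setT (X : T -> BV R n).
Proof.
move=> mX; apply: (@measurability _ _ T (BV R n) setT X [set A : set 'rV[R]_n | open A]).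
  by [].
move=> _ [D oD <-]; rewrite setTI; have [x [e ->]] := open_cubes oD.
rewrite preimage_bigcup; apply: bigcup_measurable => k _.
have [ek|ek] := leP 0 (e k); last first.
  rewrite (_ : _ @^-1` _ = set0)//; apply/seteqP; split => // w /= h.
  by have := normr_ge0 (X w - x k); rewrite leNgt (le_lt_trans h).
rewrite (_ : _ @^-1` _ = \bigcap_(i in [set: 'I_n])
    ((fun w => X w 0 i) @^-1` `[x k 0 i - e k, x k 0 i + e k])); last first.
  apply/seteqP; split => w /=.
    move/norm_rV_le => /(_ ek) h i _ /=; have := h i; rewrite !mxE in_itv/=.
    by rewrite ler_norml => /andP[? ?]; apply/andP; split; lra.
  move=> h; apply/norm_rV_le => // i; have := h i I; rewrite !mxE /= in_itv/=.
  by rewrite ler_norml => /andP[? ?]; apply/andP; split; lra.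
apply: fin_bigcap_measurable => // i _; rewrite -[X in measurable X]setTI.
exact: mX.
Qed.

Lemma rvec_borel (R : realType) d (T : measurableType d) n (X : T -> 'rV[R]_n) B :
  rvec X -> borel_rV B -> measurable (X @^-1` B).
Proof.
move=> /rvec_measurable mX mB; rewrite -[X in measurable X]setTI.
exact: (mX measurableT B mB).
Qed.

Lemma rvec_fun (R : realType) d (T : measurableType d) n (X : T -> 'rV[R]_n)
    (h : BV R n -> R) : rvec X -> measurable_fun setT h ->
  measurable_fun setT (fun w => h (X w)).
Proof. by move=> /rvec_measurable mX mh; exact: (measurableT_comp mh mX). Qed.

Lemma rvec_cont (R : realType) d (T : measurableType d) n (X : T -> 'rV[R]_n)
    (h : 'rV[R]_n -> R) : rvec X -> continuous h ->
  measurable_fun setT (fun w => h (X w)).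
Proof. by move=> mX ch; exact: (rvec_fun mX (continuous_measurable (@subset_refl _ _) ch)). Qed.

Lemma measurable_rvec (R : realType) d (T : measurableType d) n (X : T -> 'rV[R]_n) :
  (forall B, borel_rV B -> measurable (X @^-1` B)) -> rvec X.
Proof.
move=> mX i; have mX' : measurable_fun setT (X : T -> BV R n).
  by move=> _ B mB; rewrite setTI; exact: mX.
have ci := continuous_measurable (@subset_refl _ _) (@coord_continuous R 1 n 0 i).
exact: (measurableT_comp ci mX').
Qed.

Lemma rvec_borel_fun (R : realType) d (T : measurableType d) n k (X : T -> 'rV[R]_n)
    (f : 'rV[R]_n -> 'rV[R]_k) : rvec X -> borel_fun f -> rvec (fun w => f (X w)).
Proof.
move=> mX bf; apply: measurable_rvec => B /bf bB; exact: (rvec_borel mX bB).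
Qed.

Lemma borel_fun_coord (R : realType) n k (f : 'rV[R]_n -> 'rV[R]_k) i : borel_fun f ->
  measurable_fun setT ((fun x => f x 0 i) : BV R n -> R).
Proof.
move=> bf; have mf : measurable_fun setT (f : BV R n -> BV R k).
  by move=> _ B mB; rewrite setTI; exact: bf.
have ci := continuous_measurable (@subset_refl _ _) (@coord_continuous R 1 k 0 i).
exact: (measurableT_comp ci mf).
Qed.

Lemma borel_fun_rvec (R : realType) n k (f : 'rV[R]_n -> 'rV[R]_k) :
  (forall i, measurable_fun setT ((fun x => f x 0 i) : BV R n -> R)) -> borel_fun f.
Proof.
move=> mf B mB; apply: (@rvec_borel R _ (BV R n) k f B _ mB) => i; exact: mf.
Qed.

Lemma rvec_row (R : realType) d (T : measurableType d) n k (X : T -> 'rV[R]_n)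
    (Y : T -> 'rV[R]_k) : rvec X -> rvec Y -> rvec (fun w => row_mx (X w) (Y w)).
Proof.
move=> mX mY i; case: (split_ordP i) => l ->.
  by under eq_fun do rewrite row_mxEl; exact: mX.
by under eq_fun do rewrite row_mxEr; exact: mY.
Qed.

Lemma borel_fun_row (R : realType) n k l (f : 'rV[R]_n -> 'rV[R]_k)
    (g : 'rV[R]_n -> 'rV[R]_l) : borel_fun f -> borel_fun g ->
  borel_fun (fun x => row_mx (f x) (g x)).
Proof.
move=> bf bg; apply: borel_fun_rvec.
by apply: (@rvec_row R _ (BV R n) k l f g) => i; exact: borel_fun_coord.
Qed.

Lemma continuous_pair (T U V : topologicalType) (f : T -> U) (g : T -> V) :
  continuous f -> continuous g -> continuous (fun x => (f x, g x)).
Proof. by move=> cf cg x; apply: cvg_pair; [exact: cf|exact: cg]. Qed.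

(** The sigma-algebra of [pairspace] is generated by the open sets of the product, not by
    rectangles; concatenating the two vectors turns these open sets into open sets of a single row
    space, where [rvec_borel] applies. *)
Lemma measurable_pair (R : realType) d (T : measurableType d) m
    (X Y : T -> 'rV[R]_(m + m)) :
  rvec X -> rvec Y -> measurable_fun setT ((fun w => (X w, Y w)) : T -> pairspace R m).
Proof.
move=> mX mY; apply: (@measurability _ _ T (pairspace R m) setT _ (@open_pair R m)).
  by [].
move=> _ [D oD <-]; rewrite setTI.
pose s (z : 'rV[R]_((m + m) + (m + m))) := (lsubmx z, rsubmx z).
have cs : continuous s.
  by apply: continuous_pair; [exact: continuous_lsubmx|exact: continuous_rsubmx].
have oD' : open (s @^-1` D) by apply: open_comp => // z _; exact: cs.
have := rvec_borel (rvec_row mX mY) (borel_open oD').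
congr measurable; apply/seteqP; split => w; rewrite /= /s row_mxKl row_mxKr//.
Qed.

Lemma continuous_pairspace (R : realType) m (h : 'rV[R]_(m + m) * 'rV[R]_(m + m) -> R) :
  continuous h -> measurable_fun setT (h : pairspace R m -> R).
Proof.
move=> ch; apply: (@measurability _ _ (pairspace R m) R setT h _
  (measurable_realfun.RGenOpens.measurableE R)).
move=> _ [_ [a [b ->]] <-]; rewrite setTI; apply: sub_sigma_algebra.
by apply: open_comp; [move=> x _; exact: ch|exact: interval_open].
Qed.

Lemma rvec_fst (R : realType) m :
  rvec ((fun z => z.1) : pairspace R m -> 'rV[R]_(m + m)).
Proof.
move=> i; apply: continuous_pairspace.
by apply: continuous_coord => x; exact: cvg_fst.
Qed.

Lemma rvec_snd (R : realType) m :
  rvec ((fun z => z.2) : pairspace R m -> 'rV[R]_(m + m)).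
Proof.
move=> i; apply: continuous_pairspace.
by apply: continuous_coord => x; exact: cvg_snd.
Qed.

(** * Square-integrable random vectors and conditional expectations *)

Lemma integrable_addf (R : realType) d (T : measurableType d) (P : probability T R)
    (f g : T -> R) : P.-integrable setT (EFin \o f) -> P.-integrable setT (EFin \o g) ->
  P.-integrable setT (fun w => (f w + g w)%:E).
Proof. by move=> fi gi; exact: (integrableD measurableT fi gi). Qed.

Lemma integrable_scalef (R : realType) d (T : measurableType d) (P : probability T R)
    (c : R) (f : T -> R) : P.-integrable setT (EFin \o f) ->
  P.-integrable setT (fun w => (c * f w)%:E).
Proof. by move=> fi; exact: (integrableZl measurableT c fi). Qed.

Lemma integrable_subf (R : realType) d (T : measurableType d) (P : probability T R)
    (f g : T -> R) : P.-integrable setT (EFin \o f) -> P.-integrable setT (EFin \o g) ->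
  P.-integrable setT (fun w => (f w - g w)%:E).
Proof. by move=> fi gi; exact: (integrableB measurableT fi gi). Qed.

Lemma integrable_mulf (R : realType) d (T : measurableType d) (P : probability T R)
    (f g : T -> R) : measurable_fun setT f -> measurable_fun setT g ->
  P.-integrable setT (fun w => (f w ^+ 2)%:E) ->
  P.-integrable setT (fun w => (g w ^+ 2)%:E) ->
  P.-integrable setT (fun w => (f w * g w)%:E).
Proof.
move=> mf mg fi gi; apply: le_integrable (integrable_addf fi gi) => //.
  by apply/measurable_EFinP; exact: measurable_funM.
move=> w _; rewrite /= lee_fin [leRHS]ger0_norm ?addr_ge0 ?sqr_ge0// normrM.
have := sqr_ge0 (`|f w| - `|g w|); have := sqr_ge0 (f w); have := sqr_ge0 (g w).
by rewrite sqrrB !real_normK ?num_real// => ? ? ?; lra.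
Qed.

Lemma integrable_cstf (R : realType) d (T : measurableType d) (P : probability T R)
    (c : R) : P.-integrable setT (fun=> c%:E).
Proof. exact: (finite_measure_integrable_cst P c measurableT). Qed.

Lemma L2_integrable (R : realType) d (T : measurableType d) (P : probability T R) n
    (X : T -> 'rV[R]_n) i : L2 P X -> P.-integrable setT (fun w => (X w 0 i)%:E).
Proof.
move=> [mX iX].
have : P.-integrable setT (fun w => (X w 0 i * (cst 1 w))%:E).
  apply: integrable_mulf => //; rewrite /cst expr1n; exact: integrable_cstf.
by under eq_fun do rewrite mulr1.
Qed.

Lemma L2_dotv (R : realType) d (T : measurableType d) (P : probability T R) n
    (X Y : T -> 'rV[R]_n) : L2 P X -> L2 P Y ->
  P.-integrable setT (fun w => (dotv (X w) (Y w))%:E).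
Proof.
move=> [mX iX] [mY iY].
have := @integrable_sum _ T R P setT measurableT 'I_n (index_enum 'I_n) xpredT
  (fun i w => (X w 0 i * Y w 0 i)%:E) (fun i _ => integrable_mulf (mX i) (mY i) (iX i) (iY i)).
by under eq_fun do rewrite sumEFin.
Qed.

Lemma L2_sub (R : realType) d (T : measurableType d) (P : probability T R) n
    (X Y : T -> 'rV[R]_n) : L2 P X -> L2 P Y -> L2 P (fun w => X w - Y w).
Proof.
move=> X2 Y2; have [mX iX] := X2; have [mY iY] := Y2.
split=> i; first by under eq_fun do rewrite !mxE; exact: measurable_funB.
under eq_fun do rewrite !mxE sqrrB.
have h := integrable_mulf (mX i) (mY i) (iX i) (iY i).
have := integrable_addf (integrable_addf (iX i) (iY i)) (integrable_scalef (-2) h).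
by congr integrable; apply/funext => w /=; congr EFin; ring.
Qed.

Lemma L2_row (R : realType) d (T : measurableType d) (P : probability T R) n k
    (X : T -> 'rV[R]_n) (Y : T -> 'rV[R]_k) :
  L2 P X -> L2 P Y -> L2 P (fun w => row_mx (X w) (Y w)).
Proof.
move=> [mX iX] [mY iY]; split; first exact: rvec_row.
move=> i; case: (split_ordP i) => l ->.
  by under eq_fun do rewrite row_mxEl.
by under eq_fun do rewrite row_mxEr.
Qed.

Lemma L2_lsubmx (R : realType) d (T : measurableType d) (P : probability T R) m
    (X : T -> 'rV[R]_(m + m)) : L2 P X -> L2 P (fun w => lsubmx (X w)).
Proof. by move=> [mX iX]; split => i; under eq_fun do rewrite mxE; [exact: mX|exact: iX]. Qed.

Lemma L2_rsubmx (R : realType) d (T : measurableType d) (P : probability T R) m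
    (X : T -> 'rV[R]_(m + m)) : L2 P X -> L2 P (fun w => rsubmx (X w)).
Proof. by move=> [mX iX]; split => i; under eq_fun do rewrite mxE; [exact: mX|exact: iX]. Qed.

Lemma L2_Sform (R : realType) d (T : measurableType d) (P : probability T R) m
    (X Y : T -> 'rV[R]_(m + m)) : L2 P X -> L2 P Y ->
  P.-integrable setT (fun w => (Sform (X w) (Y w))%:E).
Proof.
move=> X2 Y2; apply: integrable_addf; apply: L2_dotv.
- exact: L2_rsubmx. - exact: L2_lsubmx. - exact: L2_lsubmx. - exact: L2_rsubmx.
Qed.

Lemma L2_cst (R : realType) d (T : measurableType d) (P : probability T R) n
    (x : 'rV[R]_n) : L2 P (fun=> x).
Proof. by split=> i; [exact: measurable_cst|exact: integrable_cstf]. Qed.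

Lemma integral_indic_comp (R : realType) d (T : measurableType d) (P : probability T R)
    n (X : T -> 'rV[R]_n) (A : set 'rV[R]_n) (D : T -> R) :
  (\int[P]_w (\1_A (X w) * D w)%:E = \int[P]_(w in X @^-1` A) (D w)%:E)%E.
Proof.
rewrite [RHS]integral_mkcond; apply: eq_integral => w _.
rewrite patchE indicE.
have -> : (w \in X @^-1` A) = (X w \in A) by apply/idP/idP; rewrite !inE.
by case: (X w \in A); rewrite ?mul1r ?mul0r.
Qed.

Lemma integrable_indic_comp (R : realType) d (T : measurableType d) (P : probability T R)
    n (X : T -> 'rV[R]_n) (A : set 'rV[R]_n) (D : T -> R) :
  rvec X -> borel_rV A -> P.-integrable setT (EFin \o D) ->
  P.-integrable setT (fun w => (\1_A (X w) * D w)%:E).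
Proof.
move=> mX bA iD; have iD' := iD; apply: le_integrable iD' => //.
  apply/measurable_EFinP; apply: measurable_funM; last first.
    by have /measurable_int/measurable_EFinP := iD.
  apply: (rvec_fun mX (h := \1_A)).
  exact: (@measurable_indic _ (BV R n) R setT A bA).
move=> w _; rewrite /= lee_fin normrM indicE; case: (_ \in _) => /=.
  by rewrite normr1 mul1r.
by rewrite normr0 mul0r.
Qed.

(** Passes from indicators to Borel weights h that may be unbounded: simple functions increase to h,
    and |h(X) D| is a dominating function. *)
Lemma integral_comp_mul_eq0_ge0 (R : realType) d (T : measurableType d)
    (P : probability T R) n (X : T -> 'rV[R]_n) (D : T -> R) (h : BV R n -> R) :
  rvec X -> P.-integrable setT (EFin \o D) ->
  (forall B, borel_rV B -> (\int[P]_(w in X @^-1` B) (D w)%:E = 0)%E) ->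
  measurable_fun setT h -> (forall x, 0 <= h x) ->
  P.-integrable setT (fun w => (h (X w) * D w)%:E) ->
  (\int[P]_w (h (X w) * D w)%:E = 0)%E.
Proof.
move=> mX iD D0 mh h0 ihD.
have mh' : @measurable_fun _ _ (BV R n) _ setT (EFin \o h) by apply/measurable_EFinP.
pose f_ := nnsfun_approx measurableT mh'.
have f_le k x : f_ k x <= h x.
  by rewrite -lee_fin /f_ nnsfun_approxE; apply: le_approx => // y _; rewrite lee_fin.
have f_0 k : (\int[P]_w (f_ k (X w) * D w)%:E = 0)%E.
  have E w : (f_ k (X w) * D w)%:E =
    (\sum_(i < size (finmap.enum_fset (fset_set (range (f_ k)))))
      ((finmap.enum_fset (fset_set (range (f_ k))))`_i)%:E *
      (\1_(f_ k @^-1` [set (finmap.enum_fset (fset_set (range (f_ k))))`_i]) (X w) * D w)%:E)%E.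
    rewrite (fimfunEord (f_ k)) mulr_suml -sumEFin; apply: eq_bigr => i _.
    by rewrite -EFinM mulrA.
  under eq_integral do rewrite E.
  have bA i : borel_rV (f_ k @^-1` [set i]) by exact: (measurable_sfunP (f_ k)).
  rewrite integral_sum//; last first.
    move=> i; apply: integrableZl => //; exact: integrable_indic_comp.
  rewrite big1// => i _; rewrite integralZl//; last exact: integrable_indic_comp.
  by rewrite integral_indic_comp D0// mule0.
have mD : measurable_fun setT D by have /measurable_int/measurable_EFinP := iD.
have [] := @dominated_convergence _ T R P setT measurableT
  (fun k w => (f_ k (X w) * D w)%:E) (fun w => (h (X w) * D w)%:E)
  (fun w => (`|h (X w) * D w|)%:E).
- move=> k; apply/measurable_EFinP; apply: measurable_funM => //.
  exact: (rvec_fun mX).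
- exact: measurable_int ihD.
- apply: aeW => w _; apply: cvg_EFin; first exact: nearW.
  apply: cvgMl; have := @cvg_nnsfun_approx _ _ R setT measurableT _ mh'
    (fun x _ => (h0 x : (0 <= (EFin \o h) x)%E)) (X w) I.
  by move=> /fine_cvg.
- exact: (integrable_abse ihD).
- apply: aeW => w k _; rewrite /= lee_fin !normrM ler_wpM2r// ger0_norm//.
  by rewrite ger0_norm.
move=> _ _; rewrite /=; under eq_fun do rewrite f_0.
by move=> /cvg_lim <-//; apply/cvg_lim => //; exact: cvg_cst.
Qed.

Lemma integral_comp_mul_eq0 (R : realType) d (T : measurableType d)
    (P : probability T R) n (X : T -> 'rV[R]_n) (D : T -> R) (h : BV R n -> R) :
  rvec X -> P.-integrable setT (EFin \o D) ->
  (forall B, borel_rV B -> (\int[P]_(w in X @^-1` B) (D w)%:E = 0)%E) ->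
  measurable_fun setT h ->
  P.-integrable setT (fun w => (h (X w) * D w)%:E) ->
  (\int[P]_w (h (X w) * D w)%:E = 0)%E.
Proof.
move=> mX iD D0 mh ihD.
have mD : measurable_fun setT D by have /measurable_int/measurable_EFinP := iD.
have hE x : h x = Num.max (h x) 0 - Num.max (- h x) 0.
  by rewrite /Num.max; do 2!case: ifPn => ?; lra.
have mp : measurable_fun setT (fun x : BV R n => Num.max (h x) 0).
  exact: measurable_maxr.
have mn : measurable_fun setT (fun x : BV R n => Num.max (- h x) 0).
  by apply: measurable_maxr => //; exact: measurableT_comp.
have ip : P.-integrable setT (fun w => (Num.max (h (X w)) 0 * D w)%:E).
  apply: le_integrable ihD => //.
    by apply/measurable_EFinP; apply: measurable_funM => //; exact: (rvec_fun mX mp).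
  move=> w _; rewrite /= lee_fin !normrM ler_wpM2r//.
  by case: (leP (h (X w)) 0) => ?; rewrite ?normr0.
have iN : P.-integrable setT (fun w => (Num.max (- h (X w)) 0 * D w)%:E).
  apply: le_integrable ihD => //.
    by apply/measurable_EFinP; apply: measurable_funM => //; exact: (rvec_fun mX mn).
  move=> w _; rewrite /= lee_fin !normrM ler_wpM2r//.
  by case: (leP (- h (X w)) 0) => ?; rewrite ?normr0// normrN.
transitivity (\int[P]_w ((Num.max (h (X w)) 0 * D w)%:E - (Num.max (- h (X w)) 0 * D w)%:E))%E.
  by apply: eq_integral => w _; rewrite {1}hE -EFinB -mulrBl.
rewrite integralB_EFin//.
rewrite (integral_comp_mul_eq0_ge0 mX iD D0 mp)//; last by move=> x; rewrite le_max lexx orbT.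
rewrite (integral_comp_mul_eq0_ge0 mX iD D0 mn)//; last by move=> x; rewrite le_max lexx orbT.
by rewrite sube0.
Qed.

(** The charge B -> E[W; X in B] is absolutely continuous with respect to the law of X. Taking the
    Radon-Nikodym derivative on the target space yields the conditional expectation already factored
    through X. *)
Lemma condexp_exists (R : realType) d (T : measurableType d) (P : probability T R) n
    (X : T -> 'rV[R]_n) (W : T -> R) :
  rvec X -> P.-integrable setT (EFin \o W) ->
  exists h : BV R n -> R, [/\ measurable_fun setT h,
    P.-integrable setT (fun w => (h (X w))%:E) &
    forall B, borel_rV B ->
    (\int[P]_(w in X @^-1` B) (W w)%:E = \int[P]_(w in X @^-1` B) (h (X w))%:E)%E].
Proof.
move=> mX iW.
have mX' := rvec_measurable mX.
pose Xm : {mfun T >-> BV R n} := HB.pack (X : T -> BV R n) (isMeasurableFun.Build _ _ _ _ _ mX').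
pose nu : {charge set T -> \bar R} := induced_charge iW.
pose nuX0 : {charge set (BV R n) -> \bar R} := pushforward nu Xm.
pose nuX : {charge set (BV R n) -> \bar R} := nuX0 mX'.
pose mu : probability (BV R n) R := distribution P Xm.
have dom : nuX `<< mu.
  apply: dominates_pushforward => //; apply/null_content_dominatesP => A mA PA0.
  apply: null_set_integral => //; apply: measurable_funS (measurable_int _ iW) => //.
pose h := Radon_Nikodym nuX mu.
have hfin x : h x \is a fin_num by exact: Radon_Nikodym_fin_num.
have ih : mu.-integrable setT h by exact: Radon_Nikodym_integrable.
have mh : measurable_fun setT h by exact: measurable_int ih.
have ihX : P.-integrable setT (h \o X).
  apply/integrableP; split; first exact: (measurableT_comp mh mX').
  have /integrableP[_] := ih.
  rewrite /mu ge0_integral_distribution//.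
  exact: measurableT_comp.
exists (fine \o h); split.
- exact: measurableT_comp.
- by apply: eq_integrable ihX => // w _; rewrite /= fineK.
- move=> B bB.
  transitivity (nuX B); first by [].
  rewrite (Radon_Nikodym_integral dom bB).
  have mXB : measurable (X @^-1` B) by exact: rvec_borel.
  rewrite /mu /distribution (integral_pushforward mX')//.
    by apply: eq_integral => w _; rewrite /= fineK.
  exact: integrableS ihX.
Qed.

(** * Duality *)

(** E[Y | X] = X for square-integrable X and Y. Measurability of X with respect to Y is left out so
    that the coordinates of a plan qualify. *)
Definition martingale (R : realType) d (T : measurableType d) (P : probability T R) m
    (X Y : T -> 'rV[R]_(m + m)) : Prop :=
  [/\ L2 P X, L2 P Y & forall B, borel_rV B -> forall k,
    (\int[P]_(w in X @^-1` B) (Y w 0 k)%:E = \int[P]_(w in X @^-1` B) (X w 0 k)%:E)%E].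

(** The value at Y of the point X in the supremum defining a gap. Its mean differs from the primal
    value E[S(X, Y)] / 2 by a constant depending only on the law of Y; see [kap_value]. *)
Definition kap (R : realType) (T : Type) m (X Y : T -> 'rV[R]_(m + m)) (w : T) : R :=
  - Sform (X w - Y w) (X w - Y w) / 2.

Lemma condexp_orth (R : realType) d (T : measurableType d) (P : probability T R) n
    (X : T -> 'rV[R]_n) (W Z : T -> R) (h : BV R n -> R) :
  rvec X -> P.-integrable setT (EFin \o W) -> P.-integrable setT (EFin \o Z) ->
  (forall B, borel_rV B ->
    (\int[P]_(w in X @^-1` B) (W w)%:E = \int[P]_(w in X @^-1` B) (Z w)%:E)%E) ->
  measurable_fun setT h ->
  P.-integrable setT (fun w => (h (X w) * W w)%:E) ->
  P.-integrable setT (fun w => (h (X w) * Z w)%:E) ->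
  (\int[P]_w (h (X w) * W w)%:E = \int[P]_w (h (X w) * Z w)%:E)%E.
Proof.
move=> mX iW iZ WZ mh ihW ihZ.
have iD := integrable_subf iW iZ.
have ihD : P.-integrable setT (fun w => (h (X w) * (W w - Z w))%:E).
  by under eq_fun do rewrite mulrBr; exact: integrable_subf.
have D0 B : borel_rV B -> (\int[P]_(w in X @^-1` B) (W w - Z w)%:E = 0)%E.
  move=> bB; have mB := rvec_borel mX bB.
  have iWB : P.-integrable (X @^-1` B) (EFin \o W) by exact: integrableS iW.
  have iZB : P.-integrable (X @^-1` B) (EFin \o Z) by exact: integrableS iZ.
  rewrite integralB_EFin// WZ// subee//.
  exact: integrable_fin_num.
have := integral_comp_mul_eq0 mX iD D0 mh ihD.
under eq_integral do rewrite mulrBr EFinB.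
rewrite integralB_EFin// => /eqP.
by rewrite sube_eq ?add0e ?integrable_fin_num//; move/eqP.
Qed.

Lemma orth_dotv (R : realType) d (T : measurableType d) (P : probability T R) n k
    (X : T -> 'rV[R]_n) (W Z : T -> 'rV[R]_k) (h : 'rV[R]_n -> 'rV[R]_k) :
  rvec X -> L2 P W -> L2 P Z ->
  (forall B, borel_rV B -> forall i,
    (\int[P]_(w in X @^-1` B) (W w 0 i)%:E = \int[P]_(w in X @^-1` B) (Z w 0 i)%:E)%E) ->
  borel_fun h -> L2 P (fun w => h (X w)) ->
  (\int[P]_w (dotv (h (X w)) (W w))%:E = \int[P]_w (dotv (h (X w)) (Z w))%:E)%E.
Proof.
move=> mX W2 Z2 WZ bh h2; have [mh ih] := h2; have [mW iW] := W2; have [mZ iZ] := Z2.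
have iW' i := integrable_mulf (mh i) (mW i) (ih i) (iW i).
have iZ' i := integrable_mulf (mh i) (mZ i) (ih i) (iZ i).
transitivity (\int[P]_w (\sum_(i < k) (h (X w) 0 i * W w 0 i)%:E)%E)%E.
  by apply: eq_integral => w _; rewrite sumEFin.
rewrite integral_sum//.
transitivity (\int[P]_w (\sum_(i < k) (h (X w) 0 i * Z w 0 i)%:E)%E)%E; last first.
  by apply: eq_integral => w _; rewrite sumEFin.
rewrite integral_sum//; apply: eq_bigr => i _.
apply: (condexp_orth (h := (fun x => h x 0 i) : BV R n -> R) mX) => //.
- exact: L2_integrable. - exact: L2_integrable.
- by move=> B bB; exact: WZ.
- exact: borel_fun_coord.
Qed.

Lemma Sform_SmapC (R : realType) m (x y : 'rV[R]_(m + m)) : Sform x y = dotv (Smap x) y.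
Proof. by rewrite SformC Sform_Smap dotvC. Qed.

(** On X in B the weight c - X is a function of X, hence orthogonal to X - Y. This removes the cross
    term whenever a value is expanded around X by [kap_expand]. *)
Lemma martingale_cross (R : realType) d (T : measurableType d) (P : probability T R) m
    (X Y : T -> 'rV[R]_(m + m)) (c : 'rV[R]_(m + m)) B :
  martingale P X Y -> borel_rV B ->
  (\int[P]_(w in X @^-1` B) (Sform (c - X w) (X w - Y w))%:E = 0)%E.
Proof.
move=> [X2 Y2 XY] bB; have [mX iX] := X2; have mB := rvec_borel mX bB.
pose h (x : 'rV[R]_(m + m)) := \1_B x *: Smap (c - x).
have cx : L2 P (fun w => c - X w) by apply: L2_sub => //; exact: L2_cst.
have cx' : L2 P (fun w => Smap (c - X w)).
  by apply: L2_row; [exact: L2_rsubmx|exact: L2_lsubmx].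
have bh : borel_fun h.
  apply: borel_fun_rvec => i.
  rewrite (_ : (fun x => h x 0 i) = (fun x => \1_B x * Smap (c - x) 0 i)); last first.
    by apply/funext => x; rewrite mxE.
  apply: measurable_funM.
    exact: (@measurable_indic _ (BV R (m + m)) R setT B bB).
  apply: continuous_measurable => //; apply: continuous_coord.
  have c' : continuous (fun x : 'rV[R]_(m + m) => c - x).
    by apply: continuous_subv; [exact: cst_continuous|move=> x].
  by move=> x; apply: continuous_comp; [exact: c'|exact: continuous_Smap].
have h2 : L2 P (fun w => h (X w)).
  split; first exact: rvec_borel_fun.
  move=> i; have [mcx icx] := cx'; apply: le_integrable (icx i) => //.
    apply/measurable_EFinP; apply: measurable_funX.
    exact: (rvec_borel_fun mX bh).
  move=> w _; rewrite /= lee_fin mxE indicE; case: (_ \in _); first by rewrite mul1r.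
  by rewrite mul0r expr0n/= normr0.
have E := orth_dotv mX Y2 X2 XY bh h2.
have iY := L2_dotv h2 Y2; have iX' := L2_dotv h2 X2.
rewrite -integral_indic_comp.
transitivity (\int[P]_w ((dotv (h (X w)) (X w))%:E - (dotv (h (X w)) (Y w))%:E))%E.
  apply: eq_integral => w _; rewrite -EFinB; congr EFin.
  by rewrite /h !dotvZl Sform_SmapC dotvDr dotvNr mulrBr.
rewrite integralB_EFin// E subee//; exact: integrable_fin_num.
Qed.

Lemma integral_le_ge0 (R : realType) d (T : measurableType d) (P : probability T R)
    (A : set T) (g : T -> R) (f : T -> \bar R) : measurable A ->
  P.-integrable setT (EFin \o g) -> measurable_fun setT f ->
  (forall w, (0 <= f w)%E) -> (forall w, A w -> ((g w)%:E <= f w)%E) ->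
  (\int[P]_(w in A) (g w)%:E <= \int[P]_(w in A) f w)%E.
Proof.
move=> mA ig mf f0 gf.
have mg : measurable_fun setT g by have /measurable_int/measurable_EFinP := ig.
have mg' : measurable_fun setT (fun w => (Num.max (g w) 0)%:E).
  by apply/measurable_EFinP; exact: measurable_maxr.
apply: (@le_trans _ _ (\int[P]_(w in A) (Num.max (g w) 0)%:E)%E).
  have igA : P.-integrable A (EFin \o g) by exact: integrableS ig.
  apply: le_integral => //.
    apply: le_integrable igA => //; first exact: measurable_funTS.
    by move=> w _; rewrite /= lee_fin; case: (leP (g w) 0) => ?; rewrite ?normr0.
  by move=> w _; rewrite /= lee_fin le_max lexx.
apply: ge0_le_integral => //.
- by move=> w _; rewrite lee_fin le_max lexx orbT.
- exact: measurable_funTS.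
- exact: measurable_funTS.
- by move=> w Aw; rewrite EFin_max ge_max gf// f0.
Qed.

(** A supremum over uncountably many continuous functions of y is lower semicontinuous: each set gap
    G > r is open. *)
Lemma gap_measurable (R : realType) m (G : set 'rV[R]_(m + m)) :
  measurable_fun setT (gap G : BV R (m + m) -> \bar R).
Proof.
apply: (@measurability _ _ (BV R (m + m)) _ setT _ _ (ErealGenOInfty.measurableE R)).
move=> _ [_ [r ->] <-]; rewrite setTI; apply: borel_open.
rewrite (_ : _ @^-1` _ = \bigcup_(x in G) [set y | r < - Sform (x - y) (x - y) / 2]).
  apply: bigcup_open => x _; apply: open_gt_fun; apply: continuous_mulf.
    by apply: continuous_oppf; exact: continuous_Sform_sub.
  exact: cst_continuous.
apply/seteqP; split => y /=.
  rewrite in_itv/= andbT => /ereal_sup_gt[_ [x Gx <-]]; rewrite lte_fin => h.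
  by exists x.
move=> [x Gx /= h]; rewrite in_itv/= andbT; apply: lt_le_trans (gap_ge _ Gx).
by rewrite lte_fin.
Qed.

Lemma gapY_measurable (R : realType) d (T : measurableType d) m
    (G : set 'rV[R]_(m + m)) (Y : T -> 'rV[R]_(m + m)) : rvec Y ->
  measurable_fun setT (fun w => gap G (Y w)).
Proof.
by move=> /rvec_measurable mY; exact: (measurableT_comp (@gap_measurable R m G) mY).
Qed.

Lemma kap_integrable (R : realType) d (T : measurableType d) (P : probability T R) m
    (X Y : T -> 'rV[R]_(m + m)) : L2 P X -> L2 P Y ->
  P.-integrable setT (EFin \o kap X Y).
Proof.
move=> X2 Y2; have XY2 := L2_sub X2 Y2.
have := integrable_scalef (- 2^-1) (L2_Sform XY2 XY2).
by congr integrable; apply/funext => w /=; congr EFin; rewrite /kap; lra.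
Qed.

Lemma kap_expand (R : realType) m (c x y : 'rV[R]_(m + m)) :
  - Sform (c - y) (c - y) / 2 = - Sform (x - y) (x - y) / 2
    - Sform (c - x) (c - x) / 2 - Sform (c - x) (x - y).
Proof. by rewrite !Sform_lin (SformC y x) (SformC x c) (SformC y c); lra. Qed.

Lemma gap_nonempty (R : realType) m (G : set 'rV[R]_(m + m)) :
  (forall z, (0 <= gap G z)%E) -> G !=set0.
Proof.
move=> G0; apply/set0P/negP => /eqP GE; have := G0 0.
by rewrite /gap GE image_set0 ereal_sup0.
Qed.

(* Since gap G >= 0, the sets {z | - S(x - z, x - z) / 2 > - e} with x in a dense sequence
   of G cover the space.  Where X lies in such a set, gap G Y >= - S(x - Y, x - Y) / 2 is
   expanded around X: the cross term has mean 0 and the quadratic one is > - e. *)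
Lemma weak_duality (R : realType) d (T : measurableType d) (P : probability T R) m
    (X Y : T -> 'rV[R]_(m + m)) (G : set 'rV[R]_(m + m)) B :
  martingale P X Y -> (forall z, (0 <= gap G z)%E) -> borel_rV B ->
  (\int[P]_(w in X @^-1` B) (kap X Y w)%:E <= \int[P]_(w in X @^-1` B) gap G (Y w))%E.
Proof.
move=> aXY G0 bB; have [X2 Y2 XY] := aXY; have [mX iX] := X2; have [mY iY] := Y2.
have ik := kap_integrable X2 Y2.
have mk : measurable_fun setT (kap X Y) by have /measurable_int/measurable_EFinP := ik.
have mgY := gapY_measurable G mY.
have mB := rvec_borel mX bB.
have ikB : P.-integrable (X @^-1` B) (EFin \o kap X Y) by exact: integrableS ik.
have [x [Gx dx]] := dense_seq (gap_nonempty G0).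
have cS (c : 'rV[R]_(m + m)) : continuous (fun z : 'rV[R]_(m + m) => - Sform (c - z) (c - z) / 2).
  apply: continuous_mulf; last exact: cst_continuous.
  by apply: continuous_oppf; exact: continuous_Sform_sub.
apply/lee_addgt0Pr => e e0.
pose F i := [set z : 'rV[R]_(m + m) | - e < - Sform (x i - z) (x i - z) / 2].
have bF i : borel_rV (F i) by apply: borel_open; exact: open_gt_fun.
have FT : \bigcup_i F i = setT.
  apply/seteqP; split => // z _.
  have /ereal_sup_gt[_ [g Gg <-]] : ((- e)%:E < gap G z)%E.
    by apply: lt_le_trans (G0 z); rewrite lte_fin; lra.
  rewrite lte_fin => hg.
  have op : open [set c : 'rV[R]_(m + m) | - e < - Sform (z - c) (z - c) / 2].
    exact: open_gt_fun.
  have /nbhs_ballP[r /= r0] : nbhs g [set c : 'rV[R]_(m + m) | - e < - Sform (z - c) (z - c) / 2].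
    by apply: open_nbhs_nbhs; split => //=; rewrite Sform_subC.
  rewrite mx_norm_ball => hr.
  have [i hi] := dx g Gg r r0.
  exists i => //; rewrite /F /= Sform_subC; apply: hr; rewrite /ball_/= distrC.
  exact: hi.
pose D i := X @^-1` (B `&` seqDU F i).
have bD i : borel_rV (B `&` seqDU F i).
  apply/borelE; apply: measurableI => //; apply: measurableD; first exact: bF.
  by apply: bigsetU_measurable => k _; exact: bF.
have mD i : measurable (D i) by exact: rvec_borel.
have DU : X @^-1` B = \bigcup_i D i.
  rewrite /D -preimage_bigcup -setI_bigcupr -seqDU_bigcup_eq FT setIT//.
have tD : trivIset setT D.
  apply/trivIsetP => i j _ _ ij; rewrite /D -preimage_setI setIACA.
  by have /trivIsetP/(_ i j I I ij) -> := trivIset_seqDU F; rewrite setI0 preimage_set0.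
(* Adding |kap| to both sides, and e to the right one, makes all integrands nonnegative on the sets
   used, so integrals can be summed over the pieces D i even if gap G (Y) has infinite mean. *)
pose f1 w := ((kap X Y w)%:E + `|kap X Y w|%:E)%E.
pose f2 w := (gap G (Y w) + (`|kap X Y w| + e)%:E)%E.
have mabs : measurable_fun setT (fun w => `|kap X Y w|) by exact: measurableT_comp.
have f10 w : (0 <= f1 w)%E.
  by rewrite /f1 -EFinD lee_fin; have := ler_norm (- kap X Y w); rewrite normrN; lra.
have f20 w : (0 <= f2 w)%E by rewrite /f2 adde_ge0// lee_fin addr_ge0// ltW.
have mf1 : measurable_fun setT f1.
  by apply: emeasurable_funD; apply/measurable_EFinP.
have mf2 : measurable_fun setT f2.
  apply: emeasurable_funD => //; apply/measurable_EFinP; exact: measurable_funD.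
have iabs : P.-integrable setT (fun w => `|kap X Y w|%:E) by exact: (integrable_abse ik).
have step i : (\int[P]_(w in D i) f1 w <= \int[P]_(w in D i) f2 w)%E.
  pose c w := Sform (x i - X w) (X w - Y w).
  have ic : P.-integrable setT (EFin \o c).
    by apply: L2_Sform; apply: L2_sub => //; exact: L2_cst.
  have i1 : P.-integrable setT (fun w => (kap X Y w + `|kap X Y w|)%:E).
    exact: integrable_addf.
  apply: (@le_trans _ _ (\int[P]_(w in D i) (kap X Y w + `|kap X Y w| - c w)%:E)%E).
    have i1D : P.-integrable (D i) (fun w => (kap X Y w + `|kap X Y w|)%:E).
      exact: integrableS i1.
    have icD : P.-integrable (D i) (EFin \o c) by exact: integrableS ic.
    under [leRHS]eq_integral do rewrite EFinB.
    rewrite integralB_EFin// martingale_cross// sube0.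
    rewrite le_eqVlt; apply/orP; left; apply/eqP; apply: eq_integral => w _.
    by rewrite /f1 -EFinD.
  apply: integral_le_ge0 => //; first exact: integrable_subf.
  move=> w [Bw [Fw _]]; rewrite /f2.
  have := gap_ge (Y w) (Gx i); rewrite (kap_expand _ (X w)) -/(kap X Y w) -/(c w) => h.
  apply: le_trans (leeD2r _ h); rewrite -EFinD lee_fin.
  by move: Fw; rewrite /F /=; lra.
have tot : (\int[P]_(w in X @^-1` B) f1 w <= \int[P]_(w in X @^-1` B) f2 w)%E.
  rewrite DU !ge0_integral_bigcup//; [|exact: measurable_funTS|exact: measurable_funTS].
  by apply: lee_nneseries => i *; [apply: integral_ge0 => *; exact: f10|exact: step].
have iabsB : P.-integrable (X @^-1` B) (fun w => `|kap X Y w|%:E) by exact: integrableS iabs.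
have fabs : (\int[P]_(w in X @^-1` B) `|kap X Y w|%:E)%E \is a fin_num.
  exact: integrable_fin_num.
move: tot; rewrite /f1 integralD_EFin//.
have -> : (\int[P]_(w in X @^-1` B) f2 w = \int[P]_(w in X @^-1` B) gap G (Y w) +
    (\int[P]_(w in X @^-1` B) `|kap X Y w|%:E + e%:E * P (X @^-1` B)))%E.
  rewrite /f2 ge0_integralD//; [|exact: measurable_funTS|by move=> w _; rewrite lee_fin addr_ge0// ltW|]; last first.
    by apply: measurable_funTS; apply/measurable_EFinP; exact: measurable_funD.
  congr (_ + _)%E; under eq_integral do rewrite EFinD.
  rewrite ge0_integralD//; [by rewrite integral_cst| |by move=> *; rewrite lee_fin ltW].
  by apply: measurable_funTS; apply/measurable_EFinP.
rewrite addeA (addeAC _ _ (e%:E * _)%E) leeD2rE// => /le_trans; apply.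
apply: leeD2l; rewrite -[leRHS]mule1; apply: lee_wpmul2l; first by rewrite lee_fin ltW.
exact: probability_le1.
Qed.

Lemma integral_ge0_eq0_ae (R : realType) d (T : measurableType d) (P : probability T R)
    (g : T -> \bar R) : measurable_fun setT g -> (forall w, (0 <= g w)%E) ->
  (\int[P]_w g w = 0)%E -> {ae P, forall w, g w = 0%E}.
Proof.
move=> mg g0 ig.
have [N [mN N0 sub]] : ae_eq P setT g (cst 0%E).
  apply/ae_eq_integral_abs => //; rewrite -[RHS]ig.
  by apply: eq_integral => w _; rewrite gee0_abs.
exists N; split => // w nw; apply: sub => h; apply: nw; exact: h.
Qed.

(** On C, where S(c - X, c - X) < 0, expanding the competitor c around X beats [kap] in mean by
    E[eta; C], with eta > 0 there; off C weak duality holds. Equality in total forces E[eta; C] <=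
    0, so C is null. *)
Lemma dual_polar_null (R : realType) d (T : measurableType d) (P : probability T R) m
    (X Y : T -> 'rV[R]_(m + m)) (G : set 'rV[R]_(m + m)) c :
  martingale P X Y -> (forall z, (0 <= gap G z)%E) -> G c ->
  (\int[P]_w gap G (Y w) <= \int[P]_w (kap X Y w)%:E)%E ->
  P (X @^-1` [set z | 0 < - Sform (c - z) (c - z) / 2]) = 0%E.
Proof.
move=> aXY G0 Gc le; have [X2 Y2 XY] := aXY; have [mX iX] := X2; have [mY iY] := Y2.
set C := [set z | _].
have cS : continuous (fun z : 'rV[R]_(m + m) => - Sform (c - z) (c - z) / 2).
  apply: continuous_mulf; last exact: cst_continuous.
  by apply: continuous_oppf; exact: continuous_Sform_sub.
have bC : borel_rV C by apply: borel_open; exact: open_gt_fun.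
have bC' : borel_rV (~` C) by apply/borelE; exact: measurableC.
have mC := rvec_borel mX bC; have mC' := rvec_borel mX bC'.
have ik := kap_integrable X2 Y2.
have mgY := gapY_measurable G mY.
pose eta w := - Sform (c - X w) (c - X w) / 2.
pose cr w := Sform (c - X w) (X w - Y w).
have cX2 : L2 P (fun w => c - X w) by apply: L2_sub => //; exact: L2_cst.
have XY2 : L2 P (fun w => X w - Y w) by exact: L2_sub.
have ieta : P.-integrable setT (EFin \o eta).
  have := integrable_scalef (- 2^-1) (L2_Sform cX2 cX2).
  by congr integrable; apply/funext => w /=; congr EFin; rewrite /eta; lra.
have icr : P.-integrable setT (EFin \o cr) by exact: L2_Sform.
have h1 : (\int[P]_(w in X @^-1` C) (kap X Y w)%:E + \int[P]_(w in X @^-1` C) (eta w)%:E <=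
    \int[P]_(w in X @^-1` C) gap G (Y w))%E.
  apply: (@le_trans _ _ (\int[P]_(w in X @^-1` C) (kap X Y w + eta w - cr w)%:E)%E).
    have ike := integrable_addf ik ieta.
    have ikeC : P.-integrable (X @^-1` C) (fun w => (kap X Y w + eta w)%:E).
      exact: integrableS ike.
    have icrC : P.-integrable (X @^-1` C) (EFin \o cr) by exact: integrableS icr.
    have ikC : P.-integrable (X @^-1` C) (EFin \o kap X Y) by exact: integrableS ik.
    have ietaC : P.-integrable (X @^-1` C) (EFin \o eta) by exact: integrableS ieta.
    under [leRHS]eq_integral do rewrite EFinB.
    rewrite integralB_EFin// martingale_cross// sube0.
    under [leRHS]eq_integral do rewrite EFinD.
    by rewrite integralD_EFin.
  apply: integral_le_ge0 => //; first exact/integrable_subf/icr/integrable_addf.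
  move=> w _; have := gap_ge (Y w) Gc; rewrite (kap_expand _ (X w)).
  by apply: le_trans; rewrite lee_fin /kap /eta /cr; lra.
have h2 := weak_duality aXY G0 bC'.
have CU : X @^-1` C `|` X @^-1` (~` C) = setT by rewrite -preimage_setU setUv preimage_setT.
have CD : [disjoint X @^-1` C & X @^-1` (~` C)].
  by apply/disj_setPS => w [Cw nCw]; exact: nCw.
have sk : (\int[P]_w (kap X Y w)%:E = \int[P]_(w in X @^-1` C) (kap X Y w)%:E +
    \int[P]_(w in X @^-1` (~` C)) (kap X Y w)%:E)%E.
  by rewrite -[in LHS]CU integral_setU_EFin// CU; have /measurable_int/measurable_EFinP := ik.
have sg : (\int[P]_w gap G (Y w) = \int[P]_(w in X @^-1` C) gap G (Y w) +
    \int[P]_(w in X @^-1` (~` C)) gap G (Y w))%E.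
  by rewrite -[in LHS]CU ge0_integral_setU// CU.
have fk : (\int[P]_w (kap X Y w)%:E)%E \is a fin_num by exact: integrable_fin_num.
have e0 : (\int[P]_(w in X @^-1` C) (eta w)%:E <= 0)%E.
  have := leeD h1 h2; rewrite -sg addeAC -sk => /le_trans/(_ le).
  by rewrite -[leRHS]adde0 leeD2lE.
have e0' : (\int[P]_w (\1_C (X w) * eta w)%:E = 0)%E.
  apply/eqP; rewrite eq_le integral_indic_comp e0/=.
  by apply: integral_ge0 => w Cw; rewrite lee_fin ltW.
have [||N [mN N0 sub]] := integral_ge0_eq0_ae _ _ e0'.
- exact: measurable_int (integrable_indic_comp mX bC ieta).
- move=> w; rewrite lee_fin indicE; case: (boolP (X w \in C)); last by rewrite mul0r.
  by rewrite inE mul1r => /ltW.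
apply: (@subset_measure0 _ _ _ P (X @^-1` C) N) => // w Cw; apply: sub => /= -[].
have : X w \in C by rewrite inE.
by rewrite indicE => ->; rewrite mul1r => eta0; move: Cw; rewrite /C /= -/(eta w) eta0 ltxx.
Qed.

(** A point outside the polar violates the inequality for an open set of c, hence for some member of
    a dense sequence of G, so countably many null sets from [dual_polar_null] suffice. On the polar,
    gap - kap >= 0 by [polar_gap], and its mean is zero. *)
Lemma dual_equality (R : realType) d (T : measurableType d) (P : probability T R) m
    (X Y : T -> 'rV[R]_(m + m)) (G : set 'rV[R]_(m + m)) :
  martingale P X Y -> (forall z, (0 <= gap G z)%E) ->
  (\int[P]_w gap G (Y w) <= \int[P]_w (kap X Y w)%:E)%E ->
  {ae P, forall w, polar G (X w) /\ gap G (Y w) = (kap X Y w)%:E}.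
Proof.
move=> aXY G0 le; have [X2 Y2 XY] := aXY; have [mX iX] := X2; have [mY iY] := Y2.
have [x [Gx dx]] := dense_seq (gap_nonempty G0).
have aepolar : {ae P, forall w, polar G (X w)}.
  have : P.-negligible (\bigcup_i (X @^-1` [set z | 0 < - Sform (x i - z) (x i - z) / 2])).
    apply: negligible_bigcup => i; apply/negligibleP; last exact: (dual_polar_null aXY).
    apply: (rvec_borel mX); apply: borel_open; apply: open_gt_fun.
    apply: continuous_mulf; last exact: cst_continuous.
    by apply: continuous_oppf; exact: continuous_Sform_sub.
  apply: negligibleS => w /= nP.
  have [g ng] : exists g, ~ (G g -> 0 <= Sform (g - X w) (g - X w)) by exact/existsNP.
  have [Gg /negP] : G g /\ ~ 0 <= Sform (g - X w) (g - X w) by exact/not_implyP.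
  rewrite -ltNge => gw.
  have op : open [set c : 'rV[R]_(m + m) | 0 < - Sform (X w - c) (X w - c)].
    by apply: open_gt_fun; apply: continuous_oppf; exact: continuous_Sform_sub.
  have /nbhs_ballP[r /= r0] : nbhs g [set c : 'rV[R]_(m + m) | 0 < - Sform (X w - c) (X w - c)].
    by apply: open_nbhs_nbhs; split => //=; rewrite Sform_subC oppr_gt0.
  rewrite mx_norm_ball => hr; have [i hi] := dx g Gg r r0.
  exists i => //=; rewrite Sform_subC divr_gt0//; apply: hr; rewrite /ball_/= distrC.
  exact: hi.
have ik := kap_integrable X2 Y2.
have mk : measurable_fun setT (kap X Y) by have /measurable_int/measurable_EFinP := ik.
have mgY := gapY_measurable G mY.
have iabs : P.-integrable setT (fun w => `|kap X Y w|%:E) by exact: (integrable_abse ik).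
have mabs : measurable_fun setT (fun w => `|kap X Y w|) by exact: measurableT_comp.
(* The difference is nonnegative only almost surely; truncation makes it so everywhere. Adding |kap|
   in f1 and f2 keeps every integrand nonnegative. *)
pose g w := maxe (gap G (Y w) - (kap X Y w)%:E)%E 0%E.
have mg : measurable_fun setT g.
  apply: measurable_maxe => //; apply: emeasurable_funB => //; exact/measurable_EFinP.
have g0 w : (0 <= g w)%E by rewrite /g le_max lexx orbT.
pose f1 w := (gap G (Y w) + `|kap X Y w|%:E)%E.
pose f2 w := ((kap X Y w)%:E + `|kap X Y w|%:E)%E.
have f10 w : (0 <= f1 w)%E by rewrite adde_ge0.
have f20 w : (0 <= f2 w)%E.
  by rewrite /f2 -EFinD lee_fin; have := ler_norm (- kap X Y w); rewrite normrN; lra.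
have mf1 : measurable_fun setT f1 by apply: emeasurable_funD => //; exact/measurable_EFinP.
have mf2 : measurable_fun setT f2 by apply: emeasurable_funD; exact/measurable_EFinP.
have E : (\int[P]_w f1 w = \int[P]_w f2 w + \int[P]_w g w)%E.
  rewrite -ge0_integralD//; apply: ge0_ae_eq_integral => //.
  - exact: emeasurable_funD.
  - by move=> w _; rewrite adde_ge0.
  - apply: filterS aepolar => w Pw _; rewrite /f1 /f2 /g.
    have := polar_gap (Y w) G0 Pw; rewrite -/(kap X Y w) => h.
    rewrite max_l ?sube_ge0//.
    by case: (gap G (Y w)) => [r| |] //=; rewrite -!EFinD; congr EFin; ring.
have ig0 : (\int[P]_w g w = 0)%E.
  apply/eqP; rewrite eq_le integral_ge0// andbT.
  have fk : (\int[P]_w (kap X Y w)%:E)%E \is a fin_num by exact: integrable_fin_num.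
  have fa : (\int[P]_w `|kap X Y w|%:E)%E \is a fin_num by exact: integrable_fin_num.
  move: E; rewrite /f1 /f2 integralD_EFin// ge0_integralD//; last exact/measurable_EFinP.
  move=> E; have : (\int[P]_w (kap X Y w)%:E + \int[P]_w `|kap X Y w|%:E + \int[P]_w g w <=
    \int[P]_w (kap X Y w)%:E + \int[P]_w `|kap X Y w|%:E)%E by rewrite -E leeD2r.
  by rewrite -[leRHS]adde0 leeD2lE// fin_numD fk.
have aeg := integral_ge0_eq0_ae mg g0 ig0.
apply: filterS2 aepolar aeg => w Pw gw; split => //.
apply/eqP; rewrite eq_le polar_gap// andbT.
have : (gap G (Y w) - (kap X Y w)%:E <= 0)%E by rewrite -gw /g le_max lexx.
by rewrite leeBlDr// add0e.
Qed.

(** The cross term with c = 0 gives E[S(X, X)] = E[S(X, Y)]. *)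
Lemma kap_value (R : realType) d (T : measurableType d) (P : probability T R) m
    (X Y : T -> 'rV[R]_(m + m)) : martingale P X Y ->
  (\int[P]_w (kap X Y w)%:E =
   \int[P]_w (Sform (X w) (Y w) / 2)%:E - \int[P]_w (Sform (Y w) (Y w) / 2)%:E)%E.
Proof.
move=> aXY; have [X2 Y2 XY] := aXY; have [mX iX] := X2.
have half (Z W : T -> 'rV[R]_(m + m)) : L2 P Z -> L2 P W ->
    P.-integrable setT (fun w => (Sform (Z w) (W w) / 2)%:E).
  move=> Z2 W2; have := integrable_scalef (2^-1) (L2_Sform Z2 W2).
  by congr integrable; apply/funext => w /=; congr EFin; lra.
pose cr w := Sform (0 - X w) (X w - Y w).
have icr : P.-integrable setT (EFin \o cr).
  by apply: L2_Sform; apply: L2_sub => //; exact: L2_cst.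
have cr0 : (\int[P]_w (cr w)%:E = 0)%E.
  have := martingale_cross 0 aXY (@measurableT _ (BV R (m + m))); rewrite preimage_setT; exact.
have icr2 := integrable_scalef 2^-1 icr.
have i1 := half _ _ X2 Y2; have i2 := half _ _ Y2 Y2.
have i12 := integrable_subf i1 i2.
transitivity (\int[P]_w ((Sform (X w) (Y w) / 2 - Sform (Y w) (Y w) / 2)%:E +
    (2^-1 * cr w)%:E))%E.
  apply: eq_integral => w _; rewrite -EFinD; congr EFin.
  by rewrite /kap /cr !Sform_lin Sform0l Sform0l (SformC (Y w) (X w)); lra.
have cr20 : (\int[P]_w (2^-1 * cr w)%:E = 0)%E.
  by under eq_integral do rewrite EFinM; rewrite integralZl// cr0 mule0.
rewrite integralD_EFin// [X in (_ + X)%E]cr20 adde0.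
rewrite -integralB_EFin//; by apply: eq_integral => w _; rewrite /= EFinB.
Qed.

(** * Equilibria attain the dual value *)

(* Testing the defining identity against the truncation h 1_{|h| <= N} gives
   E[h^2 1_{|h| <= N}] <= E[W^2]. *)
Lemma condexp_L2 (R : realType) d (T : measurableType d) (P : probability T R) n
    (X : T -> 'rV[R]_n) (W : T -> R) (h : BV R n -> R) :
  rvec X -> measurable_fun setT W -> P.-integrable setT (fun w => (W w ^+ 2)%:E) ->
  measurable_fun setT h -> P.-integrable setT (fun w => (h (X w))%:E) ->
  (forall B, borel_rV B ->
    (\int[P]_(w in X @^-1` B) (W w)%:E = \int[P]_(w in X @^-1` B) (h (X w))%:E)%E) ->
  P.-integrable setT (fun w => (h (X w) ^+ 2)%:E).
Proof.
move=> mX mW iW2 mh ih Wh.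
have iW : P.-integrable setT (EFin \o W).
  have : P.-integrable setT (fun w => (W w * (cst 1 w))%:E).
    apply: integrable_mulf => //; rewrite /cst expr1n; exact: integrable_cstf.
  by under eq_fun do rewrite mulr1.
have mhX := rvec_fun mX mh.
pose A (N : nat) : set (BV R n) := [set x | `|h x| <= N%:R].
have mA N : measurable (A N).
  rewrite (_ : A N = (fun x => `|h x|) @^-1` [set` `]-oo, N%:R]]); last first.
    by apply/seteqP; split => x; rewrite /A /= in_itv.
  rewrite -[X in measurable X]setTI.
  have : measurable_fun setT (fun x : BV R n => `|h x|) by exact: measurableT_comp.
  by apply => //; exact: measurable_itv.
pose hN (N : nat) (x : BV R n) : R := \1_(A N) x * h x.
have mhN N : measurable_fun setT (hN N).
  by apply: measurable_funM => //; exact: measurable_indic.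
have hNle N x : `|hN N x| <= N%:R.
  rewrite /hN indicE; case: (boolP (x \in A N)); first by rewrite inE mul1r.
  by rewrite mul0r normr0.
have bnd N (V : T -> R) : P.-integrable setT (EFin \o V) ->
    P.-integrable setT (fun w => (hN N (X w) * V w)%:E).
  move=> iV; have iNV := integrable_scalef N%:R iV.
  apply: le_integrable iNV => //.
    apply/measurable_EFinP; apply: measurable_funM; first exact: (rvec_fun mX).
    by have /measurable_int/measurable_EFinP := iV.
  move=> w _; rewrite /= lee_fin (normrM (hN N (X w))) (normrM N%:R) ler_wpM2r//.
  by apply: le_trans (hNle N (X w)) _; exact: ler_norm.
have hN2 N x : hN N x * h x = hN N x ^+ 2.
  by rewrite /hN indicE; case: (_ \in _); rewrite ?mul1r ?mul0r ?expr0n.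
have bound N : (\int[P]_w (hN N (X w) ^+ 2)%:E <= \int[P]_w (W w ^+ 2)%:E)%E.
  have E := condexp_orth mX iW ih Wh (mhN N) (bnd N _ iW) (bnd N _ ih).
  have ihN2 : P.-integrable setT (fun w => (hN N (X w) ^+ 2)%:E).
    by have := bnd N _ ih; congr integrable; apply/funext => w /=; rewrite hN2.
  have E' : (\int[P]_w (hN N (X w) * W w)%:E = \int[P]_w (hN N (X w) ^+ 2)%:E)%E.
    by rewrite E; apply: eq_integral => w _; rewrite hN2.
  have : (\int[P]_w (2 * (hN N (X w) * W w))%:E <=
      \int[P]_w (hN N (X w) ^+ 2 + W w ^+ 2)%:E)%E.
    apply: le_integral => //; [exact/integrable_scalef/bnd|exact: integrable_addf|].
    by move=> w _; rewrite lee_fin; have := sqr_ge0 (hN N (X w) - W w); rewrite sqrrB; lra.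
  under eq_integral do rewrite EFinM.
  under [leRHS]eq_integral do rewrite EFinD.
  rewrite integralZl//; last exact: bnd.
  rewrite integralD_EFin// E'.
  have f1 : (\int[P]_w (hN N (X w) ^+ 2)%:E)%E \is a fin_num by exact: integrable_fin_num.
  have f2 : (\int[P]_w (W w ^+ 2)%:E)%E \is a fin_num by exact: integrable_fin_num.
  by rewrite -(fineK f1) -(fineK f2) -EFinM -EFinD !lee_fin; lra.
pose F N := X @^-1` (A N).
have mF N : measurable (F N) by exact: (rvec_borel mX (mA N)).
have FU : \bigcup_N F N = setT.
  apply/seteqP; split => // w _; exists (Num.truncn `|h (X w)|).+1 => //.
  by rewrite /F /A /= ltW// truncnS_gt.
have ndF : {homo F : N M / (N <= M)%N >-> (N <= M)%O}.
  move=> N M NM; apply/subsetPset => w; rewrite /F /A /= => /le_trans; apply.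
  by rewrite ler_nat.
have m2 : measurable_fun setT (fun w => (h (X w) ^+ 2)%:E).
  by apply/measurable_EFinP; exact: measurable_funX.
apply/integrableP; split => //.
have -> : (\int[P]_w `|(h (X w) ^+ 2)%:E| = \int[P]_w (h (X w) ^+ 2)%:E)%E.
  by apply: eq_integral => w _; rewrite gee0_abs// lee_fin sqr_ge0.
have := @ge0_nondecreasing_set_cvg_integral _ T R F (fun w => (h (X w) ^+ 2)%:E) P ndF mF
  (fun i => measurable_funTS m2) (fun i w _ => sqr_ge0 (h (X w)) : (0 <= (h (X w) ^+ 2)%:E)%E).
rewrite FU => cv.
have /integrableP[_] := iW2.
rewrite (_ : (\int[P]_w `|(W w ^+ 2)%:E|)%E = (\int[P]_w (W w ^+ 2)%:E)%E); last first.
  by apply: eq_integral => w _; rewrite gee0_abs// lee_fin sqr_ge0.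
apply: le_lt_trans; rewrite -(cvg_lim _ cv)//; apply: lime_le.
  by apply/cvg_ex; eexists; exact: cv.
apply: nearW => N; apply: le_trans (bound N).
rewrite /F -integral_indic_comp le_eqVlt; apply/orP; left; apply/eqP.
apply: eq_integral => w _; congr EFin; rewrite -hN2 /hN expr2; ring.
Qed.

(** Identifies the objective <r - U, V - f r> of an equilibrium with the value at (U, V) of the
    graph point (r, f r) in the gap. *)
Lemma kap_row (R : realType) (T : Type) m (A B C D : T -> 'rV[R]_m) w :
  kap (fun w => row_mx (A w) (B w)) (fun w => row_mx (C w) (D w)) w =
  dotv (A w - C w) (D w - B w).
Proof.
rewrite /kap !opp_row_mx !add_row_mx Sform_row (dotvC (B w - D w)) -(opprB (B w)) dotvNr.
lra.
Qed.

(** h is a version of E[U | Rv] written as a Borel function of Rv, so that conditioning on (h(Rv),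
    f(Rv)) is conditioning on certain events of Rv. The last clause is the argmax condition; the
    fourth trades Rv for h(Rv) by orthogonality of k(Rv) = Rv - h(Rv) to V - f(Rv). *)
Lemma equilibrium_dual (R : realType) d (T : measurableType d) (P : probability T R) m
    (U V Rv : T -> 'rV[R]_m) (f : 'rV[R]_m -> 'rV[R]_m) :
  L2 P U -> L2 P V -> Y_equilibrium P U V Rv f ->
  exists h : 'rV[R]_m -> 'rV[R]_m,
    [/\ L2 P (fun w => f (Rv w)),
      (forall B, borel_rV B -> forall i, (\int[P]_(w in Rv @^-1` B) (U w 0 i)%:E =
          \int[P]_(w in Rv @^-1` B) (h (Rv w) 0 i)%:E)%E),
      martingale P (fun w => row_mx (h (Rv w)) (f (Rv w))) (pairY U V),
      (\int[P]_w gap (graph_of f) (pairY U V w) =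
        \int[P]_w (kap (fun w => row_mx (h (Rv w)) (f (Rv w))) (pairY U V) w)%:E)%E &
      {ae P, forall w, gap (graph_of f) (pairY U V w) =
        (kap (fun w => row_mx (Rv w) (f (Rv w))) (pairY U V) w)%:E}].
Proof.
move=> U2 V2 [R2 mR bf [mfR [ifR condV]] argmax].
have [mRv iRv] := R2; have [mU iU] := U2; have [mV iV] := V2.
have fR2 : L2 P (fun w => f (Rv w)).
  split => // i; apply: (condexp_L2 (h := (fun x => f x 0 i) : BV R m -> R) mRv (mV i) (iV i)).
  - exact: borel_fun_coord. - exact: ifR.
  - by move=> B bB; exact: condV.
have /choice[h0 hh0] i := condexp_exists mRv (L2_integrable i U2).
pose h (x : 'rV[R]_m) : 'rV[R]_m := \row_i h0 i x.
have hE x i : h x 0 i = h0 i x by rewrite mxE.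
have bh : borel_fun h.
  apply: borel_fun_rvec => i; have [+ _ _] := hh0 i.
  by congr measurable_fun; apply/funext => x; rewrite hE.
have condU B : borel_rV B -> forall i, (\int[P]_(w in Rv @^-1` B) (U w 0 i)%:E =
    \int[P]_(w in Rv @^-1` B) (h (Rv w) 0 i)%:E)%E.
  move=> bB i; have [_ _ /(_ B bB) ->] := hh0 i.
  by apply: eq_integral => w _; rewrite hE.
have hR2 : L2 P (fun w => h (Rv w)).
  split; first exact: rvec_borel_fun.
  move=> i; have [h1 h2 h3] := hh0 i.
  have := condexp_L2 mRv (mU i) (iU i) h1 h2 h3.
  by congr integrable; apply/funext => w /=; rewrite hE.
have Y2 : L2 P (pairY U V) by exact: L2_row.
have Z2 : L2 P (fun w => row_mx (h (Rv w)) (f (Rv w))) by exact: L2_row.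
have aZ : martingale P (fun w => row_mx (h (Rv w)) (f (Rv w))) (pairY U V).
  split => // B bB k.
  have bB' : borel_rV ((fun r => row_mx (h r) (f r)) @^-1` B).
    exact: (borel_fun_row bh bf).
  rewrite /pairY; case: (split_ordP k) => l ->.
    under eq_integral do rewrite row_mxEl; under [RHS]eq_integral do rewrite row_mxEl.
    exact: (condU _ bB').
  under eq_integral do rewrite row_mxEr; under [RHS]eq_integral do rewrite row_mxEr.
  exact: (condV _ bB').
have aegap : {ae P, forall w, gap (graph_of f) (pairY U V w) =
    (kap (fun w => row_mx (Rv w) (f (Rv w))) (pairY U V) w)%:E}.
  apply: filterS argmax => w hw; apply/eqP; rewrite eq_le; apply/andP; split.
    apply/gap_le => _ [r _ <-]; rewrite lee_fin.
    have := kap_row (fun _ : T => r) (fun _ => f r) U V w; rewrite /kap => ->.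
    by have := kap_row Rv (fun w => f (Rv w)) U V w; rewrite /kap => ->; exact: hw.
  by apply: gap_ge; exists (Rv w).
exists h; split => //.
have XR2 : L2 P (fun w => row_mx (Rv w) (f (Rv w))) by exact: L2_row.
have iX := kap_integrable XR2 Y2; have iZ := kap_integrable Z2 Y2.
transitivity (\int[P]_w (kap (fun w => row_mx (Rv w) (f (Rv w))) (pairY U V) w)%:E)%E.
  apply: ae_eq_integral => //; first exact: (gapY_measurable _ Y2.1).
    exact: measurable_int iX.
  by apply: filterS aegap => w ->.
pose k (r : 'rV[R]_m) := r - h r.
have bk : borel_fun k.
  apply: borel_fun_rvec => i; rewrite (_ : (fun x => k x 0 i) = (fun x => x 0 i - h x 0 i)).
    apply: measurable_funB; last exact: borel_fun_coord.
    by apply: continuous_measurable => //; exact: coord_continuous.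
  by apply/funext => x; rewrite !mxE.
have kR2 : L2 P (fun w => k (Rv w)) by exact: L2_sub.
have E := orth_dotv mRv V2 fR2 condV bk kR2.
have i1 := L2_dotv kR2 V2; have i2 := L2_dotv kR2 fR2.
have fX := integrable_fin_num measurableT iX; have fZ := integrable_fin_num measurableT iZ.
suff : (\int[P]_w (kap (fun w => row_mx (Rv w) (f (Rv w))) (pairY U V) w)%:E -
    \int[P]_w (kap (fun w => row_mx (h (Rv w)) (f (Rv w))) (pairY U V) w)%:E = 0)%E.
  by rewrite -(fineK fX) -(fineK fZ) -EFinB => -[] /eqP; rewrite subr_eq0 => /eqP ->.
rewrite -integralB_EFin//.
transitivity (\int[P]_w ((dotv (k (Rv w)) (V w))%:E - (dotv (k (Rv w)) (f (Rv w)))%:E))%E.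
  apply: eq_integral => w _; rewrite -!EFinB !kap_row; congr EFin.
  by rewrite /k !dotv_lin; ring.
by rewrite integralB_EFin// E subee// integrable_fin_num.
Qed.

Lemma weak_dualityT (R : realType) d (T : measurableType d) (P : probability T R) m
    (X Y : T -> 'rV[R]_(m + m)) (G : set 'rV[R]_(m + m)) :
  martingale P X Y -> (forall z, (0 <= gap G z)%E) ->
  (\int[P]_w (kap X Y w)%:E <= \int[P]_w gap G (Y w))%E.
Proof.
by move=> aXY G0; have := weak_duality aXY G0 (@measurableT _ (BV R (m + m))); rewrite preimage_setT.
Qed.

(** Weak duality with each martingale map against the other graph makes the two dual values equal.
    The map built from f then gives equality for both graphs, so both gaps coincide almost surely
    with the same [kap]. *)
Lemma equilibria_equality (R : realType) d (T : measurableType d) (P : probability T R) m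
    (U V Rv Q : T -> 'rV[R]_m) (f g : 'rV[R]_m -> 'rV[R]_m) :
  L2 P U -> L2 P V -> Y_equilibrium P U V Rv f -> Y_equilibrium P U V Q g ->
  {ae P, forall w, dotv (Rv w - U w) (V w - f (Rv w)) = dotv (Q w - U w) (V w - g (Q w))} /\
  {ae P, forall w, gap (graph_of f) (pairY U V w) = gap (graph_of g) (pairY U V w)} /\
  (\int[P]_w gap (graph_of f) (pairY U V w) = \int[P]_w gap (graph_of g) (pairY U V w))%E.
Proof.
move=> U2 V2 eqf eqg.
have [hf [_ _ af vf aef]] := equilibrium_dual U2 V2 eqf.
have [hg [_ _ ag vg aeg]] := equilibrium_dual U2 V2 eqg.
have f0 := @gap_graph_ge0 R m f; have g0 := @gap_graph_ge0 R m g.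
have eqv : (\int[P]_w gap (graph_of f) (pairY U V w) =
    \int[P]_w gap (graph_of g) (pairY U V w))%E.
  apply/eqP; rewrite eq_le {1}vf weak_dualityT//= vg weak_dualityT//.
have h1 := dual_equality af f0 (eq_ind _ (fun x => x <= _)%E (lexx _) _ (esym vf)).
have h2 : {ae P, forall w, polar (graph_of g) (row_mx (hf (Rv w)) (f (Rv w))) /\
    gap (graph_of g) (pairY U V w) = (kap (fun w => row_mx (hf (Rv w)) (f (Rv w))) (pairY U V) w)%:E}.
  by apply: dual_equality => //; rewrite -vf eqv.
have aeq : {ae P, forall w, gap (graph_of f) (pairY U V w) = gap (graph_of g) (pairY U V w)}.
  by apply: filterS2 h1 h2 => w [_ ->] [_ ->].
split; last by split.
have := filterS3 _ _ aef aeg aeq; apply => w -> -> [].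
by rewrite !kap_row.
Qed.

(** * Laws with full support *)

Lemma supp_dense (R : realType) d (T : measurableType d) (P : probability T R) n
    (Y : T -> 'rV[R]_n) (p : 'rV[R]_n -> Prop) :
  supp_law P Y = setT -> rvec Y -> {ae P, forall w, p (Y w)} ->
  forall a (e : R), 0 < e -> exists2 y, p y & `|y - a| < e.
Proof.
move=> supp mY [N [mN N0 sub]] a e e0.
have : supp_law P Y a by rewrite supp.
move=> /(_ e e0) Pball; apply: contrapT => nex.
suff : P (Y @^-1` ball a e) = 0%E by move=> P0; rewrite P0 ltxx in Pball.
have mb : measurable (Y @^-1` ball a e).
  by apply: rvec_borel => //; apply: borel_open; exact: ball_open.
apply: (@subset_measure0 _ _ _ P (Y @^-1` ball a e) N) => // w.
rewrite /= mx_norm_ball /ball_/= => Yw; apply: sub => /= pY; apply: nex.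
by exists (Y w) => //; rewrite distrC.
Qed.

Lemma gap_fin_convex (R : realType) m (G : set 'rV[R]_(m + m)) :
  convex_rV [set y | (gap G y < +oo)%E].
Proof.
move=> y z t /= yG zG t0 t1.
have fin u : (gap G u < +oo)%E -> exists M : R, forall x, G x -> - Sform (x - u) (x - u) / 2 <= M.
  case E : (gap G u) => [M| |] // _; first by exists M => x Gx; have := gap_ge u Gx; rewrite E lee_fin.
  by exists 0 => x Gx; have := gap_ge u Gx; rewrite E.
have [M1 h1] := fin y yG; have [M2 h2] := fin z zG.
apply: (@le_lt_trans _ _ (t * M1 + (1 - t) * M2 + t * (1 - t) * Sform (y - z) (y - z) / 2)%:E);
  last exact: ltry.
apply/gap_le => x Gx; rewrite lee_fin.
have E : Sform (x - (t *: y + (1 - t) *: z)) (x - (t *: y + (1 - t) *: z)) =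
    t * Sform (x - y) (x - y) + (1 - t) * Sform (x - z) (x - z)
    - t * (1 - t) * Sform (y - z) (y - z).
  by rewrite !Sform_lin (SformC z y) (SformC y x) (SformC z x); ring.
rewrite E; have t1' : 0 <= 1 - t by lra.
have := ler_wpM2l t0 (h1 x Gx); have := ler_wpM2l t1' (h2 x Gx); lra.
Qed.

Lemma gap_psi_convex (R : realType) m (G : set 'rV[R]_(m + m)) :
  (forall y, gap G y \is a fin_num) ->
  convex_fun (fun y => fine (gap G y) + Sform y y / 2).
Proof.
move=> fin y z t t0 t1; set u := t *: y + _.
suff : fine (gap G u) <= t * fine (gap G y) + (1 - t) * fine (gap G z) +
    t * (1 - t) * Sform (y - z) (y - z) / 2.
  have -> : Sform (y - z) (y - z) = Sform y y - 2 * Sform y z + Sform z z.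
    by rewrite !Sform_lin (SformC z y); ring.
  have -> : Sform u u = t ^+ 2 * Sform y y + 2 * t * (1 - t) * Sform y z + (1 - t) ^+ 2 * Sform z z.
    by rewrite /u !Sform_lin (SformC z y); ring.
  by nra.
rewrite -lee_fin fineK//; apply/gap_le => x Gx; rewrite lee_fin.
have E : Sform (x - u) (x - u) =
    t * Sform (x - y) (x - y) + (1 - t) * Sform (x - z) (x - z)
    - t * (1 - t) * Sform (y - z) (y - z).
  by rewrite /u !Sform_lin (SformC z y) (SformC y x) (SformC z x); ring.
have h1 : - Sform (x - y) (x - y) / 2 <= fine (gap G y) by rewrite -lee_fin fineK//; exact: gap_ge.
have h2 : - Sform (x - z) (x - z) / 2 <= fine (gap G z) by rewrite -lee_fin fineK//; exact: gap_ge.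
rewrite E; have t1' : 0 <= 1 - t by lra.
have := ler_wpM2l t0 h1; have := ler_wpM2l t1' h2; lra.
Qed.

Lemma gap_supp_fin (R : realType) d (T : measurableType d) (P : probability T R) m
    (Y : T -> 'rV[R]_(m + m)) (G : set 'rV[R]_(m + m)) :
  supp_law P Y = setT -> rvec Y -> {ae P, forall w, (gap G (Y w) < +oo)%E} ->
  forall y, (gap G y < +oo)%E.
Proof.
move=> supp mY ae; apply: (convex_dense_setT (@gap_fin_convex R m G)).
exact: (supp_dense supp mY ae).
Qed.

(** Adding S / 2 turns both gaps into finite convex functions, which are continuous; they agree on
    the dense set of values where the almost sure equality holds. *)
Lemma gap_supp_eq (R : realType) d (T : measurableType d) (P : probability T R) m
    (Y : T -> 'rV[R]_(m + m)) (G H : set 'rV[R]_(m + m)) :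
  supp_law P Y = setT -> rvec Y ->
  (forall y, gap G y \is a fin_num) -> (forall y, gap H y \is a fin_num) ->
  {ae P, forall w, gap G (Y w) = gap H (Y w)} -> forall y, gap G y = gap H y.
Proof.
move=> supp mY fG fH ae y.
have cG := convex_continuous (gap_psi_convex fG).
have cH := convex_continuous (gap_psi_convex fH).
have cD := continuous_addf cG (continuous_oppf cH).
set D := (fun y => _) in cD.
have cN : continuous (fun y => `|D y|).
  by move=> z; apply: (@continuous_comp _ _ _ D Num.norm); [exact: cD|exact: norm_continuous].
suff : D y = 0.
  by rewrite /D => h; rewrite -(fineK (fG y)) -(fineK (fH y)); congr EFin; lra.
apply: contrapT => /eqP; rewrite -normr_gt0 => Dy.
have op : open [set z | 0 < `|D z|] by exact: open_gt_fun.
have /nbhs_ballP[r /= r0] : nbhs y [set z | 0 < `|D z|] by exact: open_nbhs_nbhs.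
rewrite mx_norm_ball => hr.
have [z zE zy] := supp_dense (p := fun y => gap G y = gap H y) supp mY ae y r0.
have : 0 < `|D z| by apply: hr; rewrite /ball_/= distrC.
by rewrite /D zE subrr normr0 ltxx.
Qed.

(** Also covers an infinite integral of f: the negative part of f + k is at most |k|, so the
    integral of the sum is then +oo and not an indeterminate difference. *)
Lemma integralD_ge0_fin (R : realType) d (T : measurableType d) (P : probability T R)
    (f : T -> \bar R) (k : T -> R) : measurable_fun setT f -> (forall w, (0 <= f w)%E) ->
  P.-integrable setT (EFin \o k) ->
  (\int[P]_w (f w + (k w)%:E) = \int[P]_w f w + \int[P]_w (k w)%:E)%E.
Proof.
move=> mf f0 ik.
have mk : measurable_fun setT (EFin \o k) by exact: measurable_int ik.
have fk : (\int[P]_w (k w)%:E)%E \is a fin_num by exact: integrable_fin_num.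
have [fin|] := ltP (\int[P]_w f w)%E +oo%E.
  apply: integralD => //; apply/integrableP; split => //.
  by under eq_integral do rewrite gee0_abs//.
rewrite leye_eq => /eqP foo; rewrite foo addye; last by rewrite -ltNye ltNye_eq fk.
have iabs : P.-integrable setT (fun w => `|k w|%:E) by exact: (integrable_abse ik).
have fabs : (\int[P]_w `|k w|%:E < +oo)%E.
  by rewrite -ge0_fin_numE ?integral_ge0//; exact: integrable_fin_num.
have mabs : measurable_fun setT (fun w => `|k w|%:E) by exact: measurable_int iabs.
set g := (fun w => (f w + (k w)%:E)%E).
have mg : measurable_fun setT g by exact: emeasurable_funD.
rewrite integralE.
have pos : (\int[P]_w g^\+ w = +oo)%E.
  apply/eqP; rewrite -leye_eq leNgt; apply/negP => lt.
  have : (\int[P]_w f w <= \int[P]_w (g^\+ w + `|k w|%:E))%E.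
    apply: ge0_le_integral => //.
    - by apply: emeasurable_funD => //; exact: measurable_funepos.
    - move=> w _; apply: (@le_trans _ _ (g w + `|k w|%:E)%E).
        rewrite /g -addeA -EFinD leeDl// lee_fin.
        by have := ler_norm (- k w); rewrite normrN; lra.
      by rewrite leeD2r// funeposE le_max lexx.
  rewrite foo ge0_integralD//; last exact: measurable_funepos.
  by rewrite leye_eq => /eqP E; have := lte_add_pinfty lt fabs; rewrite E ltxx.
have neg : (\int[P]_w g^\- w <= \int[P]_w `|k w|%:E)%E.
  apply: ge0_le_integral => //; first exact: measurable_funeneg.
  move=> w _; rewrite funenegE ge_max lee_fin normr_ge0 andbT.
  apply: (@le_trans _ _ (- (k w)%:E)%E); first by rewrite leeN2 /g leeDr.
  by rewrite -EFinN lee_fin -normrN ler_norm.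
rewrite pos addye//; rewrite gt_eqF//.
have : (\int[P]_w g^\- w < +oo)%E by exact: le_lt_trans neg fabs.
by rewrite lteNr.
Qed.

Lemma dual_value_gap (R : realType) d (T : measurableType d) (P : probability T R) m
    (Y : T -> 'rV[R]_(m + m)) (G : set 'rV[R]_(m + m)) : L2 P Y ->
  (forall z, (0 <= gap G z)%E) ->
  dual_value P Y G = (\int[P]_w gap G (Y w) + \int[P]_w (Sform (Y w) (Y w) / 2)%:E)%E.
Proof.
move=> Y2 G0; rewrite /dual_value; under eq_integral do rewrite psi_gap.
apply: integralD_ge0_fin => //; first exact: (gapY_measurable _ Y2.1).
have := integrable_scalef 2^-1 (L2_Sform Y2 Y2).
by congr integrable; apply/funext => w /=; congr EFin; rewrite mulrC.
Qed.

Lemma monotone_graphs (R : realType) m (f g : 'rV[R]_m -> 'rV[R]_m)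
    (H : set 'rV[R]_(m + m)) :
  S_monotone H -> graph_of f `<=` H -> graph_of g `<=` H ->
  forall u e (t : R), 0 < t -> 0 <= dotv e (f (u + t *: e) - g u).
Proof.
move=> mH fH gH u e t t0.
have Hf : H (row_mx (u + t *: e) (f (u + t *: e))) by apply: fH; exists (u + t *: e).
have Hg : H (row_mx u (g u)) by apply: gH; exists u.
have := mH _ _ Hf Hg; rewrite !opp_row_mx !add_row_mx Sform_row (addrC u) addrK.
rewrite (dotvC (f _ - _)) dotvZl -mulr2n pmulrn_lge0// pmulr_rge0//.
Qed.

(** By [monotone_graphs], each coordinate of g x lies between the same coordinate of f at x - t e_i
    and at x + t e_i. Letting t tend to 0 at x = u gives f u = g u; a fixed small t at x near u
    gives continuity of g. *)
Lemma monotone_cont_points (R : realType) m (f g : 'rV[R]_m -> 'rV[R]_m)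
    (H : set 'rV[R]_(m + m)) :
  S_monotone H -> graph_of f `<=` H -> graph_of g `<=` H ->
  forall u, cont_points f u -> f u = g u /\ cont_points g u.
Proof.
move=> mH fH gH u cfu.
have mfg := monotone_graphs mH fH gH.
have cf (eps : R) : 0 < eps -> exists2 r : R, 0 < r &
    forall x, `|x - u| < r -> forall i, `|f x 0 i - f u 0 i| < eps.
  move=> e0; have := cfu (ball (f u) eps) (nbhsx_ballx _ _ e0).
  move=> /nbhs_ballP[r /= r0]; rewrite !mx_norm_ball => hr; exists r => // x xr i.
  have : ball_ Num.norm (f u) eps (f x) by apply: hr; rewrite /ball_/= distrC.
  rewrite /ball_/= => /norm_rV_lt/(_ i); rewrite !mxE distrC; exact.
have fg : f u = g u.
  apply/esym/rowP => i; apply/eqP; rewrite eq_le; apply/andP; split.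
    apply/ler_addgt0Pr => eps eps0; have [r r0 hr] := cf eps eps0.
    have := mfg u (delta_mx 0 i) (r / 2) ltac:(lra).
    have h0 : `|u + (r / 2) *: delta_mx 0 i - u| < r.
      rewrite addrC addKr; apply/norm_rV_lt => // k; rewrite !mxE normrM eqxx/=.
      by rewrite (@gtr0_norm _ (r / 2)) ?normr_nat; [case: eqP => _ /=; lra|lra].
    have := hr _ h0 i.
    rewrite dotvC dotv_delta [(_ - g u) 0 i]mxE [(- g u) 0 i]mxE ltr_norml => /andP[_ ?] ?; lra.
  apply/ler_addgt0Pr => eps eps0; have [r r0 hr] := cf eps eps0.
  have := mfg u (- delta_mx 0 i) (r / 2) ltac:(lra).
  have h0 : `|u + (r / 2) *: - delta_mx 0 i - u| < r.
    rewrite addrC addKr; apply/norm_rV_lt => // k; rewrite !mxE normrM eqxx/= normrN.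
    by rewrite (@gtr0_norm _ (r / 2)) ?normr_nat; [case: eqP => _ /=; lra|lra].
  have := hr _ h0 i.
  rewrite dotvC dotvNr dotv_delta [(_ - g u) 0 i]mxE [(- g u) 0 i]mxE ltr_norml => /andP[? _] ?; lra.
split => //; apply: (@cvg_rV R m _ (nbhs u)) => i.
apply/(@cvgrPdist_le R R _ (nbhs u)) => eps eps0.
have [r r0 hr] := cf eps eps0.
apply/nbhs_ballP; exists (r / 2) => /=; first by lra.
move=> x; rewrite mx_norm_ball /ball_/= => ux.
(* r / 2 for the distance from x to u and r / 4 for the step along e add up to less than r. *)
have near_u (e : 'rV[R]_m) : (forall k, `|e 0 k| <= 1) -> `|(x + (r / 4) *: e) - u| < r.
  move=> e1; apply/norm_rV_lt => // k; rewrite !mxE.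
  have : `|u 0 k - x 0 k| < r / 2.
    by apply: le_lt_trans ux; have := norm_coord_le (u - x) k; rewrite !mxE.
  have := e1 k; rewrite ler_norml !ltr_norml => /andP[? ?] /andP[? ?].
  have r4 : 0 <= r / 4 by lra.
  have h1 : r / 4 * e 0 k <= r / 4 * 1 by rewrite ler_wpM2l.
  have h2 : r / 4 * -1 <= r / 4 * e 0 k by rewrite ler_wpM2l.
  by apply/andP; split; lra.
have d1 k : `|(delta_mx 0 i : 'rV[R]_m) 0 k| <= 1.
  by rewrite mxE eqxx/= normr_nat; case: eqP => _ /=; lra.
have d2 k : `|(- delta_mx 0 i : 'rV[R]_m) 0 k| <= 1 by rewrite mxE normrN.
have := hr _ (near_u _ d1) i; have := hr _ (near_u _ d2) i.
have := mfg x (delta_mx 0 i) (r / 4) ltac:(lra).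
have := mfg x (- delta_mx 0 i) (r / 4) ltac:(lra).
rewrite !(dotvC _ (_ - g x)) dotvNr !dotv_delta.
rewrite [(_ - g x) 0 i]mxE [(- g x) 0 i]mxE [(_ - g x) 0 i]mxE [(- g x) 0 i]mxE.
rewrite -fg !ltr_norml => ? ? /andP[? ?] /andP[? ?].
by rewrite ler_norml; apply/andP; split; lra.
Qed.

(** * Uniqueness of maximisers almost everywhere *)

Lemma cdf_continuous_atom (R : realType) d (T : measurableType d) (P : probability T R)
    (Z : T -> R) (c : R) : measurable_fun setT Z ->
  continuous (fun r : R => fine (P [set w | Z w <= r])) -> P [set w | Z w = c] = 0%E.
Proof.
move=> mZ cF.
have mle r : measurable [set w | Z w <= r].
  rewrite (_ : [set w | _] = Z @^-1` [set` `]-oo, r]]).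
    by rewrite -[X in measurable X]setTI; apply: mZ => //; exact: measurable_itv.
  by apply/seteqP; split => w /=; rewrite in_itv.
have meq : measurable [set w | Z w = c].
  rewrite (_ : [set w | _] = Z @^-1` [set c])//.
  by rewrite -[X in measurable X]setTI; apply: mZ.
pose a := fine (P [set w | Z w = c]).
have aE : P [set w | Z w = c] = a%:E by rewrite fineK// fin_num_measure.
have a0 : 0 <= a by rewrite -lee_fin -aE.
rewrite aE; congr EFin; apply/eqP; rewrite eq_le a0 andbT leNgt; apply/negP => a_gt0.
have /cvgrPdist_lt/(_ a a_gt0)/nbhs_ballP[r /= r0 hr] := cF c.
(* At c - r / 2 the distribution function should be within a of its value at c, yet the atom at c
   alone accounts for a jump of size a. *)
have := hr (c - r / 2); rewrite /ball/= opprB addrC subrK gtr0_norm ?divr_gt0//.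
move=> /(_ ltac:(lra)); rewrite ltNge => /negP; apply.
apply: le_trans (ler_norm _).
have dis : [set w | Z w = c] `&` [set w | Z w <= c - r / 2] = set0.
  by clear aE; apply/seteqP; split => // w [/= -> ?]; lra.
rewrite lerBrDr -lee_fin EFinD !fineK ?fin_num_measure// -measureU//.
apply: le_measure; rewrite ?inE//; first exact: measurableU.
by clear aE; move=> w [/= ->|/= ?]; [exact: lexx|lra].
Qed.

(** Naming the two coordinates by a boolean lets one argument treat both axes, with [~~ s] as the
    other one. *)
Definition coord2 (s : bool) : 'I_(1 + 1) := if s then lshift 1 0 else rshift 1 0.

Lemma Sform_coord2 (R : realType) s (x y : 'rV[R]_(1 + 1)) :
  Sform x y = x 0 (coord2 s) * y 0 (coord2 (~~ s)) + x 0 (coord2 (~~ s)) * y 0 (coord2 s).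
Proof. by rewrite /Sform /dotv !big_ord1 !mxE; case: s => /=; ring. Qed.

Lemma coord2P (R : realType) (x y : 'rV[R]_(1 + 1)) s :
  x 0 (coord2 s) = y 0 (coord2 s) -> x 0 (coord2 (~~ s)) = y 0 (coord2 (~~ s)) -> x = y.
Proof.
move=> h1 h2; apply/rowP => i; case: (split_ordP i) => k ->; rewrite [k]ord1;
by case: s h1 h2 => /= h1 h2.
Qed.

Lemma null_preimage_bigcup (R : realType) d (T : measurableType d) (P : probability T R) n
    (Y : T -> 'rV[R]_n) (N : nat -> set 'rV[R]_n) : rvec Y ->
  (forall i, borel_rV (N i)) -> (forall i, P (Y @^-1` N i) = 0%E) ->
  borel_rV (\bigcup_i N i) /\ P (Y @^-1` \bigcup_i N i) = 0%E.
Proof.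
move=> mY bN PN.
have bU : borel_rV (\bigcup_i N i) by apply/borelE; apply: bigcup_measurable => i _; exact: bN.
split => //; apply/negligibleP; first exact: rvec_borel.
rewrite preimage_bigcup; apply: negligible_bigcup => i.
by apply/negligibleP; [exact: rvec_borel|exact: PN].
Qed.

Lemma null_preimage_setU (R : realType) d (T : measurableType d) (P : probability T R) n
    (Y : T -> 'rV[R]_n) (N M : set 'rV[R]_n) : rvec Y ->
  borel_rV N -> borel_rV M -> P (Y @^-1` N) = 0%E -> P (Y @^-1` M) = 0%E ->
  borel_rV (N `|` M) /\ P (Y @^-1` (N `|` M)) = 0%E.
Proof.
move=> mY bN bM PN PM.
have bU : borel_rV (N `|` M) by apply/borelE; exact: measurableU.
split => //; apply/negligibleP; first exact: rvec_borel.
rewrite preimage_setU; apply: negligibleU; apply/negligibleP => //; exact: rvec_borel.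
Qed.

(* For m = 1 an isotropic difference b - a is parallel to an axis, and cross
   monotonicity leaves at most one such segment above each point q of the axis. *)
Lemma isotropic_null1 (R : realType) d (T : measurableType d) (P : probability T R)
    (Y : T -> 'rV[R]_(1 + 1)) (A0 B0 : set 'rV[R]_(1 + 1)) : rvec Y ->
  (forall a b, A0 a -> B0 b -> 0 <= Sform (b - a) (b - a)) ->
  (forall w0 : 'rV[R]_(1 + 1), S_isotropic w0 ->
      continuous (fun r : R => fine (P [set w | Sform (Y w) w0 <= r]))) ->
  exists N, [/\ borel_rV N, P (Y @^-1` N) = 0%E &
    forall y a b, ~ N y -> A0 a -> B0 b -> Sform (b - a) (b - a) = 0 ->
      Sform a y - Sform a a / 2 = Sform b y - Sform b b / 2 -> a = b].
Proof.
move=> mY cross A2.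
(* Heights c at which a segment parallel to axis s joins A0 to B0 and passes strictly over q; t
   records on which side of q the endpoint in A0 lies. *)
pose L (s t : bool) (q : R) := [set c | exists a b, [/\ A0 a, B0 b,
   a 0 (coord2 (~~ s)) = c, b 0 (coord2 (~~ s)) = c &
   (if t then a 0 (coord2 s) < q < b 0 (coord2 s) else b 0 (coord2 s) < q < a 0 (coord2 s))]].
(* For two such segments, pairing the A0 endpoint of one with the B0 endpoint of the other gives
   points on opposite sides of q, and cross monotonicity yields c <= c' and c' <= c. *)
have Luniq s t q c c' : L s t q c -> L s t q c' -> c = c'.
  move=> [a [b [Aa Bb ac bc ab]]] [a' [b' [Aa' Bb' ac' bc' ab']]].
  have := cross a' b Aa' Bb; have := cross a b' Aa Bb'.
  rewrite !(Sform_coord2 s) !mxE ac bc ac' bc' => h1 h2.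
  case: t ab ab' => /andP[? ?] /andP[? ?].
    have k1 : 0 < b 0 (coord2 s) - a' 0 (coord2 s) by lra.
    have k2 : 0 < b' 0 (coord2 s) - a 0 (coord2 s) by lra.
    have g1 : 0 <= (b 0 (coord2 s) - a' 0 (coord2 s)) * (c - c') by lra.
    have g2 : 0 <= (b' 0 (coord2 s) - a 0 (coord2 s)) * (c' - c) by lra.
    by rewrite pmulr_rge0// in g1; rewrite pmulr_rge0// in g2; lra.
  have k1 : 0 < a' 0 (coord2 s) - b 0 (coord2 s) by lra.
  have k2 : 0 < a 0 (coord2 s) - b' 0 (coord2 s) by lra.
  have g1 : 0 <= (a' 0 (coord2 s) - b 0 (coord2 s)) * (c' - c) by lra.
  have g2 : 0 <= (a 0 (coord2 s) - b' 0 (coord2 s)) * (c - c') by lra.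
  by rewrite pmulr_rge0// in g1; rewrite pmulr_rge0// in g2; lra.
have d2 s : (delta_mx 0 (coord2 s) : 'rV[R]_(1 + 1)) 0 (coord2 s) = 1 by rewrite mxE !eqxx.
have d2' s : (delta_mx 0 (coord2 s) : 'rV[R]_(1 + 1)) 0 (coord2 (~~ s)) = 0.
  by rewrite mxE; case: s.
have atom s c : P (Y @^-1` [set y | y 0 (coord2 (~~ s)) = c]) = 0%E.
  have SE (y : 'rV[R]_(1 + 1)) : Sform y (delta_mx 0 (coord2 s)) = y 0 (coord2 (~~ s)).
    by rewrite (Sform_coord2 s) d2 d2'; ring.
  have iso : S_isotropic (delta_mx 0 (coord2 s) : 'rV[R]_(1 + 1)).
    split; last by rewrite SE d2'.
    rewrite normr_gt0; apply/negP => /eqP h.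
    by have := d2 s; rewrite h mxE => /eqP; rewrite eq_sym oner_eq0.
  have := @cdf_continuous_atom R _ T P (fun w => Sform (Y w) (delta_mx 0 (coord2 s))) c _ (A2 _ iso).
  move=> <-; first by congr (P _); apply/seteqP; split => w /=; rewrite SE.
  by under eq_fun do rewrite SE; exact: mY.
have bc s c : borel_rV [set y : 'rV[R]_(1 + 1) | y 0 (coord2 (~~ s)) = c].
  have h1 : closed [set y : 'rV[R]_(1 + 1) | c <= y 0 (coord2 (~~ s))].
    by apply: closed_ge_fun; exact: coord_continuous.
  have h2 : closed [set y : 'rV[R]_(1 + 1) | - c <= - y 0 (coord2 (~~ s))].
    by apply: closed_ge_fun; apply: continuous_oppf; exact: coord_continuous.
  apply: borel_closed; have := closedI h1 h2; congr closed.
  apply/seteqP; split => y /=; first by rewrite lerN2 => -[? ?]; apply/eqP; rewrite eq_le; apply/andP.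
  by move=> ->; rewrite !lexx.
have hN (k : nat) : exists N : set 'rV[R]_(1 + 1), [/\ borel_rV N, P (Y @^-1` N) = 0%E &
    forall (s t : bool) (q : rat), unpickle k = Some (s, t, q) ->
      [set y : 'rV[R]_(1 + 1) | L s t (ratr q) (y 0 (coord2 (~~ s)))] `<=` N].
  case: (unpickle k : option (bool * bool * rat)) => [[[s t] q]|]; last first.
    by exists set0; split => //; [exact: borel0|rewrite preimage_set0 measure0].
  have [[c Lc]|nL] := pselect (exists c, L s t (ratr q) c).
    exists [set y : 'rV[R]_(1 + 1) | y 0 (coord2 (~~ s)) = c].
    split; [exact: bc|exact: atom|].
    by move=> s' t' q' [<- <- <-] y /= Ly; exact: Luniq Ly Lc.
  exists set0; split => //; [exact: borel0|by rewrite preimage_set0 measure0|].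
  by move=> s' t' q' [<- <- <-] y /= Ly; apply: nL; exists (y 0 (coord2 (~~ s))).
have [N hN'] := choice hN.
have [bU PU] := null_preimage_bigcup mY (fun i => let: And3 h _ _ := hN' i in h)
  (fun i => let: And3 _ h _ := hN' i in h).
exists (\bigcup_i N i); split => // y a b nNy Aa Bb S0 E.
have inN s t (q : rat) : L s t (ratr q) (y 0 (coord2 (~~ s))) -> a = b.
  move=> Ly; exfalso; apply: nNy; exists (pickle (s, t, q)) => //.
  have [_ _ sub] := hN' (pickle (s, t, q)); apply: (sub s t q) => //.
  by rewrite pickleK.
have key s : b 0 (coord2 (~~ s)) = a 0 (coord2 (~~ s)) -> a = b.
  move=> e2; have [e1|ne1] := eqVneq (a 0 (coord2 s)) (b 0 (coord2 s)).
    exact: coord2P e1 (esym e2).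
  (* Equal values at y force y to the common height of a and b. This is the only height in L for a
     rational q between them, so y is on one of countably many null lines. *)
  have yE : y 0 (coord2 (~~ s)) = a 0 (coord2 (~~ s)).
    move: E; rewrite !(Sform_coord2 s) e2 => E.
    have : (b 0 (coord2 s) - a 0 (coord2 s)) * (y 0 (coord2 (~~ s)) - a 0 (coord2 (~~ s))) = 0 by lra.
    by move/eqP; rewrite mulf_eq0 subr_eq0 eq_sym (negPf ne1)/= subr_eq0 => /eqP.
  case: (ltgtP (a 0 (coord2 s)) (b 0 (coord2 s))) ne1 => // lt _.
    have [q hq] := rat_in_itvoo lt; apply: (inN s true q).
    by exists a, b; split => //; rewrite ?yE// e2.
  have [q hq] := rat_in_itvoo lt; apply: (inN s false q).
  by exists a, b; split => //; rewrite ?yE// e2.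
move: S0; rewrite (Sform_coord2 true) !mxE => S0.
have : (b 0 (coord2 true) - a 0 (coord2 true)) * (b 0 (coord2 false) - a 0 (coord2 false)) = 0.
  by rewrite /= in S0; lra.
move/eqP; rewrite mulf_eq0 !subr_eq0 => /orP[/eqP h|/eqP h].
  exact: (key false).
exact: (key true).
Qed.

Lemma in_H_continuous (R : realType) m (j : 'I_(m + m)) C (h : 'rV[R]_(m + m) -> R) :
  in_H j C h -> continuous h.
Proof.
move=> [g1 [g2 [[c1 c2 _ _] [hE _]]]].
have -> : h = (fun x => x 0 j + g1 (col' j x) + - g2 (col' j x)).
  by apply/funext => x; rewrite hE.
have comp (g : 'rV[R]_(m + m).-1 -> R) : convex_fun g ->
    continuous (fun x : 'rV[R]_(m + m) => g (col' j x)).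
  move=> cg x; apply: (@continuous_comp _ _ _ (fun x : 'rV[R]_(m + m) => col' j x) g).
    exact: continuous_col'.
  exact: convex_continuous.
apply: continuous_addf; last by apply: continuous_oppf; exact: comp.
by apply: continuous_addf; [exact: coord_continuous|exact: comp].
Qed.

Lemma zero_set_borel (R : realType) m (h : 'rV[R]_(m + m) -> R) :
  continuous h -> borel_rV [set y | h (Smap y) = 0].
Proof.
move=> ch.
have ch' : continuous (fun y => h (Smap y)).
  by move=> y; apply: continuous_comp; [exact: continuous_Smap|exact: ch].
have h1 := @closed_ge_fun R _ _ 0 ch'.
have h2 := @closed_ge_fun R _ _ 0 (continuous_oppf ch').
apply: borel_closed; have := closedI h1 h2; congr closed.
apply/seteqP; split => y /=.
  by rewrite oppr_ge0 => -[? ?]; apply/eqP; rewrite eq_le; apply/andP.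
by move=> ->; rewrite oppr0 lexx.
Qed.

(** A filler: [E0] asks for a triple at every index, including those where the cover has none. For j
    in the first half its normal is isotropic when m > 0, so the bound 0 <= S <= delta holds. *)
Lemma in_H_coord (R : realType) m (j : 'I_(m + m)) :
  in_H j [set delta_mx 0 j] (fun x : 'rV[R]_(m + m) => x 0 j).
Proof.
exists (fun=> 0), (fun=> 0); split.
  split; try by move=> *; lra.
    by exists 0 => z; rewrite normr0 mul0r.
  by exists 0 => z; rewrite normr0 mul0r.
split=> [x|x _ _]; first by rewrite addr0 subr0.
apply/rowP => k; rewrite [LHS]mxE; apply/cvg_lim => //.
have E : (delta_mx 0 j : 'rV[R]_(m + m)) 0 k = (delta_mx 0 k : 'rV[R]_(m + m)) 0 j.
  by rewrite !mxE eq_sym.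
rewrite E.
have c : (fun _ : R => (delta_mx 0 k : 'rV[R]_(m + m)) 0 j) @ 0^' -->
    ((delta_mx 0 k : 'rV[R]_(m + m)) 0 j) by exact: cvg_cst.
apply: cvg_trans c.
apply: near_eq_cvg; near=> t.
have t0 : t != 0 by near: t; exact: nbhs_dnbhs_neq.
have jE : (t *: delta_mx 0 k + x) 0 j = t * (delta_mx 0 k : 'rV[R]_(m + m)) 0 j + x 0 j.
  by rewrite [LHS]mxE; congr (_ + _); rewrite mxE.
rewrite /= jE addrK /GRing.scale/= mulKf//.
Unshelve. all: by end_near. Qed.

Lemma normals_Sform (R : realType) m (j : 'I_(m + m)) (A B : set 'rV[R]_(m + m)) x :
  (forall a b, A a -> B b -> 0 <= Sform (b - a) (b - a)) ->
  normals j A B x -> 0 <= Sform x x.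
Proof.
move=> cross [[a b] [/= Aa Bb] <-]; rewrite SformZl SformZr mulrA mulr_ge0//.
  by rewrite -expr2 sqr_ge0.
exact: cross.
Qed.

Lemma continuous_Sq (R : realType) m : continuous (fun x : 'rV[R]_(m + m) => Sform x x).
Proof. by apply: continuous_Sform => x. Qed.

Lemma cover_positive (R : realType) d (T : measurableType d) (P : probability T R) m
    (Y : T -> 'rV[R]_(m + m)) (A0 B0 : set 'rV[R]_(m + m)) (q : 'rV[R]_(m + m) -> R) :
  rvec Y -> closed A0 -> closed B0 -> continuous q ->
  (forall (j : 'I_(m + m)) (C : set 'rV[R]_(m + m)),
      compact C -> C `<=` [set x : 'rV[R]_(m + m) | x 0 j = 1 /\ 0 < Sform x x] ->
      forall h, in_H j C h -> {ae P, forall w, h (Smap (Y w)) <> 0}) ->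
  exists N, [/\ borel_rV N, P (Y @^-1` N) = 0%E &
    forall y a b, ~ N y -> maximiser q A0 (Smap y) a -> maximiser q B0 (Smap y) b ->
      dotv a (Smap y) - q a = dotv b (Smap y) - q b -> 0 < Sform (b - a) (b - a) -> a = b].
Proof.
move=> mY cA cB cq A1.
have oW : open [set x : 'rV[R]_(m + m) | 0 < Sform x x].
  by apply: open_gt_fun; exact: continuous_Sq.
have [tr [tr1 tr2]] := maximisers_cover cA cB oW cq.
pose N i : set 'rV[R]_(m + m) :=
  if tr i is Some (_, _, h) then [set y | h (Smap y) = 0] else set0.
have [bU PU] : borel_rV (\bigcup_i N i) /\ P (Y @^-1` \bigcup_i N i) = 0%E.
  apply: null_preimage_bigcup => // i; rewrite /N; case E : (tr i) => [[[j C] h]|].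
  - by have [_ _ _ _ hH] := tr1 _ _ _ _ E; apply: zero_set_borel; exact: in_H_continuous hH.
  - exact: borel0.
  - have [cC C1 CW _ hH] := tr1 _ _ _ _ E.
    have sC : C `<=` [set x : 'rV[R]_(m + m) | x 0 j = 1 /\ 0 < Sform x x].
      by move=> x Cx; split; [exact: C1|exact: CW].
    have [N' [mN' N'0 sub]] := A1 j C cC sC h hH.
    apply: (@subset_measure0 _ _ _ P _ N') => //.
      by apply: (rvec_borel mY); apply: zero_set_borel; exact: in_H_continuous hH.
    by move=> w /= hw; apply: sub => /=; exact.
  - by rewrite preimage_set0 measure0.
exists (\bigcup_i N i); split => // y a b nN ma mb E S0; apply: contrapT => ab.
have [j jab] : exists j, a 0 j != b 0 j.
  by apply: contrapT => h; apply: ab; apply/rowP => j; apply: contrapT => /eqP h'; apply: h; exists j.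
have [|i [j' [C [h [ti hy]]]]] := tr2 (Smap y) a b j ma mb E jab.
  rewrite /= SformZl SformZr mulrA mulr_gt0// -expr2 exprn_even_gt0//= invr_neq0//.
  by rewrite subr_eq0 eq_sym.
by apply: nN; exists i => //; rewrite /N ti.
Qed.

(** [E0] requires one set to be covered for every delta, hence the intersection over k: the k-th
    cover uses normals with S < 1 / (k + 1), and S >= 0 on them by cross monotonicity. If b - a is
    isotropic, y lies in all of these covers. *)
Lemma isotropic_null (R : realType) d (T : measurableType d) (P : probability T R) m
    (Y : T -> 'rV[R]_(m + m)) (A0 B0 : set 'rV[R]_(m + m)) (q : 'rV[R]_(m + m) -> R) :
  rvec Y -> closed A0 -> closed B0 -> continuous q -> (1 < m)%N ->
  (forall a b, A0 a -> B0 b -> 0 <= Sform (b - a) (b - a)) ->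
  (forall D : set 'rV[R]_(m + m), E0 D -> P (Y @^-1` D) = 0%E) ->
  exists N, [/\ borel_rV N, P (Y @^-1` N) = 0%E &
    forall y a b, ~ N y -> maximiser q A0 (Smap y) a -> maximiser q B0 (Smap y) b ->
      dotv a (Smap y) - q a = dotv b (Smap y) - q b -> Sform (b - a) (b - a) = 0 -> a = b].
Proof.
move=> mY cA cB cq m1 cross A3.
pose W (k : nat) := [set x : 'rV[R]_(m + m) | - k.+1%:R^-1 < - Sform x x].
have oW k : open (W k).
  by apply: open_gt_fun; apply: continuous_oppf; exact: continuous_Sq.
have /choice[tr htr] k := maximisers_cover cA cB (oW k) cq.
pose Nk k i : set 'rV[R]_(m + m) :=
  if tr k i is Some (_, _, h) then [set y | h (Smap y) = 0] else set0.
pose N := \bigcap_k \bigcup_i Nk k i.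
have bN : borel_rV N.
  apply/borelE; apply: bigcapT_measurable => k; apply: bigcup_measurable => i _.
  rewrite /Nk; case E : (tr k i) => [[[j C] h]|]; last exact: borel0.
  have [_ _ _ _ hH] := (htr k).1 _ _ _ _ E.
  by apply: zero_set_borel; exact: in_H_continuous hH.
have m0 : (0 < m)%N by exact: ltnW.
pose j0 : 'I_(m + m) := lshift m (Ordinal m0).
have S0 : Sform (delta_mx 0 j0 : 'rV[R]_(m + m)) (delta_mx 0 j0) = 0.
  by rewrite Sform_Smap dotvC dotv_delta /Smap row_mxEl !mxE eqxx/= eq_rlshift.
have EN : E0 N.
  split => // delta delta0; have [k hk] := invS_lt delta0.
  exists (fun i => if tr k i is Some (j, _, _) then j else j0).
  exists (fun i => if tr k i is Some (_, C, _) then C else [set delta_mx 0 j0]).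
  exists (fun i => if tr k i is Some (_, _, h) then h else (fun x => x 0 j0)).
  split=> [i|y Ny].
    case E : (tr k i) => [[[j C] h]|].
      have [cC C1 CW Cn hH] := (htr k).1 _ _ _ _ E; split => // x Cx.
      split; first exact: C1.
      rewrite (normals_Sform cross (Cn _ Cx))/=; have := CW _ Cx; rewrite /W /= ltrN2.
      by move=> /ltW/le_trans; apply; exact: ltW.
    split; [exact: compact_set1| |exact: in_H_coord].
    by move=> _ ->; split; [rewrite mxE !eqxx|rewrite S0 lexx ltW].
  have [i _] := Ny k I; rewrite /Nk => Ni; exists i => //=.
  by case: (tr k i) Ni => [[[]]|].
exists N; split => //; first exact: A3.
move=> y a b nN ma mb E Sab; apply: contrapT => ab; apply: nN => k _.
have [j jab] : exists j, a 0 j != b 0 j.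
  by apply: contrapT => h; apply: ab; apply/rowP => j; apply: contrapT => /eqP h'; apply: h; exists j.
have [|i [j' [C [h [ti hy]]]]] := (htr k).2 (Smap y) a b j ma mb E jab.
  by rewrite /W /= SformZl SformZr Sab !mulr0 oppr0 oppr_lt0 invr_gt0.
by exists i => //; rewrite /Nk ti.
Qed.

Lemma maximisers_unique (R : realType) d (T : measurableType d) (P : probability T R) m
    (Y : T -> 'rV[R]_(m + m)) (A0 B0 : set 'rV[R]_(m + m)) :
  rvec Y -> closed A0 -> closed B0 ->
  (forall a b, A0 a -> B0 b -> 0 <= Sform (b - a) (b - a)) ->
  (forall (j : 'I_(m + m)) (C : set 'rV[R]_(m + m)),
      compact C -> C `<=` [set x : 'rV[R]_(m + m) | x 0 j = 1 /\ 0 < Sform x x] ->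
      forall h, in_H j C h -> {ae P, forall w, h (Smap (Y w)) <> 0}) ->
  (m = 1%N -> forall w0 : 'rV[R]_(m + m), S_isotropic w0 ->
      continuous (fun r : R => fine (P [set w | Sform (Y w) w0 <= r]))) ->
  ((1 < m)%N -> forall D : set 'rV[R]_(m + m), E0 D -> P (Y @^-1` D) = 0%E) ->
  exists N, [/\ borel_rV N, P (Y @^-1` N) = 0%E &
    forall y a b, ~ N y -> maximiser (fun x => Sform x x / 2) A0 (Smap y) a ->
      maximiser (fun x => Sform x x / 2) B0 (Smap y) b ->
      dotv a (Smap y) - Sform a a / 2 = dotv b (Smap y) - Sform b b / 2 -> a = b].
Proof.
move=> mY cA cB cross A1 A2 A3.
have cq : continuous (fun x : 'rV[R]_(m + m) => Sform x x / 2).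
  by apply: continuous_mulf; [exact: continuous_Sq|exact: cst_continuous].
have [N1 [bN1 PN1 h1]] := cover_positive mY cA cB cq A1.
have [N2 [bN2 PN2 h2]] : exists N, [/\ borel_rV N, P (Y @^-1` N) = 0%E &
    forall y a b, ~ N y -> maximiser (fun x => Sform x x / 2) A0 (Smap y) a ->
      maximiser (fun x => Sform x x / 2) B0 (Smap y) b ->
      dotv a (Smap y) - Sform a a / 2 = dotv b (Smap y) - Sform b b / 2 ->
      Sform (b - a) (b - a) = 0 -> a = b].
  (* For m = 0 the space is a single point and a = b outright. *)
  case: m Y A0 B0 mY cA cB cross A1 A2 A3 cq N1 bN1 PN1 h1 =>
    [|[|m]] Y A0 B0 mY cA cB cross A1 A2 A3 cq _ _ _ _.
  - exists set0; split => //; [exact: borel0|by rewrite preimage_set0 measure0|].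
    by move=> y a b _ _ _ _ _; apply/rowP => -[].
  - have [N [bN PN hN]] := isotropic_null1 mY cross (A2 erefl).
    exists N; split => // y a b nN [Aa _] [Bb _] E S0; apply: (hN y) => //.
    by rewrite !Sform_Smap in E *.
  - exact: isotropic_null mY cA cB cq _ cross (A3 _).
have [bN PN] := null_preimage_setU mY bN1 bN2 PN1 PN2.
exists (N1 `|` N2); split => // y a b nN ma mb E.
have := cross a b ma.1 mb.1; rewrite le_eqVlt => /orP[/eqP S0|S0].
  by apply: (h2 y) => // Ny; apply: nN; right.
by apply: (h1 y) => // Ny; apply: nN; left.
Qed.

(** * The dual optimiser under full support *)

Lemma L2_Sform_fin (R : realType) d (T : measurableType d) (P : probability T R) m
    (Y : T -> 'rV[R]_(m + m)) : L2 P Y ->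
  (\int[P]_w (Sform (Y w) (Y w) / 2)%:E)%E \is a fin_num.
Proof.
move=> LY; apply: integrable_fin_num => //.
have := integrable_scalef (1 / 2) (L2_Sform LY LY).
by apply: eq_integrable => // w _ /=; congr EFin; lra.
Qed.

Lemma polar_gapE (R : realType) m (G H : set 'rV[R]_(m + m)) :
  (forall y, gap G y = gap H y) -> polar G = polar H.
Proof.
by move=> E; apply/seteqP; split => x /gap_le0; [rewrite E|rewrite -E] => /gap_le0.
Qed.

(** [polar_gap] gives gap (polar G) <= gap G; almost surely they agree because the martingale map
    lies in the polar and attains gap G, and full support spreads this to all y. A point of G lies
    in the polar of polar G, so its gap is at most 0, which puts G inside its own polar. A monotone
    extension of polar G then contains G, hence is contained in polar G. *)
Lemma equilibrium_polar (R : realType) d (T : measurableType d) (P : probability T R) m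
    (U V Rv : T -> 'rV[R]_m) (f : 'rV[R]_m -> 'rV[R]_m) :
  L2 P U -> L2 P V -> Y_equilibrium P U V Rv f -> supp_law P (pairY U V) = setT ->
  [/\ forall y, gap (graph_of f) y \is a fin_num,
      forall y, gap (polar (graph_of f)) y = gap (graph_of f) y,
      maximal_S_monotone (polar (graph_of f)) &
      graph_of f `<=` polar (graph_of f)].
Proof.
move=> LU LV eqf supp.
have [h [_ _ aZ eZ _]] := equilibrium_dual LU LV eqf.
have G0 := gap_graph_ge0 f.
have mY : rvec (pairY U V) by apply: rvec_row; [exact: LU.1|exact: LV.1].
have leZ : (\int[P]_w gap (graph_of f) (pairY U V w) <=
  \int[P]_w (kap (fun w => row_mx (h (Rv w)) (f (Rv w))) (pairY U V) w)%:E)%E by rewrite eZ.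
have ae1 := dual_equality aZ G0 leZ.
have lty := gap_supp_fin supp mY _.
have fin y : gap (graph_of f) y \is a fin_num.
  rewrite ge0_fin_numE//; apply: lty.
  by apply: filterS ae1 => w [_ ->]; rewrite ltry.
have [_ [x0 Hx0] _] : exists2 y : 'rV[R]_(m + m), polar (graph_of f) !=set0 & `|y - 0| < 1.
  apply: (supp_dense (p := fun=> polar (graph_of f) !=set0) supp mY) => //.
  by apply: filterS ae1 => w [Hw _]; eexists; exact: Hw.
have le y : (gap (polar (graph_of f)) y <= gap (graph_of f) y)%E.
  by apply/gap_le => x Hx; exact: polar_gap.
have finH y : gap (polar (graph_of f)) y \is a fin_num.
  rewrite fin_real//; apply/andP; split.
    by apply: lt_le_trans (gap_ge y Hx0); rewrite ltNyr.
  by apply: le_lt_trans (le y) _; have := fin y; rewrite fin_numElt => /andP[].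
have E : forall y, gap (polar (graph_of f)) y = gap (graph_of f) y.
  apply: (gap_supp_eq supp mY finH fin); apply: filterS ae1 => w [Hw ew].
  by apply/eqP; rewrite eq_le le ew; exact: gap_ge.
have sub : graph_of f `<=` polar (graph_of f).
  move=> x Gx; apply/gap_le0; rewrite -E; apply/gap_le0 => y Hy.
  by rewrite Sform_subC; exact: Hy.
split=> //; split=> [x y|G' mG' HG']; first exact: polar_monotone.
apply/seteqP; split => // x G'x g Gg; apply: mG' => //.
by apply: HG'; exact: sub.
Qed.

(** The martingale map of f is a primal certificate: its value equals the dual value of the polar of
    the graph, which is therefore minimal. Another minimiser gives equality with the same map, so
    its gap agrees with that of the graph, and a maximal set is recovered from its gap as its
    polar. *)
Lemma equilibria_dual_optimal (R : realType) d (T : measurableType d)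
    (P : probability T R) m
    (U V Rv Q : T -> 'rV[R]_m) (f g : 'rV[R]_m -> 'rV[R]_m) :
  L2 P U -> L2 P V -> Y_equilibrium P U V Rv f -> Y_equilibrium P U V Q g ->
  supp_law P (pairY U V) = setT ->
  (exists H, dual_optimal P (pairY U V) H /\
     (forall H', dual_optimal P (pairY U V) H' -> H' = H) /\
     graph_of f `<=` H /\ graph_of g `<=` H) /\
  cont_points f = cont_points g /\
  (forall u, cont_points f u -> f u = g u).
Proof.
move=> LU LV eqf eqg supp.
have [finf gapf maxf subf] := equilibrium_polar LU LV eqf supp.
have [fing gapg maxg subg] := equilibrium_polar LU LV eqg supp.
have [_ [aefg _]] := equilibria_equality LU LV eqf eqg.
have [h [_ _ aZ eZ _]] := equilibrium_dual LU LV eqf.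
have LY : L2 P (pairY U V) by exact: L2_row.
have Efg := gap_supp_eq supp LY.1 finf fing aefg.
have pfg := polar_gapE Efg.
rewrite -pfg in subg.
have [h1 h2] : (forall u, cont_points f u -> f u = g u /\ cont_points g u) /\
    (forall u, cont_points g u -> g u = f u /\ cont_points f u).
  by split; exact: monotone_cont_points maxf.1 _ _.
split; last first.
  split; last by move=> u /h1[].
  by apply/seteqP; split=> u; [move/h1 => []|move/h2 => []].
have finc := L2_Sform_fin LY.
have dvH : dual_value P (pairY U V) (polar (graph_of f)) =
  (\int[P]_w (kap (fun w => row_mx (h (Rv w)) (f (Rv w))) (pairY U V) w)%:E +
   \int[P]_w (Sform (pairY U V w) (pairY U V w) / 2)%:E)%E.
  rewrite dual_value_gap//; last by move=> z; exact: gap_maximal_ge0.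
  by rewrite -eZ; congr (_ + _)%E; apply: eq_integral => w _; rewrite gapf.
exists (polar (graph_of f)); split; last split => //.
  split => // G mG; rewrite dvH dual_value_gap//; last by move=> z; exact: gap_maximal_ge0.
  by apply: leeD2r; apply: weak_dualityT => // z; exact: gap_maximal_ge0.
move=> H' [mH' optH'].
have H'0 z : (0 <= gap H' z)%E by exact: gap_maximal_ge0.
have := optH' _ maxf; rewrite dvH dual_value_gap// leeD2rE// => le.
have ae1 := dual_equality aZ H'0 le.
have leZ : (\int[P]_w gap (graph_of f) (pairY U V w) <=
  \int[P]_w (kap (fun w => row_mx (h (Rv w)) (f (Rv w))) (pairY U V) w)%:E)%E by rewrite eZ.
have ae2 := dual_equality aZ (gap_graph_ge0 f) leZ.
have finH' y : gap H' y \is a fin_num.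
  rewrite ge0_fin_numE//; apply: (gap_supp_fin supp LY.1).
  by apply: filterS ae1 => w [_ ->]; rewrite ltry.
rewrite -(polar_maximal mH'); apply: polar_gapE; apply: (gap_supp_eq supp LY.1 finH' finf).
by apply: filterS2 ae1 ae2 => w [_ ->] [_ ->].
Qed.

(** * Laws, optimal maps and optimal plans *)

Lemma same_law_integral (R : realType) d1 d2 d3 (T1 : measurableType d1)
    (T2 : measurableType d2) (S : measurableType d3) (P1 : probability T1 R)
    (P2 : probability T2 R) (Y1 : T1 -> S) (Y2 : T2 -> S) (F : S -> \bar R) :
  measurable_fun setT Y1 -> measurable_fun setT Y2 ->
  (forall B, measurable B -> P1 (Y1 @^-1` B) = P2 (Y2 @^-1` B)) ->
  measurable_fun setT F ->
  (\int[P1]_w F (Y1 w) = \int[P2]_w F (Y2 w))%E.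
Proof.
move=> m1 m2 E mF.
have ge0 (H : S -> \bar R) : measurable_fun setT H -> (forall s, (0 <= H s)%E) ->
    (\int[P1]_w H (Y1 w) = \int[P2]_w H (Y2 w))%E.
  move=> mH H0.
  have h1 := ge0_integral_pushforward m1 P1 measurableT mH (fun s _ => H0 s).
  have h2 := ge0_integral_pushforward m2 P2 measurableT mH (fun s _ => H0 s).
  rewrite !preimage_setT in h1 h2; rewrite -[LHS]h1 -[RHS]h2.
  by apply: eq_measure_integral => A mA _; exact: E.
rewrite [LHS]integralE [RHS]integralE; congr (_ - _)%E.
  transitivity (\int[P1]_w (F^\+ (Y1 w)))%E; first by apply: eq_integral => w _; rewrite !funeposE.
  rewrite (ge0 (F^\+)%E (measurable_funepos mF) (fun s => funepos_ge0 F s)).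
  by apply: eq_integral => w _; rewrite !funeposE.
transitivity (\int[P1]_w (F^\- (Y1 w)))%E; first by apply: eq_integral => w _; rewrite !funenegE.
rewrite (ge0 (F^\-)%E (measurable_funeneg mF) (fun s => funeneg_ge0 F s)).
by apply: eq_integral => w _; rewrite !funenegE.
Qed.

Lemma same_law_integral_in (R : realType) d1 d2 d3 (T1 : measurableType d1)
    (T2 : measurableType d2) (S : measurableType d3) (P1 : probability T1 R)
    (P2 : probability T2 R) (Y1 : T1 -> S) (Y2 : T2 -> S) (F : S -> \bar R) (B : set S) :
  measurable_fun setT Y1 -> measurable_fun setT Y2 ->
  (forall B, measurable B -> P1 (Y1 @^-1` B) = P2 (Y2 @^-1` B)) ->
  measurable B -> measurable_fun setT F ->
  (\int[P1]_(w in Y1 @^-1` B) F (Y1 w) = \int[P2]_(w in Y2 @^-1` B) F (Y2 w))%E.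
Proof.
move=> m1 m2 E mB mF; rewrite [LHS]integral_mkcond [RHS]integral_mkcond.
apply: (@same_law_integral R _ _ _ T1 T2 S P1 P2 Y1 Y2 (F \_ B)) => //.
by apply/(measurable_restrict _ mB measurableT); exact: measurable_funS mF.
Qed.

Lemma same_law_integrable (R : realType) d1 d2 d3 (T1 : measurableType d1)
    (T2 : measurableType d2) (S : measurableType d3) (P1 : probability T1 R)
    (P2 : probability T2 R) (Y1 : T1 -> S) (Y2 : T2 -> S) (F : S -> \bar R) :
  measurable_fun setT Y1 -> measurable_fun setT Y2 ->
  (forall B, measurable B -> P1 (Y1 @^-1` B) = P2 (Y2 @^-1` B)) ->
  measurable_fun setT F ->
  P1.-integrable setT (fun w => F (Y1 w)) -> P2.-integrable setT (fun w => F (Y2 w)).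
Proof.
move=> m1 m2 E mF /integrableP[_ lt]; apply/integrableP; split.
  exact: (measurableT_comp mF m2).
move: lt; rewrite (same_law_integral m1 m2 E (F := fun s => `|F s|%E))//.
exact: measurableT_comp.
Qed.

(** Doob-Dynkin factorisation. Each event X_i > q with q rational is Y in B (i, q), and phi recovers
    X_i as the supremum of the rationals q with Y in B (i, q); [fine] assigns some real value off
    the range of Y. *)
Lemma meas_wrt_fun (R : realType) d (T : measurableType d) n k
    (Y : T -> 'rV[R]_n) (X : T -> 'rV[R]_k) : meas_wrt Y X ->
  exists2 phi : 'rV[R]_n -> 'rV[R]_k, borel_fun phi & forall w, X w = phi (Y w).
Proof.
move=> mX.
have hB (iq : 'I_k * rat) : exists B : set 'rV[R]_n, borel_rV B /\
    forall w, (ratr iq.2 < X w 0 iq.1) <-> B (Y w).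
  have [|B [bB E]] := mX [set x | ratr iq.2 < x 0 iq.1].
    by apply: borel_open; apply: open_gt_fun; exact: coord_continuous.
  exists B; split => // w; have : (X @^-1` [set x | ratr iq.2 < x 0 iq.1]) w = (Y @^-1` B) w.
    by rewrite E.
  by rewrite /preimage /= => ->.
have [B hB'] := choice hB.
pose F i y : \bar R := ereal_sup [set (ratr q)%:E | q in [set q : rat | B (i, q) y]].
exists (fun y => \row_i fine (F i y)).
  apply: borel_fun_rvec => i.
  have -> : (fun x : 'rV[R]_n => (\row_i0 fine (F i0 x)) 0 i) = fine \o F i.
    by apply/funext => y; rewrite mxE.
  apply: (measurableT_comp (@fine_measurable R setT measurableT)).
  apply: (@measurability _ _ (BV R n) _ setT _ _ (ErealGenOInfty.measurableE R)).
  move=> _ [_ [r ->] <-]; rewrite setTI.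
  rewrite (_ : _ @^-1` _ =
    \bigcup_(q : rat) (if r < ratr q then B (i, q) else set0)).
    apply: bigcupT_measurable_rat => q; case: ifP => _; last exact: measurable0.
    by have [bB _] := hB' (i, q); exact: bB.
  apply/seteqP; split => y /=.
    rewrite in_itv/= andbT => /ereal_sup_gt[_ [q Bq <-]]; rewrite lte_fin => h.
    by exists q => //; rewrite h.
  move=> [q _]; case: ifPn => // h Bq; rewrite in_itv/= andbT.
  apply: (@lt_le_trans _ _ (ratr q)%:E); first by rewrite lte_fin.
  by apply: ereal_sup_ubound; exists q.
move=> w; apply/rowP => i; rewrite mxE.
suff -> : F i (Y w) = (X w 0 i)%:E by [].
apply/eqP; rewrite eq_le; apply/andP; split.
  apply: ub_ereal_sup => _ [q Bq <-]; rewrite lee_fin.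
  by apply/ltW; have [_ /(_ w) h] := hB' (i, q); apply/h.
apply/lee_addgt0Pr => e e0.
have [q] := @rat_in_itvoo R (X w 0 i - e) (X w 0 i) ltac:(lra).
rewrite in_itv/= => /andP[q1 q2].
have Bq : ((ratr q)%:E <= F i (Y w))%E.
  by apply: ereal_sup_ubound; exists q => //; have [_ /(_ w) h] := hB' (i, q); apply/h.
apply: le_trans (leeD Bq (lexx _)); rewrite -EFinD lee_fin; lra.
Qed.

Lemma measure_ae_eq (R : realType) d (T : measurableType d) (P : probability T R)
    (A B : set T) : measurable A -> measurable B ->
  {ae P, forall w, A w <-> B w} -> P A = P B.
Proof.
have le (C D : set T) : measurable C -> measurable D ->
    {ae P, forall w, C w <-> D w} -> (P C <= P D)%E.
  move=> mC mD [N [mN N0 sub]].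
  apply: (@le_trans _ _ (P (D `|` N))).
    apply: le_measure; rewrite ?inE//; first exact: measurableU.
    move=> w Cw; have [Dw|nD] := pselect (D w); [by left|right; apply: sub => h].
    by apply: nD; apply/h.
  by rewrite measureU0.
move=> mA mB E; apply/eqP; rewrite eq_le; apply/andP; split; apply: le => //.
by apply: filterS E => w h; split=> /h.
Qed.

(** * Equality cases under the no-mass conditions *)

Lemma maximiser_gap (R : realType) m (G A : set 'rV[R]_(m + m)) y a :
  A a -> (forall x, A x -> ((- Sform (x - y) (x - y) / 2)%:E <= gap G y)%E) ->
  gap G y = (- Sform (a - y) (a - y) / 2)%:E ->
  maximiser (fun x => Sform x x / 2) A (Smap y) a.
Proof.
move=> Aa le E; split => // x Ax; have := le x Ax; rewrite E lee_fin.
rewrite -!Sform_Smap !Sform_lin (SformC y x) (SformC y a); clear; lra.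
Qed.

(* The conditions (A1), (A2), (A3). *)
Definition no_mass (R : realType) d (T : measurableType d) (P : probability T R) m
    (Y : T -> 'rV[R]_(m + m)) : Prop :=
  [/\ forall (j : 'I_(m + m)) (C : set 'rV[R]_(m + m)),
        compact C -> C `<=` [set x : 'rV[R]_(m + m) | x 0 j = 1 /\ 0 < Sform x x] ->
        forall h, in_H j C h -> {ae P, forall w, h (Smap (Y w)) <> 0},
      m = 1%N -> forall w0 : 'rV[R]_(m + m), S_isotropic w0 ->
        continuous (fun r : R => fine (P [set w | Sform (Y w) w0 <= r])) &
      (1 < m)%N -> forall D : set 'rV[R]_(m + m), E0 D -> P (Y @^-1` D) = 0%E].

(** By [polar_gap] and [gap_closure], gap G y bounds the same functional on polar G and on closure
    G, so points attaining it are maximisers over these two closed sets with equal values. *)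
Lemma gap_attained_unique (R : realType) d (T : measurableType d) (P : probability T R) m
    (Y : T -> 'rV[R]_(m + m)) (G : set 'rV[R]_(m + m)) :
  rvec Y -> no_mass P Y -> (forall y, (0 <= gap G y)%E) ->
  exists N, [/\ borel_rV N, P (Y @^-1` N) = 0%E &
    forall y a b, ~ N y -> polar G a -> closure G b ->
      gap G y = (- Sform (a - y) (a - y) / 2)%:E ->
      gap G y = (- Sform (b - y) (b - y) / 2)%:E -> a = b].
Proof.
move=> mY [A1 A2 A3] G0.
have [N [bN PN hN]] := maximisers_unique mY (@polar_closed _ _ G) (@closed_closure _ G)
  (fun a b Pa cb => cross_closure Pa cb) A1 A2 A3.
exists N; split => // y a b nN Pa cb Ea Eb; apply: (hN y) => //.
- by apply: (maximiser_gap _ _ Ea) => // x Px; exact: polar_gap.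
- by apply: (maximiser_gap _ _ Eb) => // x cx; exact: gap_closure.
have : - Sform (a - y) (a - y) / 2 = - Sform (b - y) (b - y) / 2.
  by apply: EFin_inj; rewrite -Ea.
clear; rewrite -!Sform_Smap !Sform_lin (SformC y a) (SformC y b); lra.
Qed.

(** Z attains the gap from the polar and (Rv, f(Rv)) attains it from the graph. This serves for the
    map built from E[U | Rv], for the other equilibrium, and for any optimal map. *)
Lemma equilibrium_unique (R : realType) d (T : measurableType d) (P : probability T R) m
    (U V Rv : T -> 'rV[R]_m) (f : 'rV[R]_m -> 'rV[R]_m) (Z : T -> 'rV[R]_(m + m)) :
  L2 P U -> L2 P V -> Y_equilibrium P U V Rv f -> no_mass P (pairY U V) ->
  martingale P Z (pairY U V) ->
  (\int[P]_w gap (graph_of f) (pairY U V w) <= \int[P]_w (kap Z (pairY U V) w)%:E)%E ->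
  {ae P, forall w, Z w = row_mx (Rv w) (f (Rv w))}.
Proof.
move=> LU LV eqf nm aZ leZ.
have [h [_ _ _ _ aeX]] := equilibrium_dual LU LV eqf.
have G0 := gap_graph_ge0 f.
have mY : rvec (pairY U V) by have [_ [] ] := aZ.
have [N [bN PN hN]] := gap_attained_unique mY nm G0.
have aeN : {ae P, forall w, ~ N (pairY U V w)}.
  exists (pairY U V @^-1` N); split => //; first exact: rvec_borel.
  by move=> w /= /contrapT.
apply: filterS3 (dual_equality aZ G0 leZ) aeX aeN => w [Pw Ew] Xw nN.
apply: (hN (pairY U V w)) => //.
by apply: subset_closure; exists (Rv w).
Qed.

(** The two pairs may live on different probability spaces, which is what comparing maps with plans
    requires. *)
Lemma kap_le_value (R : realType) d1 d2 (T1 : measurableType d1) (T2 : measurableType d2)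
    (P1 : probability T1 R) (P2 : probability T2 R) m
    (X1 Y1 : T1 -> 'rV[R]_(m + m)) (X2 Y2 : T2 -> 'rV[R]_(m + m)) :
  martingale P1 X1 Y1 -> martingale P2 X2 Y2 ->
  (\int[P1]_w (Sform (Y1 w) (Y1 w) / 2)%:E = \int[P2]_w (Sform (Y2 w) (Y2 w) / 2)%:E)%E ->
  (\int[P1]_w (kap X1 Y1 w)%:E <= \int[P2]_w (kap X2 Y2 w)%:E)%E =
  (\int[P1]_w (Sform (X1 w) (Y1 w) / 2)%:E <= \int[P2]_w (Sform (X2 w) (Y2 w) / 2)%:E)%E.
Proof.
move=> a1 a2 E; rewrite !kap_value// E leeD2rE// fin_numN; apply: L2_Sform_fin.
by have [_ ] := a2.
Qed.

Lemma admissible_map_martingale (R : realType) d (T : measurableType d) (P : probability T R) m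
    (X Y : T -> 'rV[R]_(m + m)) : L2 P Y -> admissible_map P Y X -> martingale P X Y.
Proof. by move=> LY [LX _ [_ [_ ce]]]. Qed.

Lemma martingale_admissible_map (R : realType) d (T : measurableType d) (P : probability T R) m
    (X Y : T -> 'rV[R]_(m + m)) : martingale P X Y -> meas_wrt Y X -> admissible_map P Y X.
Proof.
move=> [LX _ ce] mX; split => //; split; first exact: LX.1.
by split => // i; exact: L2_integrable.
Qed.

(** Uniqueness applied to the equilibrium's own map (E[U | Rv], f(Rv)) identifies E[U | Rv] with
    Rv. *)
Lemma equilibrium_martingale (R : realType) d (T : measurableType d) (P : probability T R) m
    (U V Rv : T -> 'rV[R]_m) (f : 'rV[R]_m -> 'rV[R]_m) :
  L2 P U -> L2 P V -> Y_equilibrium P U V Rv f -> no_mass P (pairY U V) ->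
  martingale P (fun w => row_mx (Rv w) (f (Rv w))) (pairY U V).
Proof.
move=> LU LV eqf nm; have [LR _ bf [_ [_ ceV]] _] := eqf.
have [h [Lf ceU aZ eZ _]] := equilibrium_dual LU LV eqf.
have aeZ : {ae P, forall w, row_mx (h (Rv w)) (f (Rv w)) = row_mx (Rv w) (f (Rv w))}.
  by apply: (equilibrium_unique LU LV eqf nm aZ); rewrite eZ.
have bF : borel_fun (fun r : 'rV[R]_m => row_mx r (f r)) by apply: borel_fun_row.
split; [exact: L2_row|exact: L2_row|move=> B bB k].
have bB' := bF _ bB.
rewrite (_ : (fun w => row_mx (Rv w) (f (Rv w))) @^-1` B =
  Rv @^-1` ((fun r : 'rV[R]_m => row_mx r (f r)) @^-1` B))//.
case: (split_ordP k) => i ->; rewrite /pairY.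
  under eq_integral do rewrite row_mxEl.
  under [in RHS]eq_integral do rewrite row_mxEl.
  have LhR : L2 P (fun w => h (Rv w)).
    have [LZ _ _] := aZ; have := L2_lsubmx LZ.
    by under eq_fun do rewrite row_mxKl.
  have mB' : measurable (Rv @^-1` ((fun r : 'rV[R]_m => row_mx r (f r)) @^-1` B)).
    by apply: rvec_borel => //; exact: LR.1.
  rewrite ceU//; apply: ae_eq_integral => //.
  - by apply: measurable_funTS; apply/measurable_EFinP; exact: LhR.1.
  - by apply: measurable_funTS; apply/measurable_EFinP; exact: LR.1.
  - by apply: filterS aeZ => w /eq_row_mx[-> _].
under eq_integral do rewrite row_mxEr.
under [in RHS]eq_integral do rewrite row_mxEr.
exact: ceV.
Qed.

Lemma equilibrium_kap (R : realType) d (T : measurableType d) (P : probability T R) m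
    (U V Rv : T -> 'rV[R]_m) (f : 'rV[R]_m -> 'rV[R]_m) :
  L2 P U -> L2 P V -> Y_equilibrium P U V Rv f -> no_mass P (pairY U V) ->
  (\int[P]_w gap (graph_of f) (pairY U V w) =
   \int[P]_w (kap (fun w => row_mx (Rv w) (f (Rv w))) (pairY U V) w)%:E)%E.
Proof.
move=> LU LV eqf nm; have [LX LY _] := equilibrium_martingale LU LV eqf nm.
have [h [_ _ _ _ aeX]] := equilibrium_dual LU LV eqf.
apply: ae_eq_integral => //; first exact: (gapY_measurable _ LY.1).
  by have /integrableP[] := kap_integrable LX LY.
by apply: filterS aeX => w E _.
Qed.

Lemma equilibrium_optimal_map (R : realType) d (T : measurableType d)
    (P : probability T R) m
    (U V Rv : T -> 'rV[R]_m) (f : 'rV[R]_m -> 'rV[R]_m) :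
  L2 P U -> L2 P V -> Y_equilibrium P U V Rv f -> no_mass P (pairY U V) ->
  unique_optimal_map P (pairY U V) (fun w => row_mx (Rv w) (f (Rv w))).
Proof.
move=> LU LV eqf nm; have [_ mR bf _ _] := eqf.
have aX := equilibrium_martingale LU LV eqf nm; have [_ LY _] := aX.
have eX := equilibrium_kap LU LV eqf nm.
have bF : borel_fun (fun r : 'rV[R]_m => row_mx r (f r)) by apply: borel_fun_row.
have aX' : admissible_map P (pairY U V) (fun w => row_mx (Rv w) (f (Rv w))).
  by apply: martingale_admissible_map => // B bB; exact: mR (bF _ bB).
split.
  split => // X' /(admissible_map_martingale LY) adX'.
  rewrite /map_value -(kap_le_value adX' aX)// -eX.
  by apply: weak_dualityT => // z; exact: gap_graph_ge0.
move=> X' [/(admissible_map_martingale LY) adX' opt].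
apply: (equilibrium_unique LU LV eqf nm adX').
by rewrite eX (kap_le_value aX adX')//; exact: opt.
Qed.

Lemma plan_martingale (R : realType) d (T : measurableType d) (P : probability T R) m
    (Y : T -> 'rV[R]_(m + m)) (gam : probability (pairspace R m) R) :
  admissible_plan P Y gam ->
  martingale gam (fun z : pairspace R m => z.1) (fun z : pairspace R m => z.2).
Proof.
move=> [int _ ce].
have sq0 (z : pairspace R m) k : 0 <= z.1 0 k ^+ 2 + z.2 0 k ^+ 2.
  by rewrite addr_ge0// sqr_ge0.
have bd (z : pairspace R m) k :
    z.1 0 k ^+ 2 + z.2 0 k ^+ 2 <= \sum_(k < m + m) (z.1 0 k ^+ 2 + z.2 0 k ^+ 2).
  by rewrite (bigD1 k)//= lerDl sumr_ge0.
split => //.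
- split => [|k]; first exact: rvec_fst.
  apply: le_integrable int => //.
    by apply/measurable_EFinP; apply: measurable_funX; exact: (@rvec_fst R m k).
  move=> z _ /=; rewrite lee_fin !ger0_norm ?sqr_ge0//; last by rewrite sumr_ge0.
  by apply: le_trans (bd z k); rewrite lerDl sqr_ge0.
- split => [|k]; first exact: rvec_snd.
  apply: le_integrable int => //.
    by apply/measurable_EFinP; apply: measurable_funX; exact: (@rvec_snd R m k).
  move=> z _ /=; rewrite lee_fin !ger0_norm ?sqr_ge0//; last by rewrite sumr_ge0.
  by apply: le_trans (bd z k); rewrite lerDr sqr_ge0.
Qed.

Lemma law_admissible_plan (R : realType) d (T : measurableType d) (P : probability T R) m
    (X Y : T -> 'rV[R]_(m + m)) : martingale P X Y ->
  exists gam : probability (pairspace R m) R,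
    [/\ admissible_plan P Y gam, plan_value gam = map_value P Y X &
        forall A, gam A = law_pair P X Y A].
Proof.
move=> [LX LY ce].
pose XY : T -> pairspace R m := fun w => (X w, Y w).
have mXY : measurable_fun setT XY by exact: measurable_pair LX.1 LY.1.
pose Xm : {mfun T >-> pairspace R m} :=
  HB.pack XY (isMeasurableFun.Build _ _ _ _ XY mXY).
pose gam : probability (pairspace R m) R := distribution P Xm.
have mid : measurable_fun setT (fun z : pairspace R m => z) by exact: measurable_id.
have law (B : set (pairspace R m)) : measurable B ->
  P (XY @^-1` B) = gam ((fun z : pairspace R m => z) @^-1` B) by [].
have m1 k : measurable_fun setT (fun z : pairspace R m => (z.1 0 k)%:E).
  by apply/measurable_EFinP; exact: (@rvec_fst R m k).
have m2 k : measurable_fun setT (fun z : pairspace R m => (z.2 0 k)%:E).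
  by apply/measurable_EFinP; exact: (@rvec_snd R m k).
exists gam; split => //; last first.
  rewrite /plan_value /map_value.
  rewrite -(same_law_integral mXY mid law
    (F := fun z : pairspace R m => (Sform z.1 z.2 / 2)%:E))//.
  apply/measurable_EFinP; apply: continuous_pairspace.
  apply: continuous_mulf; last exact: cst_continuous.
  by apply: continuous_Sform => z; [exact: cvg_fst|exact: cvg_snd].
split => //.
- apply: (same_law_integrable mXY mid law (F := fun z : pairspace R m =>
     (\sum_(k < m + m) (z.1 0 k ^+ 2 + z.2 0 k ^+ 2))%:E)).
    apply/measurable_EFinP; apply: measurable_sum => k.
    by apply: measurable_funD; apply: measurable_funX; [exact: (@rvec_fst R m k)|exact: (@rvec_snd R m k)].
  rewrite (_ : (fun w => _) = (fun w => \sum_(k < m + m) ((X w 0 k ^+ 2)%:E + (Y w 0 k ^+ 2)%:E))%E).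
    apply: integrable_sum => // k _.
    by apply: integrableD => //; [exact: LX.2|exact: LY.2].
  by apply/funext => w; rewrite -sumEFin.
- move=> A bA k.
  have mA : measurable ([set z : pairspace R m | A z.1] : set (pairspace R m)).
    by apply: (rvec_borel (@rvec_fst R m)).
  have := same_law_integral_in mXY mid law mA (m2 k).
  have := same_law_integral_in mXY mid law mA (m1 k).
  by move=> <- <-; exact: ce.
Qed.

(* [X = phi (Y)] by measurability, so optimality of a plan forces it onto the graph of
   [phi], and such a plan is determined by its second marginal. *)
Lemma equilibrium_optimal_plan (R : realType) d (T : measurableType d)
    (P : probability T R) m
    (U V Rv : T -> 'rV[R]_m) (f : 'rV[R]_m -> 'rV[R]_m) :
  L2 P U -> L2 P V -> Y_equilibrium P U V Rv f -> no_mass P (pairY U V) ->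
  unique_optimal_plan P (pairY U V) (fun w => row_mx (Rv w) (f (Rv w))).
Proof.
move=> LU LV eqf nm.
pose G := graph_of f; pose Y := pairY U V.
pose X w := row_mx (Rv w) (f (Rv w)).
have G0 := gap_graph_ge0 f.
have aX : martingale P X Y := equilibrium_martingale LU LV eqf nm.
have eX : (\int[P]_w gap G (Y w) = \int[P]_w (kap X Y w)%:E)%E :=
  equilibrium_kap LU LV eqf nm.
have [LX LY _] := aX.
have mY := rvec_measurable LY.1.
have msnd := rvec_measurable (@rvec_snd R m).
have marg (gam : probability (pairspace R m) R) : admissible_plan P Y gam ->
    forall B : set (BV R (m + m)), measurable B ->
    P (Y @^-1` B) = gam ((fun z : pairspace R m => z.2) @^-1` B).
  by move=> [_ mg _] B bB; rewrite -mg.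
have margS gam (ad : admissible_plan P Y gam) : (\int[P]_w (Sform (Y w) (Y w) / 2)%:E =
    \int[gam]_z (Sform (z : pairspace R m).2 z.2 / 2)%:E)%E.
  apply: (same_law_integral mY msnd (marg _ ad)
    (F := fun y : BV R (m + m) => (Sform y y / 2)%:E)).
  apply/measurable_EFinP; apply: continuous_measurable => //.
  by apply: continuous_mulf; [exact: continuous_Sq|exact: cst_continuous].
have margG gam (ad : admissible_plan P Y gam) :
    (\int[P]_w gap G (Y w) = \int[gam]_z gap G (z : pairspace R m).2)%E.
  by apply: (same_law_integral mY msnd (marg _ ad)); exact: gap_measurable.
have [gam0 [ad0 val0 law0]] := law_admissible_plan aX.
have opt0 : optimal_plan P Y gam0.
  split => // gam ad; rewrite val0 /plan_value /map_value.
  rewrite -(kap_le_value (plan_martingale ad) aX) -?margS// -eX (margG _ ad).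
  by apply: (weak_dualityT (plan_martingale ad)).
split; first by exists gam0; split.
move=> gam [ad opt] A mA.
have le : (\int[gam]_z gap G (z : pairspace R m).2 <=
    \int[gam]_z (kap (fun z : pairspace R m => z.1) (fun z : pairspace R m => z.2) z)%:E)%E.
  rewrite -margG// eX (kap_le_value aX (plan_martingale ad)) -?margS//.
  by have := opt _ ad0; rewrite val0.
have ae1 := dual_equality (plan_martingale ad) G0 le.
have [_ mR bf _ _] := eqf.
have bF : borel_fun (fun r : 'rV[R]_m => row_mx r (f r)) by apply: borel_fun_row.
have mX : meas_wrt Y X by move=> B bB; exact: mR (bF _ bB).
have [phi bphi XE] := meas_wrt_fun mX.
have [N [bN PN hN]] := gap_attained_unique LY.1 nm G0.
have rphi : rvec (fun y : BV R (m + m) => phi y) by move=> i; exact: borel_fun_coord.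
have rid : rvec (fun y : BV R (m + m) => (y : 'rV[R]_(m + m))).
  by move=> i; apply: continuous_measurable => //; exact: coord_continuous.
(* The points y at which phi y attains the gap from the closed graph. It is a condition on y alone,
   so it passes from the law of Y to [gam] through the second marginal; [dual_equality] makes z.1
   attain the gap from the polar, and uniqueness gives z.1 = phi z.2. *)
pose E := [set y : BV R (m + m) | closure G (phi y)] `&`
  [set y | gap G y = (- Sform (phi y - y) (phi y - y) / 2)%:E].
have mE : measurable E.
  apply: measurableI.
    by apply: (rvec_borel rphi); apply: borel_closed; exact: closed_closure.
  rewrite -[X in measurable X]setTI; apply: measurable_eqe => //; first exact: gap_measurable.
  apply/measurable_EFinP.
  have rs : rvec (fun y : BV R (m + m) => phi y - (y : 'rV[R]_(m + m))).
    move=> i; have -> : (fun y : BV R (m + m) => (phi y - (y : 'rV[R]_(m + m))) 0 i) =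
        (fun y : BV R (m + m) => phi y 0 i - (y : 'rV[R]_(m + m)) 0 i).
      by apply/funext => y; rewrite mxE; congr (_ + _); rewrite mxE.
    by apply: measurable_funB; [exact: rphi|exact: rid].
  apply: (rvec_cont (h := fun x => - Sform x x / 2) rs).
  apply: continuous_mulf; last exact: cst_continuous.
  by apply: continuous_oppf; exact: continuous_Sq.
have PE : P (Y @^-1` ~` E) = 0%E.
  have [h [_ _ _ _ [N' [mN' N'0 sub]]]] := equilibrium_dual LU LV eqf.
  apply: (@subset_measure0 _ _ _ P _ N') => //.
    by apply: (rvec_borel LY.1); apply/borelE; exact: measurableC.
  move=> w nE; apply: sub => Ew; apply: nE; split => /=; rewrite -XE.
    by apply: subset_closure; exists (Rv w).
  exact: Ew.
have aeE : {ae gam, forall z : pairspace R m, E z.2}.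
  exists ((fun z : pairspace R m => z.2) @^-1` ~` E); split => //.
    by apply: (rvec_borel (@rvec_snd R m)); apply/borelE; exact: measurableC.
  by rewrite -marg//; exact: measurableC.
have aeN : {ae gam, forall z : pairspace R m, ~ N z.2}.
  exists ((fun z : pairspace R m => z.2) @^-1` N); split => //.
  - exact: (rvec_borel (@rvec_snd R m)).
  - by rewrite -marg.
  - by move=> z /= /contrapT.
have aephi : {ae gam, forall z : pairspace R m, z.1 = phi z.2}.
  apply: filterS3 ae1 aeE aeN => z [Pz Ez] [cz Ez'] nN.
  exact: (hN z.2).
pose A' := [set y : BV R (m + m) | A ((phi y, y) : pairspace R m)].
have mA' : measurable A'.
  by rewrite -[A']setTI; apply: (measurable_pair rphi rid).
transitivity (gam ((fun z : pairspace R m => z.2) @^-1` A')).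
  apply: measure_ae_eq => //; first exact: (rvec_borel (@rvec_snd R m)).
  by apply: filterS aephi => -[x y] /= ->.
rewrite -marg// /law_pair; congr (P _); apply/seteqP.
by split => w /=; rewrite /A' /= -XE.
Qed.

Theorem theorem10 (R : realType) (d : measure_display) (T : measurableType d)
  (P : probability T R) (m : nat) (U V : T -> 'rV[R]_m)
  (Rv Q : T -> 'rV[R]_m) (f g : 'rV[R]_m -> 'rV[R]_m) :
  L2 P U -> L2 P V ->
  Y_equilibrium P U V Rv f -> Y_equilibrium P U V Q g ->
  let Y := pairY U V in
  (* (a) *)
  {ae P, forall w, dotv (Rv w - U w) (V w - f (Rv w)) =
                   dotv (Q w - U w) (V w - g (Q w))} /\
  (* (b) *)
  (supp_law P Y = setT ->
     (exists H, dual_optimal P Y H /\ (forall H', dual_optimal P Y H' -> H' = H) /\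
                graph_of f `<=` H /\ graph_of g `<=` H) /\
     cont_points f = cont_points g /\
     (forall u, cont_points f u -> f u = g u)) /\
  (* (c) *)
  (interior (conv_hull (supp_law P Y)) !=set0 ->
   (* (A1) *)
   (forall (j : 'I_(m + m)) (C : set 'rV[R]_(m + m)),
      compact C -> C `<=` [set x : 'rV[R]_(m + m) | x 0 j = 1 /\ 0 < Sform x x] ->
      forall h, in_H j C h -> {ae P, forall w, h (Smap (Y w)) <> 0}) ->
   (* (A2) *)
   (m = 1%N -> forall w0 : 'rV[R]_(m + m), S_isotropic w0 ->
      continuous (fun r : R => fine (P [set w | Sform (Y w) w0 <= r]))) ->
   (* (A3) *)
   ((1 < m)%N -> forall D : set 'rV[R]_(m + m), E0 D -> P (Y @^-1` D) = 0%E) ->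
   {ae P, forall w, f (Rv w) = g (Q w)} /\
   ((monotone_map f /\ monotone_map g) \/
      {ae P, forall w, interior (supp_law P Y) (Y w)} ->
    {ae P, forall w, Rv w = Q w} /\
    let X := fun w => row_mx (Rv w) (f (Rv w)) in
    unique_optimal_map P Y X /\ unique_optimal_plan P Y X)).
Proof.
move=> LU LV eqf eqg Y; have [eqa [_ eqi]] := equilibria_equality LU LV eqf eqg.
split => //; split; first exact: equilibria_dual_optimal LU LV eqf eqg.
move=> _ A1 A2 A3; have nm : no_mass P Y by [].
(* (Q, g(Q)) is itself a martingale map, and the equal dual values of the two graphs make it attain
   that of f, so uniqueness for f applies to it. *)
have aefg : {ae P, forall w, row_mx (Q w) (g (Q w)) = row_mx (Rv w) (f (Rv w))}.
  apply: (equilibrium_unique LU LV eqf nm (equilibrium_martingale LU LV eqg nm)).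
  by rewrite eqi (equilibrium_kap LU LV eqg nm).
split; first by apply: filterS aefg => w /eq_row_mx[].
move=> _; split; first by apply: filterS aefg => w /eq_row_mx[].
split; first exact: equilibrium_optimal_map LU LV eqf nm.
exact: equilibrium_optimal_plan LU LV eqf nm.
Qed.
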